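(* Let $X$ (respectively $\eta$) be a surface given, as described in the context, by a holomorphic function $g$ with $g'\neq0$, a nonzero real constant $c$ and a differentiable function $h$, so that $X=Y-\frac{2(h+c)}{S}\eta$ with $Y=\pi_-^{-1}\circ g$ and $\eta=\nabla_Lh+hY$. Then $X$ is an $H_1$-surface of rotation (respectively $\eta$ is a minimal surface of rotation) if and only if $g(z)=e^z$ and $$h=a_1-\big(a_2+a_1(u-1)\big)\tanh u,\qquad z=u+iv,\quad a_1,a_2\in\mathbb{R}.$$ In this case, the surfaces $X$ and $\eta$ can be locally parameterized by $$X(u,v)=\big(M(u)\cos v,\;M(u)\sin v,\;N(u)\big),\qquad \eta(u,v)=\big(M_1(u)\cos v,\;M_1(u)\sin v,\;N_1(u)\big),$$ where $$M(u)=\frac{2e^u\{4a_2^2e^{2u}+2a_2a_1l_1+a_1[-2c(1+e^{2u})^2+a_1l_2]\}}{(1+e^{2u})\big[4a_2^2e^{2u}+8a_1a_2e^{2u}(u-1)+a_1^2\big(1+e^{4u}+e^{2u}(6-8u+4u^2)\big)\big]},$$ $$N(u)=\frac{4a_2e^{2u}p_1-8a_1e^{2u}p_2+a_1^2p_3}{(1+e^{2u})\big[4a_2^2e^{2u}+8a_2a_1e^{2u}(u-1)+a_1^2\big(1+e^{4u}+e^{2u}(6-8u+4u^2)\big)\big]},$$ $$M_1(u)=a_1\left(\frac{1+e^{2u}}{2e^u}\right),\qquad N_1(u)=a_2+a_1(u-1),$$ with $$l_1=e^{4u}+4e^{2u}(u-1)-1,\qquad l_2=1-2u+e^{4u}(2u-3)+e^{2u}(2-8u+4u^2),$$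 $$p_1=a_2(e^{2u}-1)-2c(1+e^{2u}),\qquad p_2=c(1+e^{2u})(u-1)+a_2\big(u-e^{2u}(u-2)\big),$$ $$p_3=1-e^{6u}+e^{2u}(5-4u^2)+e^{4u}(11-16u+4u^2).$$
   Context: Setting. Identify $\mathbb{R}^2=\mathbb{C}$ and $\mathbb{R}^3=\mathbb{C}\times\mathbb{R}$. Let $g:\mathbb{C}\to\mathbb{C}_\infty$ be holomorphic with $g'\neq0$, let $\pi_-^{-1}:\mathbb{C}\to\mathbb{S}^2\setminus\{-e_3\}$ be the inverse of stereographic projection, let $U\subset\mathbb{R}^2$ be open, $T=1+|g|^2$, and $Y=\pi_-^{-1}\circ g=\frac1T(2g,\,2-T):U\to\mathbb{S}^2$. Then $L_{ij}=\langle Y_{,i},Y_{,j}\rangle=\frac{4|g'|^2}{T^2}\delta_{ij}$. An immersion $X:\Sigma\to\mathbb{R}^3$ of a Riemann surface $\Sigma$ with Gauss map $\mathcal N$ and $\langle X,\mathcal N\rangle\neq1$ everywhere can be locally parameterized by $X=Y-\frac{2(h+c)}{S}\eta$, where $c$ is a nonzero real constant, $h:U\to\mathbb{R}$ is a nowhere-vanishing differentiable function, and $$\eta=\nabla_Lh+hY,\qquad \nabla_L h=\frac{T^2}{4|g'|^2}(h_{,1}Y_{,1}+h_{,2}Y_{,2}),\qquad S=\langle\eta,\eta\rangle=|\nabla_Lh|^2+h^2;$$ in these coordinates the Gauss map is $\mathcal N=Y-\frac{2h}{S}\eta$ (written $\mathcal N$ to distinguish it from the profile function $N(u)$). The map $\eta:U\to\mathbb{R}^3$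 defines a surface with unit normal $Y$. Curvatures. Let $\Psi=\langle X,\mathcal N\rangle$, $R=\frac{1-|X|^2}{2(\Psi-1)}$ (radius function of the sphere congruence having $X$ and the unit sphere as envelopes; one has $h=-\frac{c}{R+1}$), let $k_1,k_2$ be the principal curvatures (eigenvalues of $-d\mathcal N$), $s_i=\frac{1+k_i}{1-k_iR}$, and $H_S=\frac12(s_1+s_2)$ (spherical mean curvature). $X$ is an $H_1$-surface if $H_S=0$.
   Formalization: ''Surface of rotation'' means locally about the x3-axis, off the axis; ''g(z)=e^z and h=…'' holds up to a local holomorphic change of z, with common a1, a2 on connected U; ''differentiable'' means smooth. Literally false: g=e^{2z}, or a translated catenoid. *)

(* Defs.v *)
From Stdlib Require Import Reals.
From Coquelicot Require Import Coquelicot.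
Open Scope R_scope.

(* The parameter plane is Coquelicot's C = R * R, with z = (u, v) = u + iv.
   R^3 is R * R * R with the componentwise vector-space structure provided by
   Coquelicot (plus, minus, opp, scal, zero). *)
Definition R3 : Type := (R * R * R)%type.

Definition coord1 (p : R3) : R := fst (fst p).
Definition coord2 (p : R3) : R := snd (fst p).
Definition coord3 (p : R3) : R := snd p.

Definition dot (p q : R3) : R :=
  coord1 p * coord1 q + coord2 p * coord2 q + coord3 p * coord3 q.

Definition dom_connected (U : C -> Prop) : Prop :=
  forall A B : C -> Prop, open A -> open B ->
    (forall z, U z -> A z \/ B z) ->
    (forall z, U z -> A z -> B z -> False) ->
    (exists z, U z /\ A z) -> (exists z, U z /\ B z) -> False.

Definition pd1 (f : C -> R) (z : C) : R := Derive (fun t => f (t, snd z)) (fst z).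
Definition pd2 (f : C -> R) (z : C) : R := Derive (fun t => f (fst z, t)) (snd z).

Definition D1 (F : C -> R3) (z : C) : R3 :=
  (pd1 (fun w => coord1 (F w)) z, pd1 (fun w => coord2 (F w)) z,
   pd1 (fun w => coord3 (F w)) z).
Definition D2 (F : C -> R3) (z : C) : R3 :=
  (pd2 (fun w => coord1 (F w)) z, pd2 (fun w => coord2 (F w)) z,
   pd2 (fun w => coord3 (F w)) z).

Definition differential (F : C -> R3) (z : C) (e : R * R) : R3 :=
  plus (scal (fst e) (D1 F z)) (scal (snd e) (D2 F z)).

Fixpoint Ck_on (k : nat) (U : C -> Prop) (f : C -> R) : Prop :=
  match k with
  | O => forall z, U z -> continuous f z
  | S k' =>
      (forall z, U z -> ex_derive (fun t => f (t, snd z)) (fst z)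
                     /\ ex_derive (fun t => f (fst z, t)) (snd z)) /\
      Ck_on k' U (pd1 f) /\ Ck_on k' U (pd2 f)
  end.

(* "Differentiable" is used in the sense of differential geometry: C^infinity. *)
Definition smooth_on (U : C -> Prop) (f : C -> R) : Prop :=
  forall k, Ck_on k U f.

(* Complex differentiable at every point of the open set U.  Smoothness of the
   real and imaginary parts is automatic (Goursat, Cauchy); that theorem is in
   neither library, so it is recorded in the definition. *)
Definition holomorphic_on (U : C -> Prop) (g : C -> C) : Prop :=
  (forall z, U z -> is_derive g z (C_derive g z)) /\
  smooth_on U (fun z => Re (g z)) /\ smooth_on U (fun z => Im (g z)).

Definition Cexp (z : C) : C :=
  (exp (Re z) * cos (Im z), exp (Re z) * sin (Im z)).

Definition immersion_on (U : C -> Prop) (F : C -> R3) : Prop :=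
  forall z, U z -> forall e : R * R,
    differential F z e = zero -> e = (0, 0).

(* For a surface F with unit normal field N: k1, k2 are the eigenvalues of the
   shape operator -dN, with (independent) eigenvectors e1, e2. *)
Definition principal_curvatures (F N : C -> R3) (z : C) (k1 k2 : R) : Prop :=
  exists e1 e2 : R * R,
    fst e1 * snd e2 - snd e1 * fst e2 <> 0 /\
    opp (differential N z e1) = scal k1 (differential F z e1) /\
    opp (differential N z e2) = scal k2 (differential F z e2).

Definition minimal_on (U : C -> Prop) (F N : C -> R3) : Prop :=
  forall z, U z -> exists k1 k2 : R,
    principal_curvatures F N z k1 k2 /\ (k1 + k2) / 2 = 0.

Definition support (F N : C -> R3) (z : C) : R := dot (F z) (N z).

Definition radius (F N : C -> R3) (z : C) : R :=
  (1 - dot (F z) (F z)) / (2 * (support F N z - 1)).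

Definition spherical_curvature (k rho : R) : R := (1 + k) / (1 - k * rho).

(* Division is total in R, so the denominators of the spherical curvatures are
   required to be nonzero. *)
Definition H1_surface_on (U : C -> Prop) (F N : C -> R3) : Prop :=
  forall z, U z -> exists k1 k2 : R,
    principal_curvatures F N z k1 k2 /\
    1 - k1 * radius F N z <> 0 /\ 1 - k2 * radius F N z <> 0 /\
    (spherical_curvature k1 (radius F N z)
     + spherical_curvature k2 (radius F N z)) / 2 = 0.

(* The point of R^3 obtained by rotating the profile point (m, n) by the angle
   v about the x3-axis. *)
Definition rotation_point (m n v : R) : R3 := (m * cos v, m * sin v, n).

(* phi is a diffeomorphism from the open set W onto an open subset of U. *)
Definition change_of_parameters (W U : C -> Prop) (phi : C -> C) : Prop :=
  open W /\
  smooth_on W (fun w => Re (phi w)) /\ smooth_on W (fun w => Im (phi w)) /\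
  (forall w, W w -> U (phi w)) /\
  (forall w w', W w -> W w' -> phi w = phi w' -> w = w') /\
  (forall w, W w ->
     pd1 (fun x => Re (phi x)) w * pd2 (fun x => Im (phi x)) w
     - pd2 (fun x => Re (phi x)) w * pd1 (fun x => Im (phi x)) w <> 0).

(* Near each of its points the surface is obtained, in suitable parameters
   (u, v), by rotating a profile curve (M, N) about the x3-axis; this is the
   axis singled out by the normalization g(z) = e^z. *)
Definition surface_of_rotation_on (U : C -> Prop) (F : C -> R3) : Prop :=
  forall z0, U z0 ->
    exists (W : C -> Prop) (phi : C -> C) (M N : R -> R),
      change_of_parameters W U phi /\
      (exists w0, W w0 /\ phi w0 = z0) /\
      forall w, W w -> F (phi w) = rotation_point (M (Re w)) (N (Re w)) (Im w).

Definition Tfun (g : C -> C) (z : C) : R := 1 + Cmod (g z) ^ 2.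

Definition Ymap (g : C -> C) (z : C) : R3 :=
  (2 * Re (g z) / Tfun g z, 2 * Im (g z) / Tfun g z, (2 - Tfun g z) / Tfun g z).

Definition gradL (g : C -> C) (h : C -> R) (z : C) : R3 :=
  scal (Tfun g z ^ 2 / (4 * Cmod (C_derive g z) ^ 2))
    (plus (scal (pd1 h z) (D1 (Ymap g) z)) (scal (pd2 h z) (D2 (Ymap g) z))).

Definition eta (g : C -> C) (h : C -> R) (z : C) : R3 :=
  plus (gradL g h z) (scal (h z) (Ymap g z)).

Definition Sfun (g : C -> C) (h : C -> R) (z : C) : R :=
  dot (eta g h z) (eta g h z).

Definition Xmap (g : C -> C) (c : R) (h : C -> R) (z : C) : R3 :=
  minus (Ymap g z) (scal (2 * (h z + c) / Sfun g h z) (eta g h z)).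

Definition Nmap (g : C -> C) (h : C -> R) (z : C) : R3 :=
  minus (Ymap g z) (scal (2 * h z / Sfun g h z) (eta g h z)).

Definition conformal_parameter (W U : C -> Prop) (psi : C -> C) : Prop :=
  open W /\ holomorphic_on W psi /\
  (forall w, W w -> U (psi w)) /\
  (forall w w', W w -> W w' -> psi w = psi w' -> w = w') /\
  (forall w, W w -> C_derive psi w <> 0%C).

Definition h_profile (a1 a2 u : R) : R := a1 - (a2 + a1 * (u - 1)) * tanh u.

(* In the conformal parameter z = u + iv given by psi, the data (g, h) read
   g(z) = e^z and h = h_profile a1 a2 u. *)
Definition normal_parameter (a1 a2 : R) (W U : C -> Prop) (g : C -> C)
    (h : C -> R) (psi : C -> C) : Prop :=
  conformal_parameter W U psi /\
  forall z, W z -> g (psi z) = Cexp z /\ h (psi z) = h_profile a1 a2 (Re z).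

(* The prescribed form holds up to the choice of the conformal parameter:
   near each point one can introduce a normal parameter, with the same
   constants a1, a2 throughout U. *)
Definition normal_form_on (a1 a2 : R) (U : C -> Prop) (g : C -> C)
    (h : C -> R) : Prop :=
  forall z0, U z0 -> exists (W : C -> Prop) (psi : C -> C),
    normal_parameter a1 a2 W U g h psi /\ exists w0, W w0 /\ psi w0 = z0.

Definition l1 (u : R) : R := exp (4 * u) + 4 * exp (2 * u) * (u - 1) - 1.

Definition l2 (u : R) : R :=
  1 - 2 * u + exp (4 * u) * (2 * u - 3) + exp (2 * u) * (2 - 8 * u + 4 * u ^ 2).

Definition p1 (c a2 u : R) : R :=
  a2 * (exp (2 * u) - 1) - 2 * c * (1 + exp (2 * u)).

Definition p2 (c a2 u : R) : R :=
  c * (1 + exp (2 * u)) * (u - 1) + a2 * (u - exp (2 * u) * (u - 2)).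

Definition p3 (u : R) : R :=
  1 - exp (6 * u) + exp (2 * u) * (5 - 4 * u ^ 2)
  + exp (4 * u) * (11 - 16 * u + 4 * u ^ 2).

Definition profile_den (a1 a2 u : R) : R :=
  (1 + exp (2 * u)) *
  (4 * a2 ^ 2 * exp (2 * u) + 8 * a1 * a2 * exp (2 * u) * (u - 1)
   + a1 ^ 2 * (1 + exp (4 * u) + exp (2 * u) * (6 - 8 * u + 4 * u ^ 2))).

Definition M_profile (c a1 a2 u : R) : R :=
  2 * exp u *
  (4 * a2 ^ 2 * exp (2 * u) + 2 * a2 * a1 * l1 u
   + a1 * (- 2 * c * (1 + exp (2 * u)) ^ 2 + a1 * l2 u))
  / profile_den a1 a2 u.

Definition N_profile (c a1 a2 u : R) : R :=
  (4 * a2 * exp (2 * u) * p1 c a2 u - 8 * a1 * exp (2 * u) * p2 c a2 u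
   + a1 ^ 2 * p3 u)
  / profile_den a1 a2 u.

Definition M1_profile (a1 u : R) : R := a1 * ((1 + exp (2 * u)) / (2 * exp u)).

Definition N1_profile (a1 a2 u : R) : R := a2 + a1 * (u - 1).

(* Main.v *)
(* In the moving frame of the unit normal [Y], both the minimality of [eta] and the condition [H_S = 0]
   for [X] say that [A = Hess_L h + h I] is trace free: the spherical curvatures [s_i] of [X] satisfy
   [A e_i = (s_i S / (2 h)) e_i], because [dX + R dN] and [dX - dN] are, up to factors, the images of [dY]
   and [d eta] under the reflection in the plane orthogonal to [eta].  In isothermal coordinates this is
   the linear equation [h_11 + h_22 + 2 E h = 0] with [E = 4 |g'|^2 / T^2], which is invariant under
   conformal changes of the parameter.

   If one of the surfaces is rotational, so are its normal field and [Y] (for [X] through the centres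
   [X + R N = (1 + R) Y]), and [h] depends on the profile parameter only.  Hence [g] is [r(u) e^(iv)] in the
   rotation parameters, and inverting the one-variable function [ln |r|] yields a conformal parameter in
   which [g = e^z] and [h = h(u)].  The equation becomes [h'' + 2 (1 - tanh^2 u) h = 0], whose solutions
   are the profiles [h_profile a1 a2].  The constants are recovered from [eta] and [Y] by smooth
   expressions, so they agree throughout the connected set [U]. *)
Require Import Defs.
From Stdlib Require Import Reals.
From Coquelicot Require Import Coquelicot.
From Stdlib Require Import Lra Psatz Classical FunctionalExtensionality Ranalysis5.
Open Scope R_scope.

(** * Differentiable functions of two real variables *)

(** The map [eta] already contains first derivatives of [h] and of [Y], and its differential is
    never expanded in coordinates. Only the scalar identities <eta, Y> = h and <eta, Y_i> = h_i are
    differentiated, and the single second-order fact about [Y] that enters is Y_11 + Y_22 = - 2 E Y,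
    the harmonicity of a conformal map into the sphere.

    The obstacle on the way from rotation to the normal form is regularity. The profile curve of a
    surface of rotation is a pair of arbitrary functions, the unit normal might a priori change sign
    along a parallel, and the inverse of ln |r| is only known to be differentiable. So the profiles
    are recovered as components of smooth maps along a slice, the normal is shown to be constant in
    the rotating frame by differentiation, and smoothness of the new parameter is regained from its
    Cauchy-Riemann system.

    The shape of [h_profile] comes from the two solutions 1 - u tanh u and tanh u of the linear
    equation, whose Wronskian is 1; their coefficients are a1 and a1 - a2. *)

Definition dif (f : C -> R) (z : C) (a b : R) : Prop :=
  filterdiff (K := R_AbsRing) (U := C_R_NormedModule) (V := R_NormedModule)
    f (locally z) (fun w => fst w * a + snd w * b).

Lemma dif_ext_loc (f f' : C -> R) (z : C) (a b : R) :
  locally z (fun w => f w = f' w) -> dif f z a b -> dif f' z a b.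
Proof. intros H K; exact (filterdiff_ext_locally (K := R_AbsRing) (U := C_R_NormedModule) f f' z _ H K). Qed.

Lemma dif_eq (f : C -> R) (z : C) (a b a' b' : R) :
  dif f z a b -> a = a' -> b = b' -> dif f z a' b'.
Proof. intros H -> ->; exact H. Qed.

Lemma dif_const (k : R) (z : C) : dif (fun _ => k) z 0 0.
Proof.
  unfold dif. eapply (filterdiff_ext_lin (K:=R_AbsRing) (U:=C_R_NormedModule) (V:=R_NormedModule));
      [refine (filterdiff_const (K:=R_AbsRing) (U:=C_R_NormedModule) (V:=R_NormedModule) k)|].
  intros [x y]; cbn. unfold zero; cbn. ring.
Qed.

Lemma dif_fst (z : C) : dif (fun w => fst w) z 1 0.
Proof.
  unfold dif. eapply (filterdiff_ext_lin (K:=R_AbsRing) (U:=C_R_NormedModule) (V:=R_NormedModule)).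
  - refine (filterdiff_linear (K:=R_AbsRing) (U:=C_R_NormedModule) (V:=R_NormedModule) _ _). apply
      (is_linear_fst (K:=R_AbsRing) (U:=R_NormedModule) (V:=R_NormedModule)).
  - intros [x y]; cbn; ring.
Qed.

Lemma dif_snd (z : C) : dif (fun w => snd w) z 0 1.
Proof.
  unfold dif. eapply (filterdiff_ext_lin (K:=R_AbsRing) (U:=C_R_NormedModule) (V:=R_NormedModule)).
  - refine (filterdiff_linear (K:=R_AbsRing) (U:=C_R_NormedModule) (V:=R_NormedModule) _ _). apply
      (is_linear_snd (K:=R_AbsRing) (U:=R_NormedModule) (V:=R_NormedModule)).
  - intros [x y]; cbn; ring.
Qed.

Lemma dif_plus (f f' : C -> R) (z : C) (a b a' b' : R) :
  dif f z a b -> dif f' z a' b' ->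
  dif (fun w => f w + f' w) z (a + a') (b + b').
Proof.
  intros H H'. unfold dif.
  eapply (filterdiff_ext_lin (K:=R_AbsRing) (U:=C_R_NormedModule) (V:=R_NormedModule));
      [refine (filterdiff_plus_fct _ _ _ _ H H')|].
  intros [x y]; cbn. unfold plus; cbn. ring.
Qed.

Lemma dif_mult (f f' : C -> R) (z : C) (a b a' b' : R) :
  dif f z a b -> dif f' z a' b' ->
  dif (fun w => f w * f' w) z (a * f' z + f z * a') (b * f' z + f z * b').
Proof.
  intros H H'. unfold dif.
  eapply (filterdiff_ext_lin (K:=R_AbsRing) (U:=C_R_NormedModule) (V:=R_NormedModule));
      [refine (filterdiff_mult_fct _ _ _ _ _ Rmult_comm H H')|].
  intros [x y]; cbn. unfold plus, mult; cbn. ring.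
Qed.

Lemma dif_comp1 (k : R -> R) (f : C -> R) (z : C) (a b l : R) :
  is_derive k (f z) l -> dif f z a b -> dif (fun w => k (f w)) z (l * a) (l * b).
Proof.
  intros H H'. unfold dif.
  eapply (filterdiff_ext_lin (K:=R_AbsRing) (U:=C_R_NormedModule) (V:=R_NormedModule));
      [refine (filterdiff_comp' _ _ _ _ _ H' H)|].
  intros [x y]; cbn. unfold scal; cbn. unfold mult; cbn. ring.
Qed.

Lemma dif_inv (f : C -> R) (z : C) (a b : R) :
  f z <> 0 -> dif f z a b -> dif (fun w => / f w) z (- a / (f z) ^ 2) (- b / (f z) ^ 2).
Proof.
  intros H0 H.
  eapply dif_eq; [apply (dif_comp1 Rinv f z a b (- / (f z) ^ 2)); [|exact H]| |].
  - auto_derive; auto. field. exact H0.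
  - field; exact H0.
  - field; exact H0.
Qed.

Lemma dif_comp (f P Q : C -> R) (z : C) (a b p1 p2 q1 q2 : R) :
  dif f (P z, Q z) a b -> dif P z p1 p2 -> dif Q z q1 q2 ->
  dif (fun w => f (P w, Q w)) z (a * p1 + b * q1) (a * p2 + b * q2).
Proof.
  intros H HP HQ. unfold dif.
  assert (H' : filterdiff (K := R_AbsRing)
     (U := prod_NormedModule R_AbsRing R_NormedModule R_NormedModule)
     (V := R_NormedModule) (fun t => (fun x y => f (x, y)) (fst t) (snd t))
     (locally (P z, Q z)) (fun t => (fun x y => x * a + y * b) (fst t) (snd t))).
  { eapply filterdiff_ext; [|exact H]. intros [x y]; reflexivity. }
  eapply (filterdiff_ext_lin (K:=R_AbsRing) (U:=C_R_NormedModule) (V:=R_NormedModule));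
      [refine (filterdiff_comp'_2 (K:=R_AbsRing) (T:=C_R_NormedModule) (U:=R_NormedModule)
      (V:=R_NormedModule) (W:=R_NormedModule) P Q (fun x y => f (x, y)) z _ _ _ HP HQ H')|].
  intros [x y]; cbn. ring.
Qed.

Lemma dif_path (f : C -> R) (P Q : R -> R) (t a b p q : R) :
  dif f (P t, Q t) a b -> is_derive P t p -> is_derive Q t q ->
  is_derive (fun s => f (P s, Q s)) t (a * p + b * q).
Proof.
  intros H HP HQ.
  assert (H' : filterdiff (K := R_AbsRing)
     (U := prod_NormedModule R_AbsRing R_NormedModule R_NormedModule)
     (V := R_NormedModule) (fun t => (fun x y => f (x, y)) (fst t) (snd t))
     (locally (P t, Q t)) (fun t => (fun x y => x * a + y * b) (fst t) (snd t))).
  { eapply filterdiff_ext; [|exact H]. intros [x y]; reflexivity. }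
  unfold is_derive.
  eapply filterdiff_ext_lin;
      [refine (filterdiff_comp'_2 (K:=R_AbsRing) (T:=R_NormedModule) (U:=R_NormedModule)
      (V:=R_NormedModule) (W:=R_NormedModule) P Q (fun x y => f (x, y)) t _ _ _ HP HQ H')|].
  intros x; cbn. unfold scal; cbn; unfold mult; cbn. ring.
Qed.

Lemma dif_is_derive1 (f : C -> R) (z : C) (a b : R) :
  dif f z a b -> is_derive (fun t => f (t, snd z)) (fst z) a.
Proof.
  intros H. destruct z as [x y]; cbn.
  evar_last; [apply (dif_path f (fun t => t) (fun _ => y) x a b 1 0 H)|ring].
  - apply (is_derive_id (K:=R_AbsRing)).
  - apply (is_derive_const (K:=R_AbsRing)(V:=R_NormedModule)).
Qed.

Lemma dif_is_derive2 (f : C -> R) (z : C) (a b : R) :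
  dif f z a b -> is_derive (fun t => f (fst z, t)) (snd z) b.
Proof.
  intros H. destruct z as [x y]; cbn.
  evar_last; [apply (dif_path f (fun _ => x) (fun t => t) y a b 0 1 H)|ring].
  - apply (is_derive_const (K:=R_AbsRing)(V:=R_NormedModule)).
  - apply (is_derive_id (K:=R_AbsRing)).
Qed.

Lemma dif_pd1 (f : C -> R) (z : C) (a b : R) : dif f z a b -> pd1 f z = a.
Proof. intros H. apply is_derive_unique. exact (dif_is_derive1 f z a b H). Qed.

Lemma dif_pd2 (f : C -> R) (z : C) (a b : R) : dif f z a b -> pd2 f z = b.
Proof. intros H. apply is_derive_unique. exact (dif_is_derive2 f z a b H). Qed.

Lemma dif_continuous (f : C -> R) (z : C) (a b : R) : dif f z a b -> continuous f z.
Proof.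
  intros H. apply (filterdiff_continuous (K:=R_AbsRing)(U:=C_R_NormedModule)(V:=R_NormedModule)).
  eexists; exact H.
Qed.

(** * Passing between the classes [Ck_on] and total differentials *)

Lemma locally_slice1 (P : C -> Prop) (z : C) :
  locally z P -> locally (fst z) (fun t => P (t, snd z)).
Proof.
  intros [e He]. exists e. intros t Ht. apply He. split; [exact Ht|apply ball_center].
Qed.

Lemma locally_slice2 (P : C -> Prop) (z : C) :
  locally z P -> locally (snd z) (fun t => P (fst z, t)).
Proof.
  intros [e He]. exists e. intros t Ht. apply He. split; [apply ball_center|exact Ht].
Qed.

(** [Ck_on] speaks of partial derivatives only, which do not suffice for a chain rule. Total
    differentiability follows from the existence of both partials near z and the continuity of the
    first one. *)
Lemma Ck1_dif (U : C -> Prop) (f : C -> R) (z : C) :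
  open U -> Ck_on 1 U f -> U z -> dif f z (pd1 f z) (pd2 f z).
Proof.
  intros HU [Hd [H1 H2]] Hz.
  assert (K : filterdiff (fun u : R * R => (fun x y => f (x,y)) (fst u) (snd u)) (locally (fst z, snd z))
     (fun u : R * R => plus (scal (fst u) (pd1 f (fst z, snd z))) (scal (snd u) (pd2 f z)))).
  { apply (is_derive_filterdiff (fun x y => f (x,y)) (fst z) (snd z) (fun x y => pd1 f (x,y)) (pd2 f z)).
    - rewrite <- surjective_pairing. apply filter_imp with U; [|exact (HU z Hz)].
      intros w Hw. rewrite <- surjective_pairing. apply Derive_correct, (Hd w Hw).
    - apply Derive_correct, (Hd z Hz).
    - rewrite <- surjective_pairing.
      apply continuous_ext with (pd1 f); [intros [x y]; reflexivity|apply H1, Hz]. }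
  unfold dif. rewrite <- surjective_pairing in K.
  eapply filterdiff_ext; [|eapply filterdiff_ext_lin; [exact K|]].
  - intros [x y]; reflexivity.
  - intros [x y]; reflexivity.
Qed.

(** [Ck_on (S k)] does not mention continuity of [f] itself; at the bottom level it comes from total
    differentiability. *)
Lemma Ck_on_pred (k : nat) (U : C -> Prop) (f : C -> R) :
  open U -> Ck_on (S k) U f -> Ck_on k U f.
Proof.
  intros HU; revert f; induction k as [|k IH]; intros f H.
  - intros z Hz. eapply dif_continuous, Ck1_dif; eauto.
  - destruct H as [Hd [H1 H2]]. split; [exact Hd|split; apply IH; assumption].
Qed.

Lemma pd1_ext_loc (f f' : C -> R) (z : C) :
  locally z (fun w => f w = f' w) -> pd1 f z = pd1 f' z.
Proof. intros H. apply Derive_ext_loc. exact (locally_slice1 _ _ H). Qed.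

Lemma pd2_ext_loc (f f' : C -> R) (z : C) :
  locally z (fun w => f w = f' w) -> pd2 f z = pd2 f' z.
Proof. intros H. apply Derive_ext_loc. exact (locally_slice2 _ _ H). Qed.

Lemma eq_locally (U : C -> Prop) (f f' : C -> R) (z : C) :
  open U -> (forall w, U w -> f w = f' w) -> U z -> locally z (fun w => f w = f' w).
Proof. intros HU H Hz. apply filter_imp with U; [exact H|exact (HU z Hz)]. Qed.

Lemma Ck_on_ext (k : nat) (U : C -> Prop) (f f' : C -> R) :
  open U -> (forall w, U w -> f w = f' w) -> Ck_on k U f -> Ck_on k U f'.
Proof.
  intros HU; revert f f'; induction k as [|k IH]; intros f f' E H.
  - intros z Hz. eapply continuous_ext_loc; [|apply H, Hz].
    eapply eq_locally; eauto.
  - destruct H as [Hd [H1 H2]]. repeat split.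
    + eapply ex_derive_ext_loc; [|apply (Hd z H)].
      apply (locally_slice1 (fun w => f w = f' w)). eapply eq_locally; eauto.
    + eapply ex_derive_ext_loc; [|apply (Hd z H)].
      apply (locally_slice2 (fun w => f w = f' w)). eapply eq_locally; eauto.
    + apply (IH (pd1 f)); [|exact H1]. intros w Hw. apply pd1_ext_loc. eapply eq_locally; eauto.
    + apply (IH (pd2 f)); [|exact H2]. intros w Hw. apply pd2_ext_loc. eapply eq_locally; eauto.
Qed.

(** The induction step for every closure property below: an explicit differential valid on all of
    [U] reduces the claim to its two coefficients. *)
Lemma Ck_on_S_dif (k : nat) (U : C -> Prop) (f a b : C -> R) :
  open U -> (forall z, U z -> dif f z (a z) (b z)) ->
  Ck_on k U a -> Ck_on k U b -> Ck_on (S k) U f.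
Proof.
  intros HU Hd Ha Hb. repeat split.
  - eexists; eapply dif_is_derive1, Hd; assumption.
  - eexists; eapply dif_is_derive2, Hd; assumption.
  - apply Ck_on_ext with a; auto. intros w Hw. symmetry; eapply dif_pd1, Hd, Hw.
  - apply Ck_on_ext with b; auto. intros w Hw. symmetry; eapply dif_pd2, Hd, Hw.
Qed.

Lemma Ck_on_S_inv (k : nat) (U : C -> Prop) (f : C -> R) :
  open U -> Ck_on (S k) U f ->
  (forall z, U z -> dif f z (pd1 f z) (pd2 f z)) /\
  Ck_on k U f /\ Ck_on k U (pd1 f) /\ Ck_on k U (pd2 f).
Proof.
  intros HU H. split; [|split; [apply Ck_on_pred; assumption|exact (proj2 H)]].
  intros z Hz. apply (Ck1_dif U); auto.
  clear Hz z. revert f H; induction k as [|k IH]; intros f H; auto.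
  apply IH, Ck_on_pred; auto.
Qed.

Lemma Ck_on_const (k : nat) (U : C -> Prop) (c : R) : open U -> Ck_on k U (fun _ => c).
Proof.
  intros HU; revert c; induction k as [|k IH]; intros c.
  - intros z _. apply continuous_const.
  - apply (Ck_on_S_dif k U _ (fun _ => 0) (fun _ => 0)); auto. intros; apply dif_const.
Qed.

Lemma Ck_on_plus (k : nat) (U : C -> Prop) (f f' : C -> R) :
  open U -> Ck_on k U f -> Ck_on k U f' -> Ck_on k U (fun w => f w + f' w).
Proof.
  intros HU; revert f f'; induction k as [|k IH]; intros f f' H H'.
  - intros z Hz. apply (continuous_plus f f'); auto.
  - apply Ck_on_S_inv in H; auto. apply Ck_on_S_inv in H'; auto.
    decompose [and] H; decompose [and] H'.
    eapply (Ck_on_S_dif k U); auto.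
    + intros z Hz. apply dif_plus; auto.
    + apply IH; auto.
    + apply IH; auto.
Qed.

Lemma Ck_on_mult (k : nat) (U : C -> Prop) (f f' : C -> R) :
  open U -> Ck_on k U f -> Ck_on k U f' -> Ck_on k U (fun w => f w * f' w).
Proof.
  intros HU; revert f f'; induction k as [|k IH]; intros f f' H H'.
  - intros z Hz. apply (continuous_mult f f'); auto.
  - apply Ck_on_S_inv in H; auto. apply Ck_on_S_inv in H'; auto.
    decompose [and] H; decompose [and] H'.
    eapply (Ck_on_S_dif k U); auto.
    + intros z Hz. apply dif_mult; auto.
    + cbn beta. apply Ck_on_plus; auto.
    + cbn beta. apply Ck_on_plus; auto.
Qed.

Lemma Ck_on_inv (k : nat) (U : C -> Prop) (f : C -> R) :
  open U -> (forall z, U z -> f z <> 0) -> Ck_on k U f -> Ck_on k U (fun w => / f w).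
Proof.
  intros HU H0; induction k as [|k IH]; intros H.
  - intros z Hz. apply (continuous_comp f Rinv); auto.
    apply (ex_derive_continuous (K:=R_AbsRing)(V:=R_NormedModule)). auto_derive. auto.
  - apply Ck_on_S_inv in H; auto. decompose [and] H.
    (* The derivative is written with products of [/ f w] instead of a quotient by [f w ^ 2], so
       that the induction hypothesis applies to its factors. *)
    eapply (Ck_on_S_dif k U _ (fun w => (-1) * pd1 f w * (/ f w * / f w))
       (fun w => (-1) * pd2 f w * (/ f w * / f w))); auto.
    + intros z Hz. eapply dif_eq; [apply dif_inv; auto| |]; field; auto.
    + apply Ck_on_mult; auto using Ck_on_mult, Ck_on_const.
    + apply Ck_on_mult; auto using Ck_on_mult, Ck_on_const.
Qed.

(** The induction is general in [f], because the chain rule replaces [f] by its partial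
    derivatives. *)
Lemma Ck_on_comp (k : nat) (U W : C -> Prop) (f P Q : C -> R) :
  open U -> open W -> (forall w, W w -> U (P w, Q w)) ->
  Ck_on k U f -> Ck_on k W P -> Ck_on k W Q -> Ck_on k W (fun w => f (P w, Q w)).
Proof.
  intros HU HW HWU; revert f; induction k as [|k IH]; intros f H HP HQ.
  - intros z Hz. apply (continuous_comp_2 P Q (fun x y => f (x, y))); auto.
    apply continuous_ext with f; [intros [x y]; reflexivity|]. apply H, HWU, Hz.
  - apply Ck_on_S_inv in H; auto. apply Ck_on_S_inv in HP; auto. apply Ck_on_S_inv in HQ; auto.
    decompose [and] H; decompose [and] HP; decompose [and] HQ.
    eapply (Ck_on_S_dif k W); auto.
    + intros z Hz. apply dif_comp; auto.
    + cbn beta. apply Ck_on_plus; auto; apply Ck_on_mult; auto;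
        exact (IH _ ltac:(assumption) ltac:(assumption) ltac:(assumption)).
    + cbn beta. apply Ck_on_plus; auto; apply Ck_on_mult; auto;
        exact (IH _ ltac:(assumption) ltac:(assumption) ltac:(assumption)).
Qed.

Lemma smooth_dif (U : C -> Prop) (f : C -> R) (z : C) :
  open U -> smooth_on U f -> U z -> dif f z (pd1 f z) (pd2 f z).
Proof. intros HU H Hz. exact (Ck1_dif U f z HU (H 1%nat) Hz). Qed.

Lemma smooth_pd1 (U : C -> Prop) (f : C -> R) : smooth_on U f -> smooth_on U (pd1 f).
Proof. intros H k. apply (H (S k)). Qed.

Lemma smooth_pd2 (U : C -> Prop) (f : C -> R) : smooth_on U f -> smooth_on U (pd2 f).
Proof. intros H k. apply (H (S k)). Qed.

Lemma smooth_Schwarz (U : C -> Prop) (f : C -> R) (z : C) :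
  open U -> smooth_on U f -> U z -> pd1 (pd2 f) z = pd2 (pd1 f) z.
Proof.
  intros HU H Hz.
  apply (Schwarz (fun x y => f (x, y)) (fst z) (snd z)).
  - apply locally_2d_locally. rewrite <- surjective_pairing.
    apply filter_imp with U; [|exact (HU z Hz)]. intros [x y] Hw.
    pose proof (H 1%nat) as [Ha _].
    pose proof (smooth_pd2 _ _ H 1%nat) as [Hb _].
    pose proof (smooth_pd1 _ _ H 1%nat) as [Hc _].
    specialize (Ha _ Hw); specialize (Hb _ Hw); specialize (Hc _ Hw). cbn in *.
    tauto.
  - apply continuity_2d_pt_filterlim. rewrite <- surjective_pairing.
    apply continuous_ext with (pd1 (pd2 f)); [intros [x y]; reflexivity|].
    exact (smooth_pd1 _ _ (smooth_pd2 _ _ H) 0%nat z Hz).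
  - apply continuity_2d_pt_filterlim. rewrite <- surjective_pairing.
    apply continuous_ext with (pd2 (pd1 f)); [intros [x y]; reflexivity|].
    exact (smooth_pd2 _ _ (smooth_pd1 _ _ H) 0%nat z Hz).
Qed.

(** * Complex derivatives *)

(** The norm of [C] as a real product module is the complex modulus, so real differentials and
    complex derivatives can be compared through the same estimate. *)
Lemma norm_minus_Cmod (w z : C) :
  @norm R_AbsRing C_R_NormedModule
    (@minus (NormedModule.AbelianGroup R_AbsRing C_R_NormedModule) w z) = Cmod (w - z)%C.
Proof.
  unfold Cmod. cbn. unfold prod_norm, norm; cbn. f_equal.
  unfold abs; cbn. rewrite !Rmult_1_r.
  rewrite <- !Rabs_mult, !Rabs_pos_eq by apply Rle_0_sqr. reflexivity.
Qed.

Lemma dif_intro (f : C -> R) (z : C) (a b : R) :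
  (forall eps : posreal, locally z (fun w =>
     Rabs (f w - f z - ((fst w - fst z) * a + (snd w - snd z) * b)) <= eps * Cmod (w - z)%C)) ->
  dif f z a b.
Proof.
  intros H. split.
  - apply (is_linear_ext (K:=R_AbsRing) (U:=C_R_NormedModule) (V:=R_NormedModule)
      (fun t => plus (scal a (fst t)) (scal b (snd t)))).
    { intros [x y]; cbn. unfold plus, scal; cbn; unfold mult; cbn. ring. }
    apply (is_linear_comp (K:=R_AbsRing) (U:=C_R_NormedModule)
      (V:=prod_NormedModule R_AbsRing R_NormedModule R_NormedModule) (W:=R_NormedModule)
      (fun t => (scal a (fst t), scal b (snd t))) (fun t => plus (fst t) (snd t))).
    + apply is_linear_prod.
      * apply (is_linear_comp (K:=R_AbsRing) (U:=C_R_NormedModule) (V:=R_NormedModule)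
          (W:=R_NormedModule) fst (fun t => scal a t)).
        -- exact (is_linear_fst (K:=R_AbsRing) (U:=R_NormedModule) (V:=R_NormedModule)).
        -- exact (is_linear_scal_r (K:=R_AbsRing) (V:=R_NormedModule) _ Rmult_comm).
      * apply (is_linear_comp (K:=R_AbsRing) (U:=C_R_NormedModule) (V:=R_NormedModule)
          (W:=R_NormedModule) snd (fun t => scal b t)).
        -- exact (is_linear_snd (K:=R_AbsRing) (U:=R_NormedModule) (V:=R_NormedModule)).
        -- exact (is_linear_scal_r (K:=R_AbsRing) (V:=R_NormedModule) _ Rmult_comm).
    + apply is_linear_plus.
  - intros x Hx.
    apply (is_filter_lim_locally_unique (K:=R_AbsRing) (V:=C_R_NormedModule)) in Hx.
    subst x. intros eps. eapply filter_imp; [|exact (H eps)].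
    intros w Hw. cbv beta in Hw |- *.
    rewrite norm_minus_Cmod. exact Hw.
Qed.

Lemma dif_elim (f : C -> R) (z : C) (a b : R) :
  dif f z a b -> forall eps : posreal, locally z (fun w =>
     Rabs (f w - f z - ((fst w - fst z) * a + (snd w - snd z) * b)) <= eps * Cmod (w - z)%C).
Proof.
  intros [_ H] eps. specialize (H z (fun P HP => HP) eps).
  eapply filter_imp; [|exact H]. intros w Hw. cbv beta in Hw.
  rewrite norm_minus_Cmod in Hw. exact Hw.
Qed.

(** [locally_C] exchanges the neighbourhoods defined by the modulus with those of the product
    structure used by [dif]. *)
Lemma C_derive_locally (g : C -> C) (z l : C) :
  is_derive g z l <->
  forall eps : posreal, locally z (fun w =>
     Cmod (g w - g z - (w - z) * l)%C <= eps * Cmod (w - z)%C).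
Proof.
  split.
  - intros [_ H] eps. specialize (H z (fun P HP => HP) eps).
    apply locally_C. exact H.
  - intros H. split.
    + apply is_linear_scal_l.
    + intros x Hx. apply (is_filter_lim_locally_unique (K:=C_AbsRing) (V:=AbsRing_NormedModule C_AbsRing))
        in Hx. subst x.
      intros eps. apply locally_C. exact (H eps).
Qed.

(** The two real remainders are the real and imaginary parts of the complex one, hence bounded by
    its modulus. *)
Lemma C_derive_dif (g : C -> C) (z l : C) :
  is_derive g z l ->
  dif (fun w => Re (g w)) z (Re l) (- Im l) /\ dif (fun w => Im (g w)) z (Im l) (Re l).
Proof.
  intros H. pose proof (proj1 (C_derive_locally g z l) H) as K.
  split; apply dif_intro; intros eps; (eapply filter_imp; [|exact (K eps)]);
    intros w Hw; (eapply Rle_trans; [|exact Hw]).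
  - eapply Rle_trans; [|apply Rmax_Cmod]. eapply Rle_trans; [|apply Rmax_l].
    right. cbn. unfold Re, Im. f_equal; ring.
  - eapply Rle_trans; [|apply Rmax_Cmod]. eapply Rle_trans; [|apply Rmax_r].
    right. cbn. unfold Re, Im. f_equal; ring.
Qed.

Lemma Cmod_le_Rabs (w : C) : Cmod w <= Rabs (Re w) + Rabs (Im w).
Proof.
  unfold Cmod. apply Rsqr_incr_0_var.
  - rewrite Rsqr_sqrt by nra. unfold Rsqr, Re, Im.
    pose proof (Rabs_pos (fst w)). pose proof (Rabs_pos (snd w)).
    pose proof (pow2_abs (fst w)). pose proof (pow2_abs (snd w)). nra.
  - pose proof (Rabs_pos (Re w)). pose proof (Rabs_pos (Im w)). lra.
Qed.

(** The converse of [C_derive_dif]: the modulus of the complex remainder is at most the sum of the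
    two real ones, each kept below eps / 2. *)
Lemma dif_C_derive (g : C -> C) (z : C) (a b : R) :
  dif (fun w => Re (g w)) z a (- b) -> dif (fun w => Im (g w)) z b a ->
  is_derive g z (a, b).
Proof.
  intros H1 H2. apply C_derive_locally. intros eps.
  pose proof (dif_elim _ _ _ _ H1 (pos_div_2 eps)) as K1.
  pose proof (dif_elim _ _ _ _ H2 (pos_div_2 eps)) as K2.
  generalize (filter_and _ _ K1 K2); apply filter_imp. intros w [Hw1 Hw2].
  eapply Rle_trans; [apply Cmod_le_Rabs|].
  replace (Re (g w - g z - (w - z) * (a, b))%C)
    with (Re (g w) - Re (g z) - ((fst w - fst z) * a + (snd w - snd z) * - b))
    by (cbn; unfold Re; ring).
  replace (Im (g w - g z - (w - z) * (a, b))%C)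
    with (Im (g w) - Im (g z) - ((fst w - fst z) * b + (snd w - snd z) * a))
    by (cbn; unfold Im; ring).
  cbn in Hw1, Hw2. lra.
Qed.

Definition Cexp_re (z : C) := exp (fst z) * cos (snd z).
Definition Cexp_im (z : C) := exp (fst z) * sin (snd z).

Lemma dif_Cexp (z : C) :
  dif Cexp_re z (Cexp_re z) (- Cexp_im z) /\ dif Cexp_im z (Cexp_im z) (Cexp_re z).
Proof.
  assert (He : dif (fun w => exp (fst w)) z (exp (fst z)) 0).
  { eapply dif_eq; [apply (dif_comp1 exp); [apply is_derive_exp|apply dif_fst]| |]; ring. }
  assert (Hc : dif (fun w => cos (snd w)) z 0 (- sin (snd z))).
  { eapply dif_eq; [apply (dif_comp1 cos); [apply is_derive_cos|apply dif_snd]| |]; ring. }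
  assert (Hs : dif (fun w => sin (snd w)) z 0 (cos (snd z))).
  { eapply dif_eq; [apply (dif_comp1 sin); [apply is_derive_sin|apply dif_snd]| |]; ring. }
  unfold Cexp_re, Cexp_im. split;
  (eapply dif_eq; [apply dif_mult; eassumption| |]); cbv beta; ring.
Qed.

(** Differentiation permutes the two functions up to sign, so one induction proves both claims. *)
Lemma Ck_Cexp (k : nat) (U : C -> Prop) :
  open U -> Ck_on k U Cexp_re /\ Ck_on k U Cexp_im.
Proof.
  intros HU. induction k as [|k [H1 H2]].
  - split; intros z _.
    + exact (dif_continuous _ _ _ _ (proj1 (dif_Cexp z))).
    + exact (dif_continuous _ _ _ _ (proj2 (dif_Cexp z))).
  - split.
    + apply (Ck_on_S_dif k U _ Cexp_re (fun z => - Cexp_im z)); auto.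
      * intros z _. exact (proj1 (dif_Cexp z)).
      * apply Ck_on_ext with (fun z => (-1) * Cexp_im z); [auto|intros; ring|].
        apply Ck_on_mult; auto using Ck_on_const.
    + apply (Ck_on_S_dif k U _ Cexp_im Cexp_re); auto.
      intros z _. exact (proj2 (dif_Cexp z)).
Qed.

(* Unfolded, [dif] is a conjunction, and [apply] and [auto] would look into it. *)
Global Opaque dif.

(** * Vector-valued maps *)

Lemma R3_ext (p q : R3) :
  coord1 p = coord1 q -> coord2 p = coord2 q -> coord3 p = coord3 q -> p = q.
Proof. destruct p as [[? ?] ?], q as [[? ?] ?]; cbn; congruence. Qed.

(** The projections commute with the vector operations by conversion; [change] pushes them inwards
    without unfolding the canonical structures. *)
Ltac coords :=
  repeat match goal with
  | |- context [coord1 (@zero ?G)] => change (coord1 (@zero G)) with 0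
  | |- context [coord2 (@zero ?G)] => change (coord2 (@zero G)) with 0
  | |- context [coord3 (@zero ?G)] => change (coord3 (@zero G)) with 0
  | |- context [coord1 (@plus ?G ?p ?q)] => change (coord1 (@plus G p q)) with (coord1 p + coord1 q)
  | |- context [coord2 (@plus ?G ?p ?q)] => change (coord2 (@plus G p q)) with (coord2 p + coord2 q)
  | |- context [coord3 (@plus ?G ?p ?q)] => change (coord3 (@plus G p q)) with (coord3 p + coord3 q)
  | |- context [coord1 (@minus ?G ?p ?q)] => change (coord1 (@minus G p q)) with (coord1 p - coord1 q)
  | |- context [coord2 (@minus ?G ?p ?q)] => change (coord2 (@minus G p q)) with (coord2 p - coord2 q)
  | |- context [coord3 (@minus ?G ?p ?q)] => change (coord3 (@minus G p q)) with (coord3 p - coord3 q)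
  | |- context [coord1 (@opp ?G ?p)] => change (coord1 (@opp G p)) with (- coord1 p)
  | |- context [coord2 (@opp ?G ?p)] => change (coord2 (@opp G p)) with (- coord2 p)
  | |- context [coord3 (@opp ?G ?p)] => change (coord3 (@opp G p)) with (- coord3 p)
  | |- context [coord1 (@scal ?K ?V ?k ?p)] => change (coord1 (@scal K V k p)) with (k * coord1 p)
  | |- context [coord2 (@scal ?K ?V ?k ?p)] => change (coord2 (@scal K V k p)) with (k * coord2 p)
  | |- context [coord3 (@scal ?K ?V ?k ?p)] => change (coord3 (@scal K V k p)) with (k * coord3 p)
  end.

Lemma dot_comm (p q : R3) : dot p q = dot q p.
Proof. unfold dot; ring. Qed.

Lemma dot_plus_l (p q r : R3) : dot (plus p q) r = dot p r + dot q r.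
Proof. unfold dot; coords; ring. Qed.

Lemma dot_scal_l (k : R) (p r : R3) : dot (scal k p) r = k * dot p r.
Proof. unfold dot; coords; ring. Qed.

Lemma dot_minus_l (p q r : R3) : dot (minus p q) r = dot p r - dot q r.
Proof. unfold dot; coords; ring. Qed.

Lemma dot_plus_r (p q r : R3) : dot r (plus p q) = dot r p + dot r q.
Proof. rewrite !(dot_comm r); apply dot_plus_l. Qed.

Lemma dot_scal_r (k : R) (p r : R3) : dot r (scal k p) = k * dot r p.
Proof. rewrite !(dot_comm r); apply dot_scal_l. Qed.

Lemma dot_minus_r (p q r : R3) : dot r (minus p q) = dot r p - dot r q.
Proof. rewrite !(dot_comm r); apply dot_minus_l. Qed.

Lemma dot_zero_l (p : R3) : dot zero p = 0.
Proof. unfold dot; coords; ring. Qed.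

Ltac dots := rewrite ?dot_plus_l, ?dot_plus_r, ?dot_minus_l, ?dot_minus_r, ?dot_scal_l, ?dot_scal_r,
  ?dot_plus_l, ?dot_plus_r, ?dot_minus_l, ?dot_minus_r, ?dot_scal_l, ?dot_scal_r,
  ?dot_plus_l, ?dot_plus_r, ?dot_minus_l, ?dot_minus_r, ?dot_scal_l, ?dot_scal_r.

Lemma dot_pos (p : R3) : p <> zero -> 0 < dot p p.
Proof.
  intros H. destruct (Rlt_or_le 0 (dot p p)) as [|K]; auto. exfalso; apply H.
  unfold dot in K. apply R3_ext; coords; nra.
Qed.

(** [D] is the triple product of y, p, q. Its square is their Gram determinant, here E^2, so D is
    nonzero, and Cramer's rule writes each w_i D as a combination of the three vanishing inner
    products. *)
Lemma orthogonal_frame_zero (y p q w : R3) (E : R) :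
  dot y y = 1 -> dot y p = 0 -> dot y q = 0 -> dot p q = 0 ->
  dot p p = E -> dot q q = E -> E <> 0 ->
  dot w y = 0 -> dot w p = 0 -> dot w q = 0 -> w = zero.
Proof.
  destruct y as [[y1 y2] y3], p as [[a1 a2] a3], q as [[b1 b2] b3], w as [[w1 w2] w3].
  unfold dot, coord1, coord2, coord3; cbn [fst snd]. intros.
  set (D := y1 * (a2 * b3 - a3 * b2) - y2 * (a1 * b3 - a3 * b1) + y3 * (a1 * b2 - a2 * b1)).
  assert (HD : D * D = E * E).
  { transitivity ((y1*y1+y2*y2+y3*y3)*((a1*a1+a2*a2+a3*a3)*(b1*b1+b2*b2+b3*b3)
        - (a1*b1+a2*b2+a3*b3)*(a1*b1+a2*b2+a3*b3))
      - (y1*a1+y2*a2+y3*a3)*((y1*a1+y2*a2+y3*a3)*(b1*b1+b2*b2+b3*b3)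
        - (a1*b1+a2*b2+a3*b3)*(y1*b1+y2*b2+y3*b3))
      + (y1*b1+y2*b2+y3*b3)*((y1*a1+y2*a2+y3*a3)*(a1*b1+a2*b2+a3*b3)
        - (a1*a1+a2*a2+a3*a3)*(y1*b1+y2*b2+y3*b3))).
    - unfold D; ring.
    - rewrite H, H0, H1, H2, H3, H4. ring. }
  assert (D <> 0) by (intros K; rewrite K in HD; nra).
  assert (w1 * D = 0).
  { transitivity ((w1*y1+w2*y2+w3*y3)*(a2*b3-a3*b2) - (w1*a1+w2*a2+w3*a3)*(y2*b3-y3*b2)
      + (w1*b1+w2*b2+w3*b3)*(y2*a3-y3*a2)); [unfold D; ring|rewrite H6, H7, H8; ring]. }
  assert (w2 * D = 0).
  { transitivity (-(w1*y1+w2*y2+w3*y3)*(a1*b3-a3*b1) + (w1*a1+w2*a2+w3*a3)*(y1*b3-y3*b1)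
      - (w1*b1+w2*b2+w3*b3)*(y1*a3-y3*a1)); [unfold D; ring|rewrite H6, H7, H8; ring]. }
  assert (w3 * D = 0).
  { transitivity ((w1*y1+w2*y2+w3*y3)*(a1*b2-a2*b1) - (w1*a1+w2*a2+w3*a3)*(y1*b2-y2*b1)
      + (w1*b1+w2*b2+w3*b3)*(y1*a2-y2*a1)); [unfold D; ring|rewrite H6, H7, H8; ring]. }
  assert (w1 = 0) by (destruct (Rmult_integral w1 D); tauto).
  assert (w2 = 0) by (destruct (Rmult_integral w2 D); tauto).
  assert (w3 = 0) by (destruct (Rmult_integral w3 D); tauto).
  subst w1 w2 w3. reflexivity.
Qed.

Lemma frame_decomposition (y p q w : R3) (E : R) :
  dot y y = 1 -> dot y p = 0 -> dot y q = 0 -> dot p q = 0 ->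
  dot p p = E -> dot q q = E -> E <> 0 -> dot w y = 0 ->
  w = plus (scal (dot w p / E) p) (scal (dot w q / E) q).
Proof.
  intros.
  assert (K : minus w (plus (scal (dot w p / E) p) (scal (dot w q / E) q)) = zero).
  { apply (orthogonal_frame_zero y p q _ E); auto; dots;
      rewrite ?(dot_comm p y), ?(dot_comm q y), ?(dot_comm q p), ?H, ?H0, ?H1, ?H2, ?H3, ?H4, ?H6;
      field; auto. }
  apply R3_ext; [apply (f_equal coord1) in K|apply (f_equal coord2) in K|apply (f_equal coord3) in K];
    revert K; coords; lra.
Qed.

Definition vdif (F : C -> R3) (z : C) (A B : R3) : Prop :=
  dif (fun w => coord1 (F w)) z (coord1 A) (coord1 B) /\
  dif (fun w => coord2 (F w)) z (coord2 A) (coord2 B) /\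
  dif (fun w => coord3 (F w)) z (coord3 A) (coord3 B).

Lemma vdif_D1 (F : C -> R3) (z : C) (A B : R3) : vdif F z A B -> D1 F z = A.
Proof.
  intros (H1 & H2 & H3). apply R3_ext; cbn; eapply dif_pd1; eassumption.
Qed.

Lemma vdif_D2 (F : C -> R3) (z : C) (A B : R3) : vdif F z A B -> D2 F z = B.
Proof.
  intros (H1 & H2 & H3). apply R3_ext; cbn; eapply dif_pd2; eassumption.
Qed.

Lemma dif_dot (F G : C -> R3) (z : C) (A B A' B' : R3) :
  vdif F z A B -> vdif G z A' B' ->
  dif (fun w => dot (F w) (G w)) z (dot A (G z) + dot (F z) A') (dot B (G z) + dot (F z) B').
Proof.
  intros (H1 & H2 & H3) (K1 & K2 & K3).
  eapply dif_eq; [refine (dif_plus _ _ _ _ _ _ _ (dif_plus _ _ _ _ _ _ _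
    (dif_mult _ _ _ _ _ _ _ H1 K1) (dif_mult _ _ _ _ _ _ _ H2 K2)) (dif_mult _ _ _ _ _ _ _ H3 K3))| |];
  unfold dot; ring.
Qed.

Lemma vdif_plus (F G : C -> R3) (z : C) (A B A' B' : R3) :
  vdif F z A B -> vdif G z A' B' ->
  vdif (fun w => plus (F w) (G w)) z (plus A A') (plus B B').
Proof.
  intros (H1 & H2 & H3) (K1 & K2 & K3).
  split; [|split]; (eapply dif_eq; [apply dif_plus; eassumption|..]); reflexivity.
Qed.

Lemma vdif_scal (f : C -> R) (F : C -> R3) (z : C) (a b : R) (A B : R3) :
  dif f z a b -> vdif F z A B ->
  vdif (fun w => scal (f w) (F w)) z (plus (scal a (F z)) (scal (f z) A))
     (plus (scal b (F z)) (scal (f z) B)).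
Proof.
  intros H (H1 & H2 & H3).
  split; [|split]; (eapply dif_eq; [apply dif_mult; eassumption|..]); reflexivity.
Qed.

Definition vsmooth (U : C -> Prop) (F : C -> R3) : Prop :=
  smooth_on U (fun w => coord1 (F w)) /\ smooth_on U (fun w => coord2 (F w)) /\
  smooth_on U (fun w => coord3 (F w)).

Lemma vsmooth_vdif (U : C -> Prop) (F : C -> R3) (z : C) :
  open U -> vsmooth U F -> U z -> vdif F z (D1 F z) (D2 F z).
Proof.
  intros HU (H1 & H2 & H3) Hz. split; [|split].
  - exact (smooth_dif _ _ _ HU H1 Hz).
  - exact (smooth_dif _ _ _ HU H2 Hz).
  - exact (smooth_dif _ _ _ HU H3 Hz).
Qed.

Lemma vsmooth_D1 (U : C -> Prop) (F : C -> R3) : vsmooth U F -> vsmooth U (D1 F).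
Proof. intros (H1 & H2 & H3). split; [|split]; (apply smooth_pd1; assumption). Qed.

Lemma vsmooth_D2 (U : C -> Prop) (F : C -> R3) : vsmooth U F -> vsmooth U (D2 F).
Proof. intros (H1 & H2 & H3). split; [|split]; (apply smooth_pd2; assumption). Qed.

Lemma smooth_plus (U : C -> Prop) (f f' : C -> R) :
  open U -> smooth_on U f -> smooth_on U f' -> smooth_on U (fun w => f w + f' w).
Proof. intros HU H H' k. apply Ck_on_plus; auto. Qed.

Lemma smooth_mult (U : C -> Prop) (f f' : C -> R) :
  open U -> smooth_on U f -> smooth_on U f' -> smooth_on U (fun w => f w * f' w).
Proof. intros HU H H' k. apply Ck_on_mult; auto. Qed.

Lemma smooth_inv (U : C -> Prop) (f : C -> R) :
  open U -> (forall z, U z -> f z <> 0) -> smooth_on U f -> smooth_on U (fun w => / f w).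
Proof. intros HU H0 H k. apply Ck_on_inv; auto. Qed.

Lemma smooth_const (U : C -> Prop) (c : R) : open U -> smooth_on U (fun _ => c).
Proof. intros HU k. apply Ck_on_const; auto. Qed.

Lemma smooth_ext (U : C -> Prop) (f f' : C -> R) :
  open U -> (forall w, U w -> f w = f' w) -> smooth_on U f -> smooth_on U f'.
Proof. intros HU H H' k. apply Ck_on_ext with f; auto. Qed.

Lemma vsmooth_plus (U : C -> Prop) (F G : C -> R3) :
  open U -> vsmooth U F -> vsmooth U G -> vsmooth U (fun w => plus (F w) (G w)).
Proof. intros HU (H1 & H2 & H3) (K1 & K2 & K3). split; [|split]; (refine (smooth_plus _ _ _ HU _ _);
    assumption). Qed.

Lemma vsmooth_scal (U : C -> Prop) (f : C -> R) (F : C -> R3) :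
  open U -> smooth_on U f -> vsmooth U F -> vsmooth U (fun w => scal (f w) (F w)).
Proof. intros HU H (H1 & H2 & H3). split; [|split]; (refine (smooth_mult _ _ _ HU _ _); assumption). Qed.

Lemma smooth_dot (U : C -> Prop) (F G : C -> R3) :
  open U -> vsmooth U F -> vsmooth U G -> smooth_on U (fun w => dot (F w) (G w)).
Proof.
  intros HU (H1 & H2 & H3) (K1 & K2 & K3).
  refine (smooth_plus _ _ _ HU (smooth_plus _ _ _ HU _ _) _); apply smooth_mult; assumption.
Qed.

(** * The surface with prescribed unit normal and support function *)

(** [Y] is a conformal map into the unit sphere with conformal factor E. The last clause is its
    harmonic map equation. *)
Definition conformal_frame (Y : C -> R3) (E : C -> R) (z : C) : Prop :=
  dot (Y z) (Y z) = 1 /\ dot (D1 Y z) (D1 Y z) = E z /\ dot (D2 Y z) (D2 Y z) = E z /\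
  dot (D1 Y z) (D2 Y z) = 0 /\ 0 < E z /\
  plus (D1 (D1 Y) z) (D2 (D2 Y) z) = scal (- 2 * E z) (Y z).

(** The envelope of the planes with unit normal [Y] and support function [h]; the first summand is
    the gradient of [h] for the metric E (du^2 + dv^2). *)
Definition support_surface (Y : C -> R3) (E h : C -> R) (z : C) : R3 :=
  plus (scal (/ E z) (plus (scal (pd1 h z) (D1 Y z)) (scal (pd2 h z) (D2 Y z))))
    (scal (h z) (Y z)).

(** E times the trace of Hess_L h + h I, that is, Delta_L h + 2 h = 0 for the metric E (du^2 +
    dv^2). *)
Definition laplace_condition (E h : C -> R) (z : C) : Prop :=
  pd1 (pd1 h) z + pd2 (pd2 h) z + 2 * E z * h z = 0.

Section Frame.
Context (U : C -> Prop) (Y : C -> R3) (E h : C -> R) (HU : open U)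
  (HY : vsmooth U Y) (HF : forall z, U z -> conformal_frame Y E z) (Hh : smooth_on U h).

Let eta := support_surface Y E h.

Lemma dif_const_on (f : C -> R) (k : R) (z : C) (a b : R) :
  (forall w, U w -> f w = k) -> U z -> dif f z a b -> a = 0 /\ b = 0.
Proof.
  intros H Hz Hd.
  assert (K : dif f z 0 0).
  { apply dif_ext_loc with (fun _ => k); [|apply dif_const].
    apply (eq_locally U); auto. intros; symmetry; auto. }
  split.
  - rewrite <- (dif_pd1 _ _ _ _ Hd). exact (dif_pd1 _ _ _ _ K).
  - rewrite <- (dif_pd2 _ _ _ _ Hd). exact (dif_pd2 _ _ _ _ K).
Qed.

Lemma dif_eq_on (f f' : C -> R) (z : C) (a b a' b' : R) :
  (forall w, U w -> f w = f' w) -> U z -> dif f z a b -> dif f' z a' b' -> a = a' /\ b = b'.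
Proof.
  intros H Hz Hd Hd'.
  assert (K : dif f' z a b).
  { apply dif_ext_loc with f; [|exact Hd]. apply (eq_locally U); auto. }
  split.
  - rewrite <- (dif_pd1 _ _ _ _ Hd'). symmetry; exact (dif_pd1 _ _ _ _ K).
  - rewrite <- (dif_pd2 _ _ _ _ Hd'). symmetry; exact (dif_pd2 _ _ _ _ K).
Qed.

Lemma frame_dot_Y_D (z : C) : U z -> dot (Y z) (D1 Y z) = 0 /\ dot (Y z) (D2 Y z) = 0.
Proof.
  intros Hz. pose proof (vsmooth_vdif U Y z HU HY Hz) as Hd.
  destruct (dif_const_on (fun w => dot (Y w) (Y w)) 1 z _ _ (fun w Hw => proj1 (HF w Hw)) Hz
     (dif_dot _ _ _ _ _ _ _ Hd Hd)) as [K1 K2].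
  rewrite (dot_comm (D1 Y z)) in K1. rewrite (dot_comm (D2 Y z)) in K2. lra.
Qed.

Lemma support_surface_dot (z : C) : U z ->
  dot (eta z) (Y z) = h z /\ dot (eta z) (D1 Y z) = pd1 h z /\ dot (eta z) (D2 Y z) = pd2 h z.
Proof.
  intros Hz. destruct (frame_dot_Y_D z Hz) as [K1 K2].
  destruct (HF z Hz) as (H1 & H2 & H3 & H4 & H5 & _).
  unfold eta, support_surface. dots.
  rewrite (dot_comm (D1 Y z) (Y z)), (dot_comm (D2 Y z) (Y z)), (dot_comm (D2 Y z) (D1 Y z)),
    K1, K2, H1, H2, H3, H4.
  repeat split; field; lra.
Qed.

Lemma frame_E_smooth : smooth_on U E.
Proof.
  apply smooth_ext with (fun w => dot (D1 Y w) (D1 Y w)); auto.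
  - intros w Hw. apply (HF w Hw).
  - apply smooth_dot; auto using vsmooth_D1.
Qed.

Lemma support_surface_smooth : vsmooth U eta.
Proof.
  unfold eta, support_surface.
  refine (vsmooth_plus _ _ _ HU (vsmooth_scal _ _ _ HU _ (vsmooth_plus _ _ _ HU _ _)) _).
  - apply smooth_inv; auto using frame_E_smooth. intros z Hz.
    destruct (HF z Hz) as (_ & _ & _ & _ & K & _). lra.
  - refine (vsmooth_scal _ _ _ HU _ _); auto using smooth_pd1, vsmooth_D1.
  - refine (vsmooth_scal _ _ _ HU _ _); auto using smooth_pd2, vsmooth_D2.
  - refine (vsmooth_scal _ _ _ HU _ _); auto.
Qed.

(** Differentiating <eta, Y> = h and cancelling <eta, Y_i> = h_i leaves <eta_i, Y> = 0.
    Differentiating <eta, Y_j> = h_j gives <eta_i, Y_j> = h_ij - <eta, Y_ij>, symmetric by Schwarz;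
    in the trace, Y_11 + Y_22 = - 2 E Y contributes 2 E h. *)
Lemma support_surface_D (z : C) : U z ->
  dot (D1 eta z) (Y z) = 0 /\ dot (D2 eta z) (Y z) = 0 /\
  dot (D1 eta z) (D2 Y z) = dot (D2 eta z) (D1 Y z) /\
  dot (D1 eta z) (D1 Y z) + dot (D2 eta z) (D2 Y z) =
    pd1 (pd1 h) z + pd2 (pd2 h) z + 2 * E z * h z.
Proof.
  intros Hz.
  pose proof (vsmooth_vdif U eta z HU support_surface_smooth Hz) as He.
  pose proof (vsmooth_vdif U Y z HU HY Hz) as Hy.
  pose proof (vsmooth_vdif U _ z HU (vsmooth_D1 _ _ HY) Hz) as Hy1.
  pose proof (vsmooth_vdif U _ z HU (vsmooth_D2 _ _ HY) Hz) as Hy2.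
  pose proof (smooth_dif U _ z HU Hh Hz) as Hh0.
  pose proof (smooth_dif U _ z HU (smooth_pd1 _ _ Hh) Hz) as Hh1.
  pose proof (smooth_dif U _ z HU (smooth_pd2 _ _ Hh) Hz) as Hh2.
  destruct (dif_eq_on _ _ _ _ _ _ _ (fun w Hw => proj1 (support_surface_dot w Hw)) Hz
    (dif_dot _ _ _ _ _ _ _ He Hy) Hh0) as [A1 A2].
  destruct (dif_eq_on _ _ _ _ _ _ _ (fun w Hw => proj1 (proj2 (support_surface_dot w Hw))) Hz
    (dif_dot _ _ _ _ _ _ _ He Hy1) Hh1) as [B1 B2].
  destruct (dif_eq_on _ _ _ _ _ _ _ (fun w Hw => proj2 (proj2 (support_surface_dot w Hw))) Hz
    (dif_dot _ _ _ _ _ _ _ He Hy2) Hh2) as [C1 C2].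
  destruct (support_surface_dot z Hz) as (S0 & S1 & S2).
  destruct (HF z Hz) as (_ & _ & _ & _ & _ & HL).
  assert (Hs : D1 (D2 Y) z = D2 (D1 Y) z).
  { destruct HY as (Y1 & Y2 & Y3).
    apply R3_ext; unfold D1, D2, coord1, coord2, coord3; cbn [fst snd];
      [exact (smooth_Schwarz U _ z HU Y1 Hz)|exact (smooth_Schwarz U _ z HU Y2 Hz)|exact (smooth_Schwarz U
          _ z HU Y3 Hz)]. }
  assert (HhS := smooth_Schwarz U h z HU Hh Hz).
  assert (HL' : dot (eta z) (D1 (D1 Y) z) + dot (eta z) (D2 (D2 Y) z) = -2 * E z * h z).
  { rewrite <- dot_plus_r. etransitivity; [apply f_equal; exact HL|]. rewrite dot_scal_r, S0. ring. }
  rewrite Hs in C1. repeat split; lra.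
Qed.

Lemma support_surface_D_frame (z : C) : U z ->
  D1 eta z = plus (scal (dot (D1 eta z) (D1 Y z) / E z) (D1 Y z))
                  (scal (dot (D1 eta z) (D2 Y z) / E z) (D2 Y z)) /\
  D2 eta z = plus (scal (dot (D2 eta z) (D1 Y z) / E z) (D1 Y z))
                  (scal (dot (D2 eta z) (D2 Y z) / E z) (D2 Y z)).
Proof.
  intros Hz. destruct (frame_dot_Y_D z Hz) as [K1 K2].
  destruct (HF z Hz) as (H1 & H2 & H3 & H4 & H5 & _).
  destruct (support_surface_D z Hz) as (A & B & _).
  split; apply (frame_decomposition (Y z)); auto; lra.
Qed.

(** Pairing the eigenvector equations with Y_1 and Y_2 exhibits a symmetric matrix with trace E (m1
    + m2), and [support_surface_D] computes the same trace in coordinates. *)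
Lemma eigenvectors_trace (z : C) (e1 e2 : R * R) (m1 m2 : R) : U z ->
  fst e1 * snd e2 - snd e1 * fst e2 <> 0 ->
  Defs.differential eta z e1 = scal m1 (Defs.differential Y z e1) ->
  Defs.differential eta z e2 = scal m2 (Defs.differential Y z e2) ->
  pd1 (pd1 h) z + pd2 (pd2 h) z + 2 * E z * h z = E z * (m1 + m2).
Proof.
  intros Hz Hi He1 He2.
  destruct (HF z Hz) as (_ & H2 & H3 & H4 & H5 & _).
  destruct (support_surface_D z Hz) as (_ & _ & Hs & <-).
  pose proof (f_equal (fun v => dot v (D1 Y z)) He1) as P1.
  pose proof (f_equal (fun v => dot v (D2 Y z)) He1) as P2.
  pose proof (f_equal (fun v => dot v (D1 Y z)) He2) as Q1.
  pose proof (f_equal (fun v => dot v (D2 Y z)) He2) as Q2.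
  unfold Defs.differential in P1, P2, Q1, Q2. cbv beta in P1, P2, Q1, Q2.
  revert P1 P2 Q1 Q2. dots.
  rewrite (dot_comm (D2 Y z) (D1 Y z)), H2, H3, H4, Hs.
  set (a := dot (D1 eta z) (D1 Y z)). set (b := dot (D2 eta z) (D1 Y z)).
  set (d := dot (D2 eta z) (D2 Y z)). set (x1 := fst e1) in *. set (y1 := snd e1) in *.
  set (x2 := fst e2) in *. set (y2 := snd e2) in *. intros.
  apply (Rmult_eq_reg_l (x1 * y2 - y1 * x2)); [|exact Hi].
  (* For a matrix A, det(A e1, e2) + det(e1, A e2) = tr(A) det(e1, e2). *)
  transitivity ((x1 * a + y1 * b) * y2 - y1 * (x2 * a + y2 * b)
     + x1 * (x2 * b + y2 * d) - (x1 * b + y1 * d) * x2); [ring|].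
  rewrite P1, P2, Q1, Q2. ring.
Qed.

Lemma laplace_eigenvectors (z : C) : U z -> laplace_condition E h z ->
  exists (m : R) (e1 e2 : R * R), fst e1 * snd e2 - snd e1 * fst e2 <> 0 /\
    Defs.differential eta z e1 = scal m (Defs.differential Y z e1) /\
    Defs.differential eta z e2 = scal (- m) (Defs.differential Y z e2).
Proof.
  intros Hz HL.
  destruct (HF z Hz) as (_ & _ & _ & _ & H5 & _).
  destruct (support_surface_D z Hz) as (_ & _ & Hs & Ht). unfold laplace_condition in HL.
  rewrite HL in Ht.
  destruct (support_surface_D_frame z Hz) as [F1 F2].
  revert Hs Ht F1 F2. set (b := dot (D2 eta z) (D1 Y z)).
  set (a := dot (D1 eta z) (D1 Y z)). set (d := dot (D2 eta z) (D2 Y z)).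
  intros -> Ht F1 F2. assert (d = - a) by lra. clearbody a b d. subst d.
  destruct (Req_dec b 0) as [->|Hb].
  (* Diagonal matrix: one of the two eigenvectors used in the other case would vanish here. *)
  - exists (a / E z), (1, 0), (0, 1). cbn [fst snd]. split; [lra|].
    split; unfold Defs.differential; rewrite F1, F2; apply R3_ext; coords; cbn [fst snd]; field; lra.
  - assert (Hm : 0 < a * a + b * b) by nra.
    set (m := sqrt (a * a + b * b)).
    assert (Hm0 : m * m = a * a + b * b) by (apply sqrt_sqrt; lra).
    assert (Hm1 : 0 < m) by (apply sqrt_lt_R0; exact Hm). clearbody m.
    assert (Hb2 : b * b = (m - a) * (m + a)) by lra.
    (* Eigenvectors of the matrix with rows (a, b) and (b, - a), for the eigenvalues m and - m. The
       division by E passes from inner products to coefficients in the frame. *)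
    exists (m / E z), (b, m - a), (b, - m - a). cbn [fst snd]. split.
    { replace (b * (- m - a) - (m - a) * b) with (- 2 * (b * m)) by ring.
      assert (b * m <> 0) by (apply Rmult_integral_contrapositive; split; lra). lra. }
    split; unfold Defs.differential; rewrite F1, F2; apply R3_ext; coords; cbn [fst snd];
     match goal with |- _ = _ * (b * ?x + _ * ?y) => apply (Rmult_eq_reg_l (E z)); [|lra];
       first
       [ transitivity ((b * a + (m - a) * b) * x + (b * b + (m - a) * - a) * y);
         [field; lra|rewrite Hb2; field; lra]
       | transitivity ((b * a + (- m - a) * b) * x + (b * b + (- m - a) * - a) * y);
         [field; lra|rewrite Hb2; field; lra] ] end.
Qed.

End Frame.

(** * Spherical and minimal curvature conditions *)

(** Common form of X (f = h + c) and N (f = h). Since <n, Y> = h, the case f = h is the mirror image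
    of Y in the plane orthogonal to n. *)
Definition reflected (Y n : C -> R3) (f : C -> R) (z : C) : R3 :=
  minus (Y z) (scal (2 * f z / dot (n z) (n z)) (n z)).

(** The differential of [reflected] in one direction, with dy, dn, df the differentials of its data.
    It is linear in the triple (dy, dn, df), so it applies to any tangent direction. *)
Definition reflected_diff (dy n dn : R3) (f df : R) : R3 :=
  minus dy (plus (scal (2 * (df * dot n n - f * (2 * dot n dn)) / (dot n n) ^ 2) n)
                 (scal (2 * f / dot n n) dn)).

Lemma vdif_minus (F G : C -> R3) (z : C) (A B A' B' : R3) :
  vdif F z A B -> vdif G z A' B' ->
  vdif (fun w => minus (F w) (G w)) z (minus A A') (minus B B').
Proof.
  intros HF (K1 & K2 & K3).
  apply (vdif_plus F (fun w => opp (G w))); auto.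
  assert (K : forall k a b, dif k z a b -> dif (fun w => - k w) z (- a) (- b)).
  { intros k a b Hk. apply dif_ext_loc with (fun w => (-1) * k w).
    - apply filter_forall. intros w; ring.
    - eapply dif_eq; [apply dif_mult; [apply dif_const|exact Hk]| |]; cbv beta; ring. }
  split; [|split]; apply K; assumption.
Qed.

Lemma vdif_reflected (Y n : C -> R3) (f : C -> R) (z : C) (y1 y2 n1 n2 : R3) (f1 f2 : R) :
  dot (n z) (n z) <> 0 -> vdif Y z y1 y2 -> vdif n z n1 n2 -> dif f z f1 f2 ->
  vdif (reflected Y n f) z (reflected_diff y1 (n z) n1 (f z) f1)
    (reflected_diff y2 (n z) n2 (f z) f2).
Proof.
  intros H0 HY Hn Hf. unfold reflected, reflected_diff. apply vdif_minus; auto.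
  assert (K : dif (fun w => 2 * f w / dot (n w) (n w)) z
     (2 * (f1 * dot (n z) (n z) - f z * (2 * dot (n z) n1)) / (dot (n z) (n z)) ^ 2)
     (2 * (f2 * dot (n z) (n z) - f z * (2 * dot (n z) n2)) / (dot (n z) (n z)) ^ 2)).
  { unfold Rdiv. eapply dif_eq;
      [apply dif_mult; [apply dif_mult; [apply dif_const|exact Hf]
        |apply (dif_inv (fun w => dot (n w) (n w)));
           [exact H0|exact (dif_dot _ _ _ _ _ _ _ Hn Hn)]]|..];
      cbv beta; rewrite 1?(dot_comm n1), 1?(dot_comm n2); field; exact H0. }
  exact (vdif_scal _ _ _ _ _ _ _ K Hn).
Qed.

Lemma reflected_diff_linear (y1 y2 n n1 n2 : R3) (f f1 f2 a b : R) :
  plus (scal a (reflected_diff y1 n n1 f f1)) (scal b (reflected_diff y2 n n2 f f2)) =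
  reflected_diff (plus (scal a y1) (scal b y2)) n (plus (scal a n1) (scal b n2)) f (a * f1 + b * f2).
Proof.
  unfold reflected_diff. dots. unfold Rdiv. apply R3_ext; coords; ring.
Qed.

(** Here R = - (h + c) / h. Solving - dN = k dX for dn gives a multiple of dy plus a multiple t of
    n; t itself contains <n, dn>, and pairing with n forces t = 0. *)
Lemma principal_to_eigen (dy n dn : R3) (h c k : R) :
  h <> 0 -> dot n n <> 0 -> c <> 0 -> 1 - k * (- (h + c) / h) <> 0 ->
  opp (reflected_diff dy n dn h (dot n dy)) =
    scal k (reflected_diff dy n dn (h + c) (dot n dy)) ->
  dn = scal (spherical_curvature k (- (h + c) / h) * dot n n / (2 * h)) dy.
Proof.
  intros Hh HS Hc Hk He.
  set (p := dot n dy) in *.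
  unfold reflected_diff in He. unfold spherical_curvature.
  remember (dot n dn) as q eqn:Hq. remember (dot n n) as S eqn:HSe.
  (* D = h (1 - k R), hence nonzero, and the coefficient S (1 + k) / (2 D) found below is s S / (2
     h) for the spherical curvature s of k. *)
  set (D := h + k * (h + c)).
  assert (HD : D <> 0).
  { intros K. apply Hk. replace (1 - k * (- (h + c) / h)) with (D / h) by (unfold D; field; exact Hh).
    rewrite K. field. exact Hh. }
  set (t := 2 * q / S - (1 + k) * p / D).
  assert (H0 : dn = plus (scal (S * (1 + k) / (2 * D)) dy) (scal t n)).
  { apply R3_ext; [apply (f_equal coord1) in He|apply (f_equal coord2) in He|apply (f_equal coord3) in He];
      revert He; coords; intros He; apply (Rmult_eq_reg_l (2 * D / S));
      try (apply Rmult_integral_contrapositive; split;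
        [lra|apply Rinv_neq_0_compat; exact HS]); unfold t;
      match goal with |- 2 * D / S * ?d = 2 * D / S * (_ * ?y + _ * ?m) =>
        transitivity ((1 + k) * y - 2 / S * (1 + k) * p * m + 4 * D * q / S ^ 2 * m);
        [|field; split; assumption];
        match type of He with ?A = ?B =>
          transitivity (((1 + k) * y - 2 / S * (1 + k) * p * m + 4 * D * q / S ^ 2 * m) + (A - B));
          [unfold D; field; exact HS|rewrite He; ring] end end. }
  assert (Hq' : q = S * (1 + k) / (2 * D) * p + t * S).
  { rewrite Hq, H0. dots. fold p. rewrite <- HSe. ring. }
  assert (Ht : t = 0).
  { assert (q = S * (1 + k) * p / (2 * D)).
    { apply (Rplus_eq_reg_l (- 2 * q)). transitivity (- q); [ring|]. rewrite Hq' at 1.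
      unfold t. field. split; assumption. }
    unfold t. rewrite H. field. split; assumption. }
  rewrite H0, Ht. apply R3_ext; coords;
   (replace ((1 + k) / (1 - k * (- (h + c) / h)) * S / (2 * h)) with (S * (1 + k) / (2 * D));
    [ring|unfold D; field; repeat split; auto;
      intros K; apply HD; unfold D; rewrite <- K; ring]).
Qed.

(** On an eigenvector, dX and dN become multiples of one vector, the mirror image of dy, whatever f
    is. *)
Lemma reflected_diff_eigen (dy n : R3) (f m : R) : dot n n <> 0 ->
  reflected_diff dy n (scal m dy) f (dot n dy) =
  scal (1 - 2 * f * m / dot n n) (minus dy (scal (2 * dot n dy / dot n n) n)).
Proof.
  intros HS. unfold reflected_diff. dots. apply R3_ext; coords; field; exact HS.
Qed.

(** By [reflected_diff_eigen], k is minus the ratio of the factors 1 - 2 h m / S and 1 - 2 (h + c) m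
    / S; the second is nonzero because dX is. Then 1 - k R = - c S / (h (S - 2 (h + c) m)), nonzero
    since c is. *)
Lemma eigen_to_principal (dy n dn : R3) (h c m : R) :
  h <> 0 -> dot n n <> 0 -> c <> 0 ->
  dn = scal m dy -> reflected_diff dy n dn (h + c) (dot n dy) <> zero ->
  exists k, opp (reflected_diff dy n dn h (dot n dy)) =
      scal k (reflected_diff dy n dn (h + c) (dot n dy)) /\
    1 - k * (- (h + c) / h) <> 0 /\
    spherical_curvature k (- (h + c) / h) = 2 * h * m / dot n n.
Proof.
  intros Hh HS Hc -> H0. rewrite !reflected_diff_eigen in * by assumption.
  set (S := dot n n) in *.
  assert (H1 : S - 2 * (h + c) * m <> 0).
  { intros K. apply H0. apply R3_ext; coords;
     (replace (1 - 2 * (h + c) * m / S) with ((S - 2 * (h + c) * m) / S) by (field; exact HS));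
     rewrite K; unfold Rdiv; ring. }
  assert (H2 : 1 - (2 * h * m - S) / (S - 2 * (h + c) * m) * (- (h + c) / h)
     = - c * S / (h * (S - 2 * (h + c) * m))).
  { field. split; auto. }
  exists ((2 * h * m - S) / (S - 2 * (h + c) * m)). split; [|split].
  - apply R3_ext; coords; field; split; auto.
  - rewrite H2. unfold Rdiv.
    repeat (apply Rmult_integral_contrapositive_currified || apply Rinv_neq_0_compat
      || apply Ropp_neq_0_compat); assumption.
  - unfold spherical_curvature. rewrite H2. field. repeat split; auto.
Qed.

Section Surfaces.
Context (U : C -> Prop) (Y : C -> R3) (E h : C -> R) (c : R) (HU : open U)
  (HY : vsmooth U Y) (HF : forall z, U z -> conformal_frame Y E z) (Hh : smooth_on U h)
  (Hc : c <> 0) (H0 : forall z, U z -> h z <> 0).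

Let n := support_surface Y E h.
Let X := reflected Y n (fun z => h z + c).
Let N := reflected Y n h.

Lemma support_surface_norm (z : C) : U z -> 0 < dot (n z) (n z).
Proof.
  intros Hz. apply dot_pos. intros K.
  destruct (support_surface_dot U Y E h HU HY HF z Hz) as [K1 _].
  unfold n in K. rewrite K in K1. apply (H0 z Hz). rewrite <- K1. apply dot_zero_l.
Qed.

Lemma support_diff (z : C) (e : R * R) : U z ->
  fst e * pd1 h z + snd e * pd2 h z = dot (n z) (Defs.differential Y z e).
Proof.
  intros Hz. destruct (support_surface_dot U Y E h HU HY HF z Hz) as (_ & <- & <-).
  unfold Defs.differential. dots. reflexivity.
Qed.

(** [h] and [h + c] have the same differential, and dh(e) = <n, dY(e)> by [support_diff]; so X and N
    are differentiated by one formula. *)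
Lemma reflected_differential (f : C -> R) (z : C) (e : R * R) : U z ->
  dif f z (pd1 h z) (pd2 h z) ->
  Defs.differential (reflected Y n f) z e =
  reflected_diff (Defs.differential Y z e) (n z) (Defs.differential n z e) (f z)
    (dot (n z) (Defs.differential Y z e)).
Proof.
  intros Hz Hf. rewrite <- support_diff by exact Hz.
  pose proof (vsmooth_vdif U Y z HU HY Hz) as Hy.
  pose proof (vsmooth_vdif U n z HU (support_surface_smooth U Y E h HU HY HF Hh) Hz) as Hn.
  pose proof (support_surface_norm z Hz) as HS.
  assert (K := vdif_reflected Y n f z _ _ _ _ _ _ (Rgt_not_eq _ _ HS) Hy Hn Hf).
  unfold Defs.differential at 1. rewrite (vdif_D1 _ _ _ _ K), (vdif_D2 _ _ _ _ K).
  rewrite reflected_diff_linear. reflexivity.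
Qed.

(** With k = c these are the ingredients of the radius of X; with k = 0 the first one says that N is
    a unit vector. *)
Lemma reflected_dot (f : C -> R) (k : R) (z : C) : U z ->
  f z = h z + k ->
  dot (reflected Y n f z) (reflected Y n f z) = 1 + 4 * f z * k / dot (n z) (n z) /\
  dot (reflected Y n f z) (N z) = 1 + 2 * k * h z / dot (n z) (n z).
Proof.
  intros Hz Hf. pose proof (support_surface_norm z Hz) as HS.
  destruct (support_surface_dot U Y E h HU HY HF z Hz) as (K1 & _).
  destruct (HF z Hz) as (K2 & _). fold n in K1.
  unfold N, reflected. dots. rewrite (dot_comm (Y z) (n z)), K1, K2, Hf.
  split; field; lra.
Qed.

Lemma radius_value (z : C) : U z -> radius X N z = - (h z + c) / h z.
Proof.
  intros Hz. unfold radius, support.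
  destruct (reflected_dot (fun z => h z + c) c z Hz eq_refl) as [K1 K2].
  fold X in K1, K2. rewrite K1, K2. pose proof (support_surface_norm z Hz). specialize (H0 z Hz).
  field. repeat split; auto; try lra.
  replace (dot (n z) (n z) + 2 * c * h z - dot (n z) (n z)) with (2 * (c * h z)) by ring.
  apply Rmult_integral_contrapositive_currified; [lra|].
  apply Rmult_integral_contrapositive_currified; auto.
Qed.

Lemma dif_h (z : C) : U z -> dif h z (pd1 h z) (pd2 h z).
Proof. intros Hz. exact (smooth_dif U h z HU Hh Hz). Qed.

Lemma dif_hc (z : C) : U z -> dif (fun z => h z + c) z (pd1 h z) (pd2 h z).
Proof.
  intros Hz. eapply dif_eq; [apply dif_plus; [apply dif_h, Hz|apply dif_const]| |]; ring.
Qed.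

Lemma H1_laplace : H1_surface_on U X N -> forall z, U z -> laplace_condition E h z.
Proof.
  intros H z Hz. destruct (H z Hz) as (k1 & k2 & (e1 & e2 & Hi & P1 & P2) & D1 & D2 & Hs).
  rewrite radius_value in * by exact Hz.
  unfold X, N in P1, P2.
  rewrite !reflected_differential in P1, P2 by auto using dif_h, dif_hc.
  pose proof (support_surface_norm z Hz) as HS.
  apply principal_to_eigen in P1; auto; try lra.
  apply principal_to_eigen in P2; auto; try lra.
  unfold laplace_condition.
  rewrite (eigenvectors_trace U Y E h HU HY HF Hh z e1 e2 _ _ Hz Hi P1 P2).
  set (s1 := spherical_curvature k1 _) in *. set (s2 := spherical_curvature k2 _) in *.
  replace s2 with (- s1) by lra. specialize (H0 z Hz). field. exact H0.
Qed.

Lemma independent_neq (e1 e2 : R * R) :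
  fst e1 * snd e2 - snd e1 * fst e2 <> 0 -> e1 <> (0, 0) /\ e2 <> (0, 0).
Proof. intros H; split; intros ->; apply H; cbn; ring. Qed.

(** Trace zero gives eigenvalues m and - m of d eta relative to dY. The immersion makes dX nonzero
    on both eigenvectors, as [eigen_to_principal] requires, and the spherical curvatures 2 h m / S
    and - 2 h m / S cancel. *)
Lemma laplace_H1 : immersion_on U X ->
  (forall z, U z -> laplace_condition E h z) -> H1_surface_on U X N.
Proof.
  intros HX HL z Hz. pose proof (support_surface_norm z Hz) as HS.
  destruct (laplace_eigenvectors U Y E h HU HY HF Hh z Hz (HL z Hz)) as (m & e1 & e2 & Hi & P1 & P2).
  destruct (independent_neq _ _ Hi) as [N1 N2].
  assert (K : forall e m, e <> (0, 0) -> Defs.differential n z e = scal m (Defs.differential Y z e) ->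
    exists k, opp (Defs.differential N z e) = scal k (Defs.differential X z e) /\
      1 - k * radius X N z <> 0 /\
      spherical_curvature k (radius X N z) = 2 * h z * m / dot (n z) (n z)).
  { intros e m' He Hm. rewrite radius_value by exact Hz.
    unfold X, N. rewrite !reflected_differential by auto using dif_h, dif_hc.
    apply eigen_to_principal; auto; try lra.
    intros K. apply He. apply (HX z Hz). unfold X.
    rewrite reflected_differential by auto using dif_hc. exact K. }
  destruct (K e1 m N1 P1) as (k1 & A1 & B1 & C1).
  destruct (K e2 (- m) N2 P2) as (k2 & A2 & B2 & C2).
  exists k1, k2. split; [exists e1, e2; auto|]. split; [exact B1|split; [exact B2|]].
  rewrite C1, C2. field. lra.
Qed.

Lemma frame_Y_immersion (z : C) (e : R * R) : U z ->
  Defs.differential Y z e = zero -> e = (0, 0).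
Proof.
  intros Hz K. destruct (HF z Hz) as (_ & H2 & H3 & H4 & H5 & _).
  pose proof (f_equal (fun v => dot v (D1 Y z)) K) as P1.
  pose proof (f_equal (fun v => dot v (D2 Y z)) K) as P2. revert P1 P2.
  unfold Defs.differential. cbv beta. dots.
  rewrite (dot_comm (D2 Y z) (D1 Y z)), H2, H3, H4.
  intros P1 P2. assert (Z : forall v, dot zero v = 0) by (intros; apply dot_zero_l).
  change (dot zero (D1 Y z)) with 0 in P1 || rewrite Z in P1.
  rewrite Z in P2. destruct e as [x y]; cbn [fst snd] in *. f_equal; nra.
Qed.

(** k = 0 would annihilate dY(e), which the conformal frame forbids. So d eta(e) = - (1/k) dY(e),
    and 1/k1 + 1/k2 vanishes together with k1 + k2. *)
Lemma minimal_laplace : minimal_on U n Y -> forall z, U z -> laplace_condition E h z.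
Proof.
  intros H z Hz. destruct (H z Hz) as (k1 & k2 & (e1 & e2 & Hi & P1 & P2) & Hs).
  destruct (independent_neq _ _ Hi) as [N1 N2].
  assert (K : forall e k, e <> (0, 0) -> opp (Defs.differential Y z e) = scal k (Defs.differential n z e) ->
    k <> 0 /\ Defs.differential n z e = scal (- / k) (Defs.differential Y z e)).
  { intros e k He Hk.
    assert (Hk0 : k <> 0).
    { intros ->. apply He, (frame_Y_immersion z); auto.
      apply R3_ext; [apply (f_equal coord1) in Hk|apply (f_equal coord2) in Hk|apply (f_equal coord3) in Hk];
        revert Hk; coords; lra. }
    split; auto.
    apply R3_ext; [apply (f_equal coord1) in Hk|apply (f_equal coord2) in Hk|apply (f_equal coord3) in Hk];
      revert Hk; coords; intros Hk; apply (Rmult_eq_reg_l k); auto; rewrite <- Hk; field; auto. }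
  destruct (K e1 k1 N1 P1) as [Z1 Q1]. destruct (K e2 k2 N2 P2) as [Z2 Q2].
  unfold laplace_condition.
  rewrite (eigenvectors_trace U Y E h HU HY HF Hh z e1 e2 _ _ Hz Hi Q1 Q2).
  replace k2 with (- k1) by lra. field. exact Z1.
Qed.

(** Eigenvalues m and - m of d eta relative to dY give the principal curvatures - 1/m and 1/m; m = 0
    is excluded because [eta] is an immersion. *)
Lemma laplace_minimal : immersion_on U n ->
  (forall z, U z -> laplace_condition E h z) -> minimal_on U n Y.
Proof.
  intros HX HL z Hz.
  destruct (laplace_eigenvectors U Y E h HU HY HF Hh z Hz (HL z Hz)) as (m & e1 & e2 & Hi & P1 & P2).
  destruct (independent_neq _ _ Hi) as [N1 N2].
  assert (Hm : m <> 0).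
  { intros ->. apply N1, (HX z Hz). unfold n; rewrite P1. apply R3_ext; coords; ring. }
  exists (- / m), (/ m). split; [|field; exact Hm].
  exists e1, e2. split; [exact Hi|].
  split; [unfold n; rewrite P1|unfold n; rewrite P2]; apply R3_ext; coords; field; exact Hm.
Qed.

Lemma reflected_smooth (f : C -> R) : smooth_on U f -> vsmooth U (reflected Y n f).
Proof.
  intros Hf.
  assert (Hn := support_surface_smooth U Y E h HU HY HF Hh).
  assert (K : vsmooth U (fun z => plus (Y z) (scal (-1 * (2 * f z * / dot (n z) (n z))) (n z)))).
  { apply vsmooth_plus; auto. apply vsmooth_scal; auto. repeat apply smooth_mult; auto using smooth_const.
    apply smooth_inv; auto.
    - intros z Hz. pose proof (support_surface_norm z Hz); lra.
    - apply smooth_dot; auto. }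
  destruct K as (K1 & K2 & K3).
  split; [|split]; [refine (smooth_ext _ _ _ HU _ K1)|refine (smooth_ext _ _ _ HU _ K2)
    |refine (smooth_ext _ _ _ HU _ K3)]; intros w _; unfold reflected; coords; unfold Rdiv; ring.
Qed.

End Surfaces.

(** * Stereographic projection *)

Lemma vdif_ext_on (U : C -> Prop) (F G : C -> R3) (z : C) (A B : R3) :
  open U -> (forall w, U w -> F w = G w) -> U z -> vdif F z A B -> vdif G z A B.
Proof.
  intros HU H Hz (H1 & H2 & H3).
  split; [|split].
  - refine (dif_ext_loc _ _ _ _ _ _ H1). apply (eq_locally U); auto. intros w Hw; rewrite H; auto.
  - refine (dif_ext_loc _ _ _ _ _ _ H2). apply (eq_locally U); auto. intros w Hw; rewrite H; auto.
  - refine (dif_ext_loc _ _ _ _ _ _ H3). apply (eq_locally U); auto. intros w Hw; rewrite H; auto.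
Qed.

Lemma dif_opp (f : C -> R) (z : C) (a b : R) : dif f z a b -> dif (fun w => - f w) z (- a) (- b).
Proof.
  intros H. apply dif_ext_loc with (fun w => (-1) * f w).
  - apply filter_forall. intros w; ring.
  - eapply dif_eq; [apply dif_mult; [apply dif_const|exact H]| |]; cbv beta; ring.
Qed.

Lemma dif_minus (f f' : C -> R) (z : C) (a b a' b' : R) :
  dif f z a b -> dif f' z a' b' ->
  dif (fun w => f w - f' w) z (a - a') (b - b').
Proof. intros H H'. exact (dif_plus _ _ _ _ _ _ _ H (dif_opp _ _ _ _ H')). Qed.

(** Syntax-directed differentiation: the coefficients may stay existential and are filled in by the
    rules, with atomic functions taken from the hypotheses. *)
Ltac difs :=
  lazymatch goal with
  | |- dif (fun _ => ?k) ?z _ _ => exact (dif_const k z)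
  | |- dif (fun w => @?f w - @?g w) ?z _ _ => refine (dif_minus f g z _ _ _ _ _ _); [difs|difs]
  | |- dif (fun w => @?f w + @?g w) ?z _ _ => refine (dif_plus f g z _ _ _ _ _ _); [difs|difs]
  | |- dif (fun w => @?f w * @?g w) ?z _ _ => refine (dif_mult f g z _ _ _ _ _ _); [difs|difs]
  | |- dif (fun w => - @?f w) ?z _ _ => refine (dif_opp f z _ _ _); difs
  | _ => eassumption
  end.

(** With t = 2 / T the inverse stereographic projection is polynomial in a, b, t, so that t is the
    only quotient to differentiate. *)
Definition sphere_point (a b t : R) : R3 := (a * t, b * t, t - 1).

Section Stereographic.
Context (U : C -> Prop) (a b : C -> R) (HU : open U) (Ha : smooth_on U a) (Hb : smooth_on U b)
  (CR1 : forall z, U z -> pd2 a z = - pd1 b z) (CR2 : forall z, U z -> pd2 b z = pd1 a z).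

Let t (z : C) : R := 2 / (1 + (a z * a z + b z * b z)).
Let Y (z : C) : R3 := sphere_point (a z) (b z) (t z).
(** The partial derivatives of [Y], with a_2 = - b_1 and b_2 = a_1 already eliminated; [t * t] times
    the last factor is minus the derivative of t. *)
Let Y1 (z : C) : R3 :=
  (pd1 a z * t z - a z * (t z * t z) * (a z * pd1 a z + b z * pd1 b z),
   pd1 b z * t z - b z * (t z * t z) * (a z * pd1 a z + b z * pd1 b z),
   - (t z * t z * (a z * pd1 a z + b z * pd1 b z))).
Let Y2 (z : C) : R3 :=
  (- pd1 b z * t z - a z * (t z * t z) * (b z * pd1 a z - a z * pd1 b z),
   pd1 a z * t z - b z * (t z * t z) * (b z * pd1 a z - a z * pd1 b z),
   - (t z * t z * (b z * pd1 a z - a z * pd1 b z))).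

Lemma dif_cr_a (z : C) : U z -> dif a z (pd1 a z) (- pd1 b z).
Proof. intros Hz. rewrite <- CR1 by exact Hz. exact (smooth_dif U a z HU Ha Hz). Qed.

Lemma dif_cr_b (z : C) : U z -> dif b z (pd1 b z) (pd1 a z).
Proof. intros Hz. rewrite <- CR2 by exact Hz. exact (smooth_dif U b z HU Hb Hz). Qed.

(** By Schwarz, the pair (a_1, b_1) satisfies the Cauchy-Riemann equations again. *)
Lemma dif_cr_pd (z : C) : U z ->
  dif (pd1 a) z (pd1 (pd1 a) z) (- pd1 (pd1 b) z) /\
  dif (pd1 b) z (pd1 (pd1 b) z) (pd1 (pd1 a) z).
Proof.
  intros Hz. split.
  - replace (- pd1 (pd1 b) z) with (pd2 (pd1 a) z).
    + exact (smooth_dif U _ z HU (smooth_pd1 _ _ Ha) Hz).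
    + rewrite <- (smooth_Schwarz U) by assumption.
      assert (K : dif (pd2 a) z (- pd1 (pd1 b) z) (- pd2 (pd1 b) z)).
      { apply dif_ext_loc with (fun w => - pd1 b w).
        - apply (eq_locally U); auto. intros w Hw; symmetry; auto.
        - apply dif_opp. exact (smooth_dif U _ z HU (smooth_pd1 _ _ Hb) Hz). }
      exact (dif_pd1 _ _ _ _ K).
  - replace (pd1 (pd1 a) z) with (pd2 (pd1 b) z).
    + exact (smooth_dif U _ z HU (smooth_pd1 _ _ Hb) Hz).
    + rewrite <- (smooth_Schwarz U) by assumption.
      assert (K : dif (pd2 b) z (pd1 (pd1 a) z) (pd2 (pd1 a) z)).
      { apply dif_ext_loc with (fun w => pd1 a w).
        - apply (eq_locally U); auto. intros w Hw; symmetry; auto.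
        - exact (smooth_dif U _ z HU (smooth_pd1 _ _ Ha) Hz). }
      exact (dif_pd1 _ _ _ _ K).
Qed.

Lemma stereo_den_pos (z : C) : 0 < 1 + (a z * a z + b z * b z).
Proof. nra. Qed.

Lemma dif_stereo_t (z : C) : U z ->
  dif t z (- (t z * t z * (a z * pd1 a z + b z * pd1 b z)))
          (- (t z * t z * (b z * pd1 a z - a z * pd1 b z))).
Proof.
  intros Hz. pose proof (dif_cr_a z Hz) as K1. pose proof (dif_cr_b z Hz) as K2.
  pose proof (stereo_den_pos z).
  unfold t, Rdiv. eapply dif_eq;
    [apply dif_mult; [apply dif_const|
      apply (dif_inv (fun w => 1 + (a w * a w + b w * b w))); [lra|difs]]|..];
    cbv beta; field; lra.
Qed.

Lemma vdif_stereo (z : C) : U z -> vdif Y z (Y1 z) (Y2 z).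
Proof.
  intros Hz. pose proof (dif_cr_a z Hz) as K1. pose proof (dif_cr_b z Hz) as K2.
  pose proof (dif_stereo_t z Hz) as K3.
  unfold Y, Y1, Y2, sphere_point. split; [|split]; unfold coord1, coord2, coord3; cbn [fst snd];
    (eapply dif_eq; [difs|..]); cbv beta; ring.
Qed.

Lemma stereo_smooth : vsmooth U Y.
Proof.
  assert (smooth_on U t).
  { unfold t, Rdiv. apply smooth_mult; auto using smooth_const. apply smooth_inv; auto.
    - intros z _. pose proof (stereo_den_pos z). lra.
    - apply smooth_plus; auto using smooth_const. apply smooth_plus; auto using smooth_mult. }
  unfold Y, sphere_point. split; [|split]; unfold coord1, coord2, coord3; cbn [fst snd].
  - apply smooth_mult; auto.
  - apply smooth_mult; auto.
  - apply (smooth_plus U t (fun _ => -1)); auto using smooth_const.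
Qed.

(** Substituting a^2 + b^2 = 2 / t - 1 turns every clause into a rational identity in t. In Y_11 +
    Y_22 the second derivatives of a and b cancel, since both functions are harmonic. *)
Lemma stereo_frame (z : C) : U z -> 0 < pd1 a z * pd1 a z + pd1 b z * pd1 b z ->
  conformal_frame Y (fun z => (pd1 a z * pd1 a z + pd1 b z * pd1 b z) * (t z * t z)) z.
Proof.
  intros Hz Hq. pose proof (stereo_den_pos z) as Hd.
  pose proof (dif_cr_a z Hz) as K1. pose proof (dif_cr_b z Hz) as K2.
  pose proof (dif_stereo_t z Hz) as K3. destruct (dif_cr_pd z Hz) as [K4 K5].
  assert (Ht : 0 < t z) by (apply Rdiv_lt_0_compat; lra).
  assert (Htd : t z * (1 + (a z * a z + b z * b z)) = 2) by (unfold t; field; lra).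
  assert (E1 : D1 Y z = Y1 z) by (eapply vdif_D1, vdif_stereo, Hz).
  assert (E2 : D2 Y z = Y2 z) by (eapply vdif_D2, vdif_stereo, Hz).
  (* The second derivatives are computed from the explicit fields [Y1] and [Y2], which agree with
     [D1 Y] and [D2 Y] on all of [U]. *)
  assert (V1 : forall A B, vdif Y1 z A B -> D1 (D1 Y) z = A).
  { intros A B H. eapply vdif_D1, (vdif_ext_on U Y1); eauto.
    intros w Hw. symmetry. eapply vdif_D1, vdif_stereo, Hw. }
  assert (V2 : forall A B, vdif Y2 z A B -> D2 (D2 Y) z = B).
  { intros A B H. eapply vdif_D2, (vdif_ext_on U Y2); eauto.
    intros w Hw. symmetry. eapply vdif_D2, vdif_stereo, Hw. }
  set (q := pd1 a z * pd1 a z + pd1 b z * pd1 b z) in *.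
  assert (Hab : a z * a z + b z * b z = 2 / t z - 1).
  { apply (Rmult_eq_reg_l (t z)); [|lra]. replace (t z * (2 / t z - 1)) with (2 - t z) by (field; lra). lra. }
  unfold conformal_frame. cbv beta. fold q. repeat split.
  - unfold Y, sphere_point, dot, coord1, coord2, coord3; cbn [fst snd].
    transitivity ((t z * t z) * (a z * a z + b z * b z) + (t z - 1) * (t z - 1)); [ring|].
    rewrite Hab. field. lra.
  - rewrite E1. unfold Y1, dot, coord1, coord2, coord3; cbn [fst snd].
    set (s := a z * pd1 a z + b z * pd1 b z).
    transitivity (q * (t z * t z) - 2 * (t z * t z * t z) * s * s
      + (t z * t z * t z * t z) * s * s * (a z * a z + b z * b z + 1)); [unfold q, s; ring|].
    rewrite Hab. field. lra.
  - rewrite E2. unfold Y2, dot, coord1, coord2, coord3; cbn [fst snd].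
    set (s := b z * pd1 a z - a z * pd1 b z).
    transitivity (q * (t z * t z) - 2 * (t z * t z * t z) * s * s
      + (t z * t z * t z * t z) * s * s * (a z * a z + b z * b z + 1)); [unfold q, s; ring|].
    rewrite Hab. field. lra.
  - rewrite E1, E2. unfold Y1, Y2, dot, coord1, coord2, coord3; cbn [fst snd].
    set (s := a z * pd1 a z + b z * pd1 b z). set (r := b z * pd1 a z - a z * pd1 b z).
    transitivity (- 2 * (t z * t z * t z) * s * r
      + (t z * t z * t z * t z) * s * r * (a z * a z + b z * b z + 1)); [unfold r, s; ring|].
    rewrite Hab. field. lra.
  - apply Rmult_lt_0_compat; nra.
  - erewrite (V1 (_, _, _) (_, _, _)).
    2:{ unfold Y1; split; [|split]; unfold coord1, coord2, coord3; cbn [fst snd];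
        difs. }
    erewrite (V2 (_, _, _) (_, _, _)).
    2:{ unfold Y2; split; [|split]; unfold coord1, coord2, coord3; cbn [fst snd];
        difs. }
    apply R3_ext; coords; unfold Y, sphere_point, coord1, coord2, coord3; cbn [fst snd].
    + transitivity (- 4 * a z * q * (t z * t z)
        + 2 * a z * q * (t z * t z * t z) * (a z * a z + b z * b z)); [unfold q; ring|].
      rewrite Hab. field. lra.
    + transitivity (- 4 * b z * q * (t z * t z)
        + 2 * b z * q * (t z * t z * t z) * (a z * a z + b z * b z)); [unfold q; ring|].
      rewrite Hab. field. lra.
    + transitivity (2 * q * (t z * t z * t z) * (a z * a z + b z * b z) - 2 * q * (t z * t z));
        [unfold q; ring|].
      rewrite Hab. field. lra.
Qed.

End Stereographic.

(** * Conformal changes of the parameter *)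

Lemma Cmod_sqr (z : C) : Cmod z ^ 2 = Re z * Re z + Im z * Im z.
Proof. unfold Cmod, Re, Im. rewrite pow2_sqrt; [ring|nra]. Qed.

Lemma holomorphic_CR (U : C -> Prop) (g : C -> C) (z : C) :
  holomorphic_on U g -> U z ->
  pd1 (fun w => Re (g w)) z = Re (C_derive g z) /\
  pd1 (fun w => Im (g w)) z = Im (C_derive g z) /\
  pd2 (fun w => Re (g w)) z = - Im (C_derive g z) /\
  pd2 (fun w => Im (g w)) z = Re (C_derive g z).
Proof.
  intros [Hd _] Hz. destruct (C_derive_dif g z _ (Hd z Hz)) as [K1 K2].
  repeat split.
  - exact (dif_pd1 _ _ _ _ K1).
  - exact (dif_pd1 _ _ _ _ K2).
  - exact (dif_pd2 _ _ _ _ K1).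
  - exact (dif_pd2 _ _ _ _ K2).
Qed.

(* Written as an inverse so that [/ conformal_factor g z] is literally the coefficient in [gradL]. *)
Definition conformal_factor (g : C -> C) (z : C) : R :=
  / (Tfun g z ^ 2 / (4 * Cmod (C_derive g z) ^ 2)).

Lemma Tfun_eq (g : C -> C) (z : C) :
  Tfun g z = 1 + (Re (g z) * Re (g z) + Im (g z) * Im (g z)).
Proof. unfold Tfun. rewrite Cmod_sqr. reflexivity. Qed.

Lemma Tfun_pos (g : C -> C) (z : C) : 0 < Tfun g z.
Proof. rewrite Tfun_eq. nra. Qed.

Lemma Ymap_sphere_point (g : C -> C) :
  Ymap g = (fun z => sphere_point (Re (g z)) (Im (g z))
    (2 / (1 + (Re (g z) * Re (g z) + Im (g z) * Im (g z))))).
Proof.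
  apply functional_extensionality. intros z. rewrite <- Tfun_eq.
  pose proof (Tfun_pos g z).
  unfold Ymap, sphere_point. f_equal; [f_equal|]; field; lra.
Qed.

Lemma C_neq0_sqr (z : C) : z <> 0%C -> 0 < Re z * Re z + Im z * Im z.
Proof.
  intros H. destruct z as [x y]; cbn.
  destruct (Req_dec x 0) as [->|]; [destruct (Req_dec y 0) as [->|]|]; try nra.
  exfalso; apply H; reflexivity.
Qed.

Lemma eta_support_surface (g : C -> C) (h : C -> R) :
  eta g h = support_surface (Ymap g) (conformal_factor g) h.
Proof.
  apply functional_extensionality. intros z. unfold eta, gradL, support_surface, conformal_factor.
  rewrite Rinv_inv. reflexivity.
Qed.

Lemma Ymap_smooth (U : C -> Prop) (g : C -> C) :
  open U -> holomorphic_on U g -> vsmooth U (Ymap g).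
Proof.
  intros HU (Hd & Ha & Hb). rewrite Ymap_sphere_point.
  apply (stereo_smooth U (fun z => Re (g z)) (fun z => Im (g z))); auto.
Qed.

Lemma conformal_factor_eq (g : C -> C) (z : C) : C_derive g z <> 0%C ->
  conformal_factor g z =
  (Re (C_derive g z) * Re (C_derive g z) + Im (C_derive g z) * Im (C_derive g z)) *
  (2 / Tfun g z * (2 / Tfun g z)).
Proof.
  intros H. apply C_neq0_sqr in H. unfold conformal_factor. rewrite Cmod_sqr.
  pose proof (Tfun_pos g z). field. split; lra.
Qed.

Lemma Ymap_frame (U : C -> Prop) (g : C -> C) (z : C) :
  open U -> holomorphic_on U g -> U z -> C_derive g z <> 0%C ->
  conformal_frame (Ymap g) (conformal_factor g) z.
Proof.
  intros HU Hg Hz H0. pose proof (C_neq0_sqr _ H0) as Hq.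
  destruct (holomorphic_CR U g z Hg Hz) as (E1 & E2 & _).
  assert (K : conformal_frame (Ymap g) (fun z => (pd1 (fun w => Re (g w)) z * pd1 (fun w => Re (g w)) z
     + pd1 (fun w => Im (g w)) z * pd1 (fun w => Im (g w)) z) *
     (2 / (1 + (Re (g z) * Re (g z) + Im (g z) * Im (g z))) *
      (2 / (1 + (Re (g z) * Re (g z) + Im (g z) * Im (g z)))))) z).
  { rewrite Ymap_sphere_point. destruct Hg as (Hd & Ha & Hb).
    apply (stereo_frame U (fun z => Re (g z)) (fun z => Im (g z))); auto.
    - intros w Hw. destruct (holomorphic_CR U g w (conj Hd (conj Ha Hb)) Hw) as (? & ? & ? & ?). lra.
    - intros w Hw. destruct (holomorphic_CR U g w (conj Hd (conj Ha Hb)) Hw) as (? & ? & ? & ?). lra.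
    - rewrite E1, E2. exact Hq. }
  unfold conformal_frame in *. rewrite conformal_factor_eq by exact H0.
  rewrite Tfun_eq, <- E1, <- E2. exact K.
Qed.

(** For holomorphic P + i Q the mixed second derivatives of h cancel by Cauchy-Riemann and the
    first-order terms because P and Q are harmonic, leaving |psi'|^2 times the Laplacian. *)
Lemma laplacian_conformal (U W : C -> Prop) (h P Q : C -> R) (z : C) :
  open U -> open W -> smooth_on U h -> smooth_on W P -> smooth_on W Q ->
  (forall w, W w -> U (P w, Q w)) ->
  (forall w, W w -> pd2 P w = - pd1 Q w) -> (forall w, W w -> pd2 Q w = pd1 P w) ->
  W z ->
  let k := fun w => h (P w, Q w) in
  dif k z (pd1 h (P z, Q z) * pd1 P z + pd2 h (P z, Q z) * pd1 Q z)
          (pd2 h (P z, Q z) * pd1 P z - pd1 h (P z, Q z) * pd1 Q z) /\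
  pd1 (pd1 k) z + pd2 (pd2 k) z =
    (pd1 P z * pd1 P z + pd1 Q z * pd1 Q z) *
    (pd1 (pd1 h) (P z, Q z) + pd2 (pd2 h) (P z, Q z)).
Proof.
  intros HU HW Hh HP HQ HWU CR1 CR2 Hz k.
  assert (Hk : forall w, W w ->
    dif k w (pd1 h (P w, Q w) * pd1 P w + pd2 h (P w, Q w) * pd1 Q w)
            (pd2 h (P w, Q w) * pd1 P w - pd1 h (P w, Q w) * pd1 Q w)).
  { intros w Hw. eapply dif_eq.
    - apply (dif_comp h P Q w); [exact (smooth_dif U h _ HU Hh (HWU w Hw))
       |exact (dif_cr_a W P Q HW HP CR1 w Hw)|exact (dif_cr_b W P Q HW HQ CR2 w Hw)].
    - reflexivity.
    - ring. }
  split; [apply Hk, Hz|].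
  destruct (dif_cr_pd W P Q HW HP HQ CR1 CR2 z Hz) as [K1 K2].
  pose proof (dif_cr_a W P Q HW HP CR1 z Hz) as K3.
  pose proof (dif_cr_b W P Q HW HQ CR2 z Hz) as K4.
  pose proof (dif_comp _ P Q z _ _ _ _ _ _ (smooth_dif U _ _ HU (smooth_pd1 _ _ Hh) (HWU z Hz)) K3 K4) as K5.
  pose proof (dif_comp _ P Q z _ _ _ _ _ _ (smooth_dif U _ _ HU (smooth_pd2 _ _ Hh) (HWU z Hz)) K3 K4) as K6.
  rewrite (pd1_ext_loc (pd1 k) (fun w => pd1 h (P w, Q w) * pd1 P w + pd2 h (P w, Q w) * pd1 Q w)).
  2:{ apply (eq_locally W); auto. intros w Hw. exact (dif_pd1 _ _ _ _ (Hk w Hw)). }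
  rewrite (pd2_ext_loc (pd2 k) (fun w => pd2 h (P w, Q w) * pd1 P w - pd1 h (P w, Q w) * pd1 Q w)).
  2:{ apply (eq_locally W); auto. intros w Hw. exact (dif_pd2 _ _ _ _ (Hk w Hw)). }
  match goal with |- pd1 ?F z + pd2 ?G z = _ =>
    erewrite (dif_pd1 F z); [|difs]; erewrite (dif_pd2 G z); [|difs] end. cbv beta.
  rewrite (smooth_Schwarz U h _ HU Hh (HWU z Hz)). ring.
Qed.

(** * The profile of [h] and its differential equation *)

Lemma is_derive_tanh (x : R) : is_derive tanh x (1 - tanh x ^ 2).
Proof.
  unfold tanh, sinh, cosh.
  assert (H : exp x + exp (- x) <> 0) by (pose proof (exp_pos x); pose proof (exp_pos (-x)); lra).
  auto_derive; [repeat split; auto; lra|]. field; auto.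
Qed.

Lemma tanh_exp (x : R) : tanh x = (exp (2 * x) - 1) / (exp (2 * x) + 1).
Proof.
  unfold tanh, sinh, cosh. replace (2 * x) with (x + x) by ring. rewrite exp_plus, exp_Ropp.
  pose proof (exp_pos x). field. split; nra.
Qed.

Definition h_profile' (a1 a2 u : R) : R :=
  - a1 * tanh u - (a2 + a1 * (u - 1)) * (1 - tanh u ^ 2).

Lemma is_derive_h_profile (a1 a2 u : R) : is_derive (h_profile a1 a2) u (h_profile' a1 a2 u).
Proof.
  unfold h_profile, h_profile'. pose proof (is_derive_tanh u) as K.
  auto_derive; [eexists;
      exact K|]. replace (Derive (fun x => tanh x) u) with (1 - tanh u ^ 2) by (symmetry;
          apply is_derive_unique; exact K). ring.
Qed.

(** The equation h'' + 2 (1 - tanh^2 u) h = 0, solved by a1 (1 - u tanh u) + (a1 - a2) tanh u. *)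
Lemma is_derive_h_profile' (a1 a2 u : R) :
  is_derive (h_profile' a1 a2) u (- 2 * (1 - tanh u ^ 2) * h_profile a1 a2 u).
Proof.
  unfold h_profile, h_profile'. pose proof (is_derive_tanh u) as K.
  auto_derive; [repeat split; eexists;
      exact K|]. replace (Derive (fun x => tanh x) u) with (1 - tanh u ^ 2) by (symmetry;
          apply is_derive_unique; exact K). ring.
Qed.

(** * The Laplace equation and [eta] in a chart where g is the exponential *)

Section Conformal.
Context (U W : C -> Prop) (g psi : C -> C) (h : C -> R)
  (HU : open U) (Hg : holomorphic_on U g) (Hg' : forall z, U z -> C_derive g z <> 0%C)
  (Hh : smooth_on U h) (Hpsi : conformal_parameter W U psi)
  (Hexp : forall z, W z -> g (psi z) = Cexp z).

(** Real and imaginary part of g'(psi) psi' = e^z, obtained by comparing the real differentials of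
    both sides of g(psi(z)) = e^z. *)
Lemma conformal_chain (z : C) : W z ->
  let A := Re (C_derive g (psi z)) in let B := Im (C_derive g (psi z)) in
  let p := Re (C_derive psi z) in let q := Im (C_derive psi z) in
  A * p - B * q = exp (Re z) * cos (Im z) /\ B * p + A * q = exp (Re z) * sin (Im z).
Proof.
  intros Hz. destruct Hpsi as (HW & Hp & HWU & _).
  destruct Hp as (Hpd & HP & HQ).
  destruct (C_derive_dif psi z _ (Hpd z Hz)) as [K1 K2].
  destruct (C_derive_dif g _ _ (proj1 Hg _ (HWU z Hz))) as [K3 K4].
  rewrite (surjective_pairing (psi z)) in K3, K4.
  pose proof (dif_comp (fun w => Re (g w)) (fun w => Re (psi w)) (fun w => Im (psi w)) z _ _ _ _ _ _ K3 K1
      K2) as K5.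
  pose proof (dif_comp (fun w => Im (g w)) (fun w => Re (psi w)) (fun w => Im (psi w)) z _ _ _ _ _ _ K4 K1
      K2) as K6.
  assert (E : forall w, W w -> g (Re (psi w), Im (psi w)) = Cexp w).
  { intros w Hw. rewrite <- Hexp by exact Hw. f_equal. symmetry. apply surjective_pairing. }
  destruct (dif_eq_on W HW _ Cexp_re z _ _ _ _ (fun w Hw => f_equal Re (E w Hw)) Hz K5 (proj1 (dif_Cexp
      z))) as [L1 L2].
  destruct (dif_eq_on W HW _ Cexp_im z _ _ _ _ (fun w Hw => f_equal Im (E w Hw)) Hz K6 (proj2 (dif_Cexp
      z))) as [L3 L4].
  rewrite <- (surjective_pairing (psi z)) in L1, L2, L3, L4.
  unfold Cexp_re, Cexp_im in *. cbv zeta.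
  change (Re z) with (fst z). change (Im z) with (snd z). split; lra.
Qed.

(** In the chart T = 1 + e^(2u) and |g'|^2 |psi'|^2 = e^(2u). Hence |psi'|^2 E = 4 e^(2u) / (1 +
    e^(2u))^2 = 1 - tanh^2 u, and |psi'|^2 is also the factor of the Laplacian. *)
Lemma conformal_laplace (z : C) : W z ->
  let k := fun w => h (psi w) in
  laplace_condition (conformal_factor g) h (psi z) <->
  pd1 (pd1 k) z + pd2 (pd2 k) z + 2 * (1 - tanh (Re z) ^ 2) * k z = 0.
Proof.
  intros Hz k. destruct (conformal_chain z Hz) as [L1 L2].
  destruct Hpsi as (HW & Hp & HWU & _ & Hp0).
  assert (CR := fun w Hw => holomorphic_CR W psi w Hp Hw).
  destruct (CR z Hz) as (E1 & E2 & E3 & E4).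
  destruct Hp as (Hpd & HP & HQ).
  assert (Ek : (fun w => h (Re (psi w), Im (psi w))) = k).
  { apply functional_extensionality. intros w. unfold k. f_equal. symmetry. apply surjective_pairing. }
  destruct (laplacian_conformal U W h (fun w => Re (psi w)) (fun w => Im (psi w)) z HU HW Hh HP HQ) as [_
      K]; auto.
  { intros w Hw. change (U (fst (psi w), snd (psi w))). rewrite <- surjective_pairing. auto. }
  { intros w Hw. destruct (CR w Hw) as (? & ? & ? & ?); lra. }
  { intros w Hw. destruct (CR w Hw) as (? & ? & ? & ?); lra. }
  rewrite Ek, E1, E2 in K. change (Re (psi z), Im (psi z)) with (fst (psi z), snd (psi z)) in K.
  rewrite <- surjective_pairing in K.
  pose proof (C_neq0_sqr _ (Hp0 z Hz)) as HD.
  set (p := Re (C_derive psi z)) in *. set (q := Im (C_derive psi z)) in *.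
  set (A := Re (C_derive g (psi z))) in *. set (B := Im (C_derive g (psi z))) in *.
  assert (HT : Tfun g (psi z) = 1 + exp (2 * Re z)).
  { rewrite Tfun_eq, Hexp by exact Hz. unfold Cexp, Re, Im; cbn [fst snd].
    replace (2 * fst z) with (fst z + fst z) by ring. rewrite exp_plus.
    f_equal. transitivity (exp (fst z) * exp (fst z) * ((sin (snd z))² + (cos (snd z))²));
      [unfold Rsqr; ring|rewrite sin2_cos2; ring]. }
  assert (Hq : (A * A + B * B) * (p * p + q * q) = exp (2 * Re z)).
  { transitivity ((A * p - B * q) * (A * p - B * q) + (B * p + A * q) * (B * p + A * q)); [ring|].
    rewrite L1, L2. replace (2 * Re z) with (Re z + Re z) by ring. rewrite exp_plus.
    transitivity (exp (Re z) * exp (Re z) * ((sin (Im z))² + (cos (Im z))²));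
      [unfold Rsqr; ring|rewrite sin2_cos2; ring]. }
  assert (HE : (p * p + q * q) * conformal_factor g (psi z) = 1 - tanh (Re z) ^ 2).
  { rewrite conformal_factor_eq by auto. fold A B. rewrite HT, tanh_exp.
    transitivity (((A * A + B * B) * (p * p + q * q)) * (2 / (1 + exp (2 * Re z)) * (2 / (1 + exp (2 * Re
        z))))); [ring|].
    rewrite Hq. pose proof (exp_pos (2 * Re z)). field. lra. }
  rewrite K, <- HE. unfold laplace_condition, k. split; intros H.
  - transitivity ((p * p + q * q) * (pd1 (pd1 h) (psi z) + pd2 (pd2 h) (psi z)
        + 2 * conformal_factor g (psi z) * h (psi z))); [ring|rewrite H; ring].
  - apply (Rmult_eq_reg_l (p * p + q * q)); [|lra]. rewrite Rmult_0_r, <- H. ring.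
Qed.

(** The differential (d, 0) says that [h] varies with u only, to first order at z. Inverting the
    chain rule expresses the gradient through d, and the angle enters only as a rotation. *)
Lemma eta_conformal (z : C) (d : R) : W z ->
  dif (fun w => h (psi w)) z d 0 ->
  let t := tanh (Re z) in let r := exp (Re z) in
  eta g h (psi z) = rotation_point
    (- d * t * (1 + r * r) / (2 * r) + h (psi z) * (2 * r / (1 + r * r)))
    (- d - h (psi z) * t) (Im z).
Proof.
  intros Hz Hd. cbv zeta. destruct (conformal_chain z Hz) as [L1 L2].
  destruct Hpsi as (HW & Hp & HWU & _ & Hp0).
  assert (CR := fun w Hw => holomorphic_CR W psi w Hp Hw).
  destruct (CR z Hz) as (E1 & E2 & E3 & E4).
  assert (CRg := fun w Hw => holomorphic_CR U g w Hg Hw).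
  destruct (CRg _ (HWU z Hz)) as (G1 & G2 & G3 & G4).
  destruct Hp as (Hpd & HP & HQ).
  assert (Ek : (fun w => h (Re (psi w), Im (psi w))) = (fun w => h (psi w))).
  { apply functional_extensionality. intros w. f_equal. symmetry. apply surjective_pairing. }
  destruct (laplacian_conformal U W h (fun w => Re (psi w)) (fun w => Im (psi w)) z HU HW Hh HP HQ) as [K
      _]; auto.
  { intros w Hw. change (U (fst (psi w), snd (psi w))). rewrite <- surjective_pairing. auto. }
  { intros w Hw. destruct (CR w Hw) as (? & ? & ? & ?); lra. }
  { intros w Hw. destruct (CR w Hw) as (? & ? & ? & ?); lra. }
  rewrite Ek, E1, E2 in K. change (Re (psi z), Im (psi z)) with (fst (psi z), snd (psi z)) in K.
  rewrite <- surjective_pairing in K.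
  pose proof (dif_pd1 _ _ _ _ K) as D1. rewrite (dif_pd1 _ _ _ _ Hd) in D1.
  pose proof (dif_pd2 _ _ _ _ K) as D2. rewrite (dif_pd2 _ _ _ _ Hd) in D2. clear K.
  pose proof (C_neq0_sqr _ (Hp0 z Hz)) as HD.
  pose proof (C_neq0_sqr _ (Hg' _ (HWU z Hz))) as HG.
  assert (Hv := vdif_stereo U (fun z => Re (g z)) (fun z => Im (g z)) HU (proj1 (proj2 Hg)) (proj2 (proj2 Hg))
    (fun w Hw => ltac:(destruct (CRg w Hw) as (? & ? & ? & ?); lra))
    (fun w Hw => ltac:(destruct (CRg w Hw) as (? & ? & ? & ?); lra)) (psi z) (HWU z Hz)).
  cbv beta zeta in Hv. rewrite <- Ymap_sphere_point in Hv.
  unfold eta, gradL. rewrite (vdif_D1 _ _ _ _ Hv), (vdif_D2 _ _ _ _ Hv). clear Hv.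
  rewrite G1, G2, Cmod_sqr, Ymap_sphere_point, <- Tfun_eq.
  set (p := Re (C_derive psi z)) in *. set (q := Im (C_derive psi z)) in *.
  set (A := Re (C_derive g (psi z))) in *. set (B := Im (C_derive g (psi z))) in *.
  assert (HT : Tfun g (psi z) = 1 + exp (Re z) * exp (Re z)).
  { rewrite Tfun_eq, Hexp by exact Hz. unfold Cexp, Re, Im; cbn [fst snd].
    f_equal. transitivity (exp (fst z) * exp (fst z) * ((sin (snd z))² + (cos (snd z))²));
      [unfold Rsqr; ring|rewrite sin2_cos2; ring]. }
  rewrite tanh_exp. replace (2 * Re z) with (Re z + Re z) by ring. rewrite exp_plus.
  rewrite HT, Hexp by exact Hz. clear HT.
  set (h1 := pd1 h (psi z)) in *. set (h2 := pd2 h (psi z)) in *.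
  assert (Hcs : cos (Im z) * cos (Im z) + sin (Im z) * sin (Im z) = 1).
  { pose proof (sin2_cos2 (Im z)) as K. unfold Rsqr in K. lra. }
  change (Re (Cexp z)) with (exp (Re z) * cos (Im z)).
  change (Im (Cexp z)) with (exp (Re z) * sin (Im z)).
  pose proof (exp_pos (Re z)) as Hr. unfold rotation_point, sphere_point.
  set (C := cos (Im z)) in *. set (S := sin (Im z)) in *. set (r := exp (Re z)) in *.
  set (G := A * A + B * B) in *. set (F := p * p + q * q) in *.
  assert (HQ' : G * F = r * r).
  { transitivity ((A * p - B * q) * (A * p - B * q) + (B * p + A * q) * (B * p + A * q));
      [unfold G, F; ring|]. rewrite L1, L2. transitivity (r * r * (C * C + S * S)); [ring|rewrite Hcs;
          ring]. }
  (* [Hm] and [Hn] are the two parts of (h_1 + i h_2) g' = |g'|^2 (d / r) e^(iv), the only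
     combinations through which the partials of [h] enter [gradL]. They are verified after
     multiplication by |psi'|^2. *)
  assert (Hm : h1 * A - h2 * B = G * (d * C / r)).
  { apply (Rmult_eq_reg_l F); [|lra]. transitivity (d * (r * C)).
    - rewrite <- L1, D1.
      transitivity ((h1 * A - h2 * B) * F + ((h2 * p - h1 * q) - 0) * (A * q + B * p)); [rewrite <- D2;
          ring|unfold F; ring].
    - transitivity ((G * F) * (d * C / r)); [rewrite HQ'; field; lra|ring]. }
  assert (Hn : h1 * B + h2 * A = G * (d * S / r)).
  { apply (Rmult_eq_reg_l F); [|lra]. transitivity (d * (r * S)).
    - rewrite <- L2, D1.
      transitivity ((h1 * B + h2 * A) * F + ((h2 * p - h1 * q) - 0) * (B * q - A * p)); [rewrite <- D2;
          ring|unfold F; ring].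
    - transitivity ((G * F) * (d * S / r)); [rewrite HQ'; field; lra|ring]. }
  assert (Hmn : r * C * (G * (d * C / r)) + r * S * (G * (d * S / r)) = G * d).
  { transitivity (G * d * (C * C + S * S)); [field; lra|rewrite Hcs; ring]. }
  set (t := 2 / (1 + r * r)).
  apply R3_ext; coords; unfold coord1, coord2, coord3; cbn [fst snd].
  - transitivity ((1 + r * r) ^ 2 / (4 * G) * (t * (h1 * A - h2 * B)
      - r * C * (t * t) * (r * C * (h1 * A - h2 * B) + r * S * (h1 * B + h2 * A))) + h (psi z) * (r * C * t));
      [ring|]. rewrite Hm, Hn, Hmn. unfold t. field. repeat split; nra.
  - transitivity ((1 + r * r) ^ 2 / (4 * G) * (t * (h1 * B + h2 * A)
      - r * S * (t * t) * (r * C * (h1 * A - h2 * B) + r * S * (h1 * B + h2 * A))) + h (psi z) * (r * S * t));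
      [ring|]. rewrite Hm, Hn, Hmn. unfold t. field. repeat split; nra.
  - transitivity ((1 + r * r) ^ 2 / (4 * G) *
      - ((t * t) * (r * C * (h1 * A - h2 * B) + r * S * (h1 * B + h2 * A))) + h (psi z) * (t - 1));
      [ring|]. rewrite Hm, Hn, Hmn. unfold t. field. repeat split; nra.
Qed.

End Conformal.

(** * The rotational profiles *)

Lemma exp_nat_mult (n : nat) (u : R) : exp (INR n * u) = exp u ^ n.
Proof.
  induction n as [|n IH]; [cbn; rewrite Rmult_0_l; apply exp_0|].
  rewrite S_INR. replace ((INR n + 1) * u) with (u + INR n * u) by ring.
  rewrite exp_plus, IH. reflexivity.
Qed.

Lemma exp_profile (u : R) :
  exp (2 * u) = exp u ^ 2 /\ exp (4 * u) = exp u ^ 4 /\ exp (6 * u) = exp u ^ 6.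
Proof.
  rewrite <- !exp_nat_mult. repeat split; f_equal; f_equal; cbn; ring.
Qed.

Section Normal.
Context (U W : C -> Prop) (g psi : C -> C) (h : C -> R) (a1 a2 : R)
  (HU : open U) (Hg : holomorphic_on U g) (Hg' : forall z, U z -> C_derive g z <> 0%C)
  (Hh : smooth_on U h) (Hh0 : forall z, U z -> h z <> 0)
  (Hn : normal_parameter a1 a2 W U g h psi).

Lemma normal_dif (f f' : R -> R) (k : C -> R) (z : C) :
  (forall x, is_derive f x (f' x)) -> (forall w, W w -> k w = f (Re w)) -> W z ->
  dif k z (f' (Re z)) 0.
Proof.
  intros Hf Hk Hz. destruct Hn as ((HW & _) & _).
  apply dif_ext_loc with (fun w => f (fst w)).
  - apply (eq_locally W); auto. intros w Hw; symmetry; auto.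
  - eapply dif_eq; [apply (dif_comp1 f); [apply Hf|apply dif_fst]| |]; unfold Re; ring.
Qed.

Lemma normal_h_dif (z : C) : W z -> dif (fun w => h (psi w)) z (h_profile' a1 a2 (Re z)) 0.
Proof.
  apply (normal_dif (h_profile a1 a2)); [apply is_derive_h_profile|].
  intros w Hw. apply Hn, Hw.
Qed.

Lemma normal_laplace (z : C) : W z -> laplace_condition (conformal_factor g) h (psi z).
Proof.
  intros Hz. pose proof Hn as (Hp & Hgh). pose proof Hp as (HW & _).
  apply (conformal_laplace U W g psi h HU Hg Hg' Hh Hp (fun w Hw => proj1 (Hgh w Hw)) z Hz).
  set (k := fun w => h (psi w)).
  assert (K1 : dif (pd1 k) z (-2 * (1 - tanh (Re z) ^ 2) * h_profile a1 a2 (Re z)) 0).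
  { apply (normal_dif (h_profile' a1 a2) (fun x => -2 * (1 - tanh x ^ 2) * h_profile a1 a2 x)); auto.
    - apply is_derive_h_profile'.
    - intros w Hw. exact (dif_pd1 _ _ _ _ (normal_h_dif w Hw)). }
  assert (K2 : dif (pd2 k) z 0 0).
  { apply dif_ext_loc with (fun _ => 0); [|apply dif_const].
    apply (eq_locally W); auto. intros w Hw. symmetry. exact (dif_pd2 _ _ _ _ (normal_h_dif w Hw)). }
  rewrite (dif_pd1 _ _ _ _ K1), (dif_pd2 _ _ _ _ K2). unfold k. rewrite (proj2 (Hgh z Hz)). ring.
Qed.

(** [eta_conformal] with d = h'. The profile is (a1 cosh u, a1 u + a2 - a1), so for a1 <> 0 the
    surface is part of a catenoid. *)
Lemma normal_eta (z : C) : W z ->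
  eta g h (psi z) = rotation_point (M1_profile a1 (Re z)) (N1_profile a1 a2 (Re z)) (Im z).
Proof.
  intros Hz. pose proof Hn as (Hp & Hgh).
  rewrite (eta_conformal U W g psi h HU Hg Hg' Hh Hp (fun w Hw => proj1 (Hgh w Hw)) z _ Hz (normal_h_dif z
      Hz)).
  rewrite (proj2 (Hgh z Hz)).
  unfold rotation_point, M1_profile, N1_profile, h_profile', h_profile.
  rewrite tanh_exp. destruct (exp_profile (Re z)) as (-> & _).
  pose proof (exp_pos (Re z)). set (r := exp (Re z)) in *.
  f_equal; [f_equal; f_equal|]; field; nra.
Qed.

Lemma normal_X (c : R) (z : C) : W z ->
  Xmap g c h (psi z) =
    rotation_point (M_profile c a1 a2 (Re z)) (N_profile c a1 a2 (Re z)) (Im z).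
Proof.
  intros Hz. pose proof Hn as (Hp & Hgh). pose proof Hp as (_ & _ & HWU & _).
  assert (HS : 0 < Sfun g h (psi z)).
  { unfold Sfun. rewrite eta_support_surface.
    apply (support_surface_norm U (Ymap g) (conformal_factor g) h HU (Ymap_smooth U g HU Hg)); auto.
    intros w Hw. apply (Ymap_frame U); auto. }
  unfold Sfun in HS. unfold Xmap, Sfun. rewrite normal_eta in * by exact Hz.
  unfold Ymap. rewrite Tfun_eq, (proj2 (Hgh z Hz)), (proj1 (Hgh z Hz)).
  assert (Hcs : cos (Im z) * cos (Im z) + sin (Im z) * sin (Im z) = 1).
  { pose proof (sin2_cos2 (Im z)) as K. unfold Rsqr in K. lra. }
  change (Re (Cexp z)) with (exp (Re z) * cos (Im z)).
  change (Im (Cexp z)) with (exp (Re z) * sin (Im z)).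
  revert HS. unfold dot, rotation_point, coord1, coord2, coord3; cbn [fst snd].
  unfold M1_profile, N1_profile, M_profile, N_profile, profile_den, h_profile, p1, p2, p3, l1, l2.
  rewrite tanh_exp. destruct (exp_profile (Re z)) as (-> & -> & ->).
  pose proof (exp_pos (Re z)) as Hr.
  set (u := Re z) in *. set (r := exp u) in *. set (C := cos (Im z)) in *. set (S := sin (Im z)) in *.
  (* D = 4 e^(2u) S; expanded, it is the bracket in [profile_den]. It is nonzero because S > 0. *)
  set (D := a1 ^ 2 * (1 + r ^ 2) ^ 2 + 4 * r ^ 2 * (a2 + a1 * (u - 1)) ^ 2).
  assert (E : a1 * ((1 + r ^ 2) / (2 * r)) * C * (a1 * ((1 + r ^ 2) / (2 * r)) * C) +
    a1 * ((1 + r ^ 2) / (2 * r)) * S * (a1 * ((1 + r ^ 2) / (2 * r)) * S) +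
    (a2 + a1 * (u - 1)) * (a2 + a1 * (u - 1)) = D / (4 * r ^ 2)).
  { transitivity (a1 ^ 2 * ((1 + r ^ 2) / (2 * r)) ^ 2 * (C * C + S * S) + (a2 + a1 * (u - 1)) ^ 2); [ring|].
    rewrite Hcs. unfold D. field. lra. }
  rewrite E. intros HS.
  assert (HD : D <> 0). { intros K. rewrite K in HS. unfold Rdiv in HS. lra. }
  replace (1 + (r * C * (r * C) + r * S * (r * S))) with (1 + r ^ 2)
    by (transitivity (1 + r ^ 2 * (C * C + S * S)); [rewrite Hcs; ring|ring]).
  assert (HP : (1 + r ^ 2) * (4 * a2 ^ 2 * r ^ 2 + 8 * a1 * a2 * r ^ 2 * (u - 1) +
      a1 ^ 2 * (1 + r ^ 4 + r ^ 2 * (6 - 8 * u + 4 * u ^ 2))) = (1 + r ^ 2) * D) by (unfold D; ring).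
  rewrite HP.
  assert (H1r : 1 + r ^ 2 <> 0) by nra. assert (H2r : r ^ 2 + 1 <> 0) by nra.
  apply R3_ext; coords; unfold coord1, coord2, coord3; cbn [fst snd];
    unfold D in *; field; repeat split; try lra; intros K; apply HD; rewrite <- K; ring.
Qed.

End Normal.

(** * Surfaces of rotation *)

Ltac triples :=
  repeat match goal with
  | |- context [coord1 (?a, ?b, ?c)] => change (coord1 (a, b, c)) with a
  | |- context [coord2 (?a, ?b, ?c)] => change (coord2 (a, b, c)) with b
  | |- context [coord3 (?a, ?b, ?c)] => change (coord3 (a, b, c)) with c
  end.

Lemma dif_comp_map (f : C -> R) (phi : C -> C) (w : C) (a b p1 p2 q1 q2 : R) :
  dif f (phi w) a b ->
  dif (fun x => Re (phi x)) w p1 p2 -> dif (fun x => Im (phi x)) w q1 q2 ->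
  dif (fun x => f (phi x)) w (a * p1 + b * q1) (a * p2 + b * q2).
Proof.
  intros Hf HP HQ. rewrite (surjective_pairing (phi w)) in Hf.
  apply dif_ext_loc with (fun x => f (Re (phi x), Im (phi x))).
  - apply filter_forall. intros x. f_equal. symmetry. apply surjective_pairing.
  - exact (dif_comp f _ _ w _ _ _ _ _ _ Hf HP HQ).
Qed.

Lemma vdif_comp_map (F : C -> R3) (phi : C -> C) (w : C) (A B : R3) (p1 p2 q1 q2 : R) :
  vdif F (phi w) A B ->
  dif (fun x => Re (phi x)) w p1 p2 -> dif (fun x => Im (phi x)) w q1 q2 ->
  vdif (fun x => F (phi x)) w (plus (scal p1 A) (scal q1 B)) (plus (scal p2 A) (scal q2 B)).
Proof.
  intros (H1 & H2 & H3) HP HQ.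
  split; [|split].
  - eapply dif_eq; [exact (dif_comp_map _ phi w _ _ _ _ _ _ H1 HP HQ)|..]; coords; ring.
  - eapply dif_eq; [exact (dif_comp_map _ phi w _ _ _ _ _ _ H2 HP HQ)|..]; coords; ring.
  - eapply dif_eq; [exact (dif_comp_map _ phi w _ _ _ _ _ _ H3 HP HQ)|..]; coords; ring.
Qed.

Lemma open_box (W : C -> Prop) (w0 : C) : open W -> W w0 ->
  exists d, 0 < d /\ forall u v, Rabs (u - fst w0) < d -> Rabs (v - snd w0) < d -> W (u, v).
Proof.
  intros HW H0. destruct (HW w0 H0) as [d Hd]. exists d. split; [apply cond_pos|].
  intros u v Hu Hv. apply Hd. split; assumption.
Qed.

Lemma box_open (x0 y0 d e : R) :
  open (fun z : C => Rabs (fst z - x0) < d /\ Rabs (snd z - y0) < e).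
Proof.
  intros [x y] [Hx Hy]. cbn [fst snd] in *.
  assert (Hm : 0 < Rmin (d - Rabs (x - x0)) (e - Rabs (y - y0))) by (apply Rmin_pos; lra).
  exists (mkposreal _ Hm). intros [x' y'] [Kx Ky].
  change (Rabs (x' - x) < Rmin (d - Rabs (x - x0)) (e - Rabs (y - y0))) in Kx.
  change (Rabs (y' - y) < Rmin (d - Rabs (x - x0)) (e - Rabs (y - y0))) in Ky.
  pose proof (Rmin_l (d - Rabs (x - x0)) (e - Rabs (y - y0))).
  pose proof (Rmin_r (d - Rabs (x - x0)) (e - Rabs (y - y0))).
  cbn [fst snd]. split.
  - replace (x' - x0) with ((x' - x) + (x - x0)) by ring. pose proof (Rabs_triang (x' - x) (x - x0)). lra.
  - replace (y' - y0) with ((y' - y) + (y - y0)) by ring. pose proof (Rabs_triang (y' - y) (y - y0)). lra.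
Qed.

Lemma zero_derivative_const (f : R -> R) (u0 d : R) :
  (forall t, Rabs (t - u0) < d -> is_derive f t 0) ->
  forall t, Rabs (t - u0) < d -> f t = f u0.
Proof.
  intros H t Ht. apply Rabs_lt_between in Ht.
  destruct (Rtotal_order t u0) as [L|[->|L]]; [|reflexivity|].
  - apply (eq_is_derive f t u0); auto. intros s Hs. apply H. apply Rabs_lt_between. lra.
  - symmetry. apply (eq_is_derive f u0 t); auto. intros s Hs. apply H. apply Rabs_lt_between. lra.
Qed.

(** Inside a box two coordinate segments join any point to the centre, so f is locally constant. The
    sets where f equals f z and where it does not are then both open and would separate [U]. *)
Lemma locally_const_connected (U : C -> Prop) (f : C -> R) :
  open U -> dom_connected U -> (forall z, U z -> dif f z 0 0) ->
  forall z z', U z -> U z' -> f z = f z'.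
Proof.
  intros HU Hc Hd z z' Hz Hz'.
  assert (Hloc : forall w, U w -> locally w (fun w' => U w' /\ f w' = f w)).
  { intros w Hw. destruct (open_box U w HU Hw) as (d & Hd0 & Hb).
    exists (mkposreal d Hd0). intros [x y] [Kx Ky].
    change (Rabs (x - fst w) < d) in Kx. change (Rabs (y - snd w) < d) in Ky.
    split; [apply Hb; assumption|].
    transitivity (f (fst w, y)).
    - apply (zero_derivative_const (fun t => f (t, y)) (fst w) d); auto.
      intros t Ht. exact (dif_is_derive1 f (t, y) _ _ (Hd _ (Hb t y Ht Ky))).
    - rewrite (surjective_pairing w) at 2.
      apply (zero_derivative_const (fun t => f (fst w, t)) (snd w) d); auto.
      intros t Ht. assert (K : Rabs (fst w - fst w) < d) by (rewrite Rminus_diag, Rabs_R0; exact Hd0).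
      exact (dif_is_derive2 f (fst w, t) _ _ (Hd _ (Hb (fst w) t K Ht))). }
  apply NNPP. intros Hne.
  apply (Hc (fun w => U w /\ f w = f z) (fun w => U w /\ f w <> f z)).
  - intros w [Hw E]. eapply filter_imp; [|exact (Hloc w Hw)]. intros w' [? ?]; split; congruence.
  - intros w [Hw E]. eapply filter_imp; [|exact (Hloc w Hw)]. intros w' [? ?]; split; congruence.
  - intros w Hw. destruct (Req_dec (f w) (f z)); auto.
  - intros w _ [_ ?] [_ ?]; auto.
  - exists z; auto.
  - exists z'; repeat split; auto.
Qed.

Lemma is_derive_lincomb (f f' : R -> R) (x a b c s : R) :
  is_derive f x a -> is_derive f' x b -> is_derive (fun t => f t * c + f' t * s) x (a * c + b * s).
Proof.
  intros H H'.
  apply (is_derive_ext (K := R_AbsRing) (V := R_NormedModule) (fun t => plus (scal c (f t)) (scal s (f' t)))).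
  { intros t. unfold plus, scal; cbn; unfold mult; cbn. ring. }
  replace (a * c + b * s) with (c * a + s * b) by ring.
  exact (is_derive_plus _ _ _ _ _ (is_derive_scal f x c a H) (is_derive_scal f' x s b H')).
Qed.

(* A moving unit vector (a, b) that stays orthogonal to a fixed nonzero vector (m, n) does not move. *)
Lemma planar_constant (m n a b a' b' : R) :
  m <> 0 \/ n <> 0 -> m * a + n * b = 0 -> a * a + b * b = 1 ->
  m * a' + n * b' = 0 -> a * a' + b * b' = 0 -> a' = 0 /\ b' = 0.
Proof.
  intros Hmn H1 H2 H3 H4.
  set (l := n * a - m * b).
  assert (Em : m = - b * l).
  { transitivity (m * (a * a + b * b) - a * (m * a + n * b)); [rewrite H1, H2; ring|unfold l; ring]. }
  assert (En : n = a * l).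
  { transitivity (n * (a * a + b * b) - b * (m * a + n * b)); [rewrite H1, H2; ring|unfold l; ring]. }
  assert (Hl : l <> 0) by (intros K; rewrite K in Em, En; destruct Hmn as [K'|K']; apply K'; lra).
  assert (H5 : a * b' - b * a' = 0).
  { apply (Rmult_eq_reg_l l); auto. rewrite Rmult_0_r, <- H3, Em, En at 1.
    clearbody l. ring. }
  split.
  - transitivity (a' * (a * a + b * b) - a * (a * a' + b * b') + b * (a * b' - b * a'));
      [rewrite H2, H4, H5; ring|ring].
  - transitivity (b' * (a * a + b * b) - b * (a * a' + b * b') - a * (a * b' - b * a'));
      [rewrite H2, H4, H5; ring|ring].
Qed.

Section Rotation.
Context (U W : C -> Prop) (F nu : C -> R3) (phi : C -> C) (M N : R -> R)
  (HU : open U) (HF : vsmooth U F) (Hnu : vsmooth U nu)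
  (Hunit : forall z, U z -> dot (nu z) (nu z) = 1)
  (Htan : forall z, U z -> dot (D1 F z) (nu z) = 0 /\ dot (D2 F z) (nu z) = 0)
  (Himm : immersion_on U F) (Hphi : change_of_parameters W U phi)
  (Hrot : forall w, W w -> F (phi w) = rotation_point (M (Re w)) (N (Re w)) (Im w)).

Lemma rotation_tangents (w : C) : W w ->
  exists m n : R, is_derive M (fst w) m /\ is_derive N (fst w) n /\
    M (fst w) <> 0 /\ (m <> 0 \/ n <> 0) /\
    dot (m * cos (snd w), m * sin (snd w), n) (nu (phi w)) = 0 /\
    dot (- M (fst w) * sin (snd w), M (fst w) * cos (snd w), 0) (nu (phi w)) = 0.
Proof.
  intros Hw. destruct Hphi as (HW & HP & HQ & HWU & _ & HJ).
  pose proof (smooth_dif W _ w HW HP Hw) as KP. pose proof (smooth_dif W _ w HW HQ Hw) as KQ.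
  specialize (HJ w Hw).
  set (P1 := pd1 (fun x => Re (phi x)) w) in *. set (P2 := pd2 (fun x => Re (phi x)) w) in *.
  set (Q1 := pd1 (fun x => Im (phi x)) w) in *. set (Q2 := pd2 (fun x => Im (phi x)) w) in *.
  pose proof (vdif_comp_map F phi w _ _ _ _ _ _ (vsmooth_vdif U F _ HU HF (HWU w Hw)) KP KQ) as KF.
  set (G1 := plus (scal P1 (D1 F (phi w))) (scal Q1 (D2 F (phi w)))) in *.
  set (G2 := plus (scal P2 (D1 F (phi w))) (scal Q2 (D2 F (phi w)))) in *.
  destruct (Htan (phi w) (HWU w Hw)) as [T1 T2].
  assert (TG1 : dot G1 (nu (phi w)) = 0) by (unfold G1; dots; rewrite T1, T2; ring).
  assert (TG2 : dot G2 (nu (phi w)) = 0) by (unfold G2; dots; rewrite T1, T2; ring).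
  assert (Z1 : G1 <> zero).
  { intros K. specialize (Himm (phi w) (HWU w Hw) (P1, Q1) K). injection Himm; intros A B.
    apply HJ. rewrite A, B. ring. }
  assert (Z2 : G2 <> zero).
  { intros K. specialize (Himm (phi w) (HWU w Hw) (P2, Q2) K). injection Himm; intros A B.
    apply HJ. rewrite A, B. ring. }
  assert (L1 := locally_slice1 W w (HW w Hw)). assert (L2 := locally_slice2 W w (HW w Hw)).
  destruct w as [u v]. cbn [fst snd] in *.
  destruct KF as (K1 & K2 & K3).
  pose proof (dif_is_derive1 _ _ _ _ K1) as A1. pose proof (dif_is_derive1 _ _ _ _ K2) as A2.
  pose proof (dif_is_derive1 _ _ _ _ K3) as A3.
  pose proof (dif_is_derive2 _ _ _ _ K1) as B1. pose proof (dif_is_derive2 _ _ _ _ K2) as B2.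
  pose proof (dif_is_derive2 _ _ _ _ K3) as B3. cbn [fst snd] in *.
  assert (Hcs : forall v, cos v * cos v + sin v * sin v = 1).
  { intros x. pose proof (sin2_cos2 x) as K. unfold Rsqr in K. lra. }
  assert (EG2 : G2 = (- M u * sin v, M u * cos v, 0)).
  { apply R3_ext; triples.
    - rewrite <- (is_derive_unique _ _ _ B1). apply is_derive_unique.
      apply is_derive_ext_loc with (fun t => M u * cos t).
      + eapply filter_imp; [|exact L2]. intros t Ht. cbv beta in Ht. exact (f_equal coord1 (eq_sym (Hrot
          (u, t) Ht))).
      + auto_derive; auto. ring.
    - rewrite <- (is_derive_unique _ _ _ B2). apply is_derive_unique.
      apply is_derive_ext_loc with (fun t => M u * sin t).
      + eapply filter_imp; [|exact L2]. intros t Ht. cbv beta in Ht. exact (f_equal coord2 (eq_sym (Hrot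
          (u, t) Ht))).
      + auto_derive; auto. ring.
    - rewrite <- (is_derive_unique _ _ _ B3). apply is_derive_unique.
      apply is_derive_ext_loc with (fun t => N u).
      + eapply filter_imp; [|exact L2]. intros t Ht. cbv beta in Ht. exact (f_equal coord3 (eq_sym (Hrot
          (u, t) Ht))).
      + auto_derive; auto. }
  set (m := coord1 G1 * cos v + coord2 G1 * sin v).
  assert (DM : is_derive M u m).
  { apply is_derive_ext_loc with (fun t => coord1 (F (phi (t, v))) * cos v + coord2 (F (phi (t, v))) * sin v).
    - eapply filter_imp; [|exact L1]. intros t Ht. cbv beta in Ht.
      change (coord1 (F (phi (t, v))) * cos v + coord2 (F (phi (t, v))) * sin v = M t).
      rewrite (Hrot (t, v) Ht). unfold rotation_point. triples. unfold Re, Im; cbn [fst snd].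
      transitivity (M t * (cos v * cos v + sin v * sin v)); [ring|rewrite Hcs; ring].
    - exact (is_derive_lincomb _ _ u _ _ (cos v) (sin v) A1 A2). }
  assert (DN : is_derive N u (coord3 G1)).
  { apply is_derive_ext_loc with (fun t => coord3 (F (phi (t, v)))); [|exact A3].
    eapply filter_imp; [|exact L1]. intros t Ht. cbv beta in Ht. exact (f_equal coord3 (Hrot (t, v) Ht)). }
  assert (D0 : coord1 G1 * - sin v + coord2 G1 * cos v = 0).
  { transitivity (Derive (fun t => coord1 (F (phi (t, v))) * - sin v + coord2 (F (phi (t, v))) * cos v) u).
    - symmetry. apply is_derive_unique.
      exact (is_derive_lincomb _ _ u _ _ (- sin v) (cos v) A1 A2).
    - apply is_derive_unique. apply is_derive_ext_loc with (fun _ => 0); [|auto_derive; auto].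
      eapply filter_imp; [|exact L1]. intros t Ht. cbv beta in Ht.
      change (0 = coord1 (F (phi (t, v))) * - sin v + coord2 (F (phi (t, v))) * cos v).
      rewrite (Hrot (t, v) Ht). unfold rotation_point. triples. unfold Re, Im; cbn [fst snd]. ring. }
  assert (EG1 : G1 = (m * cos v, m * sin v, coord3 G1)).
  { apply R3_ext; triples; unfold m; [| |reflexivity].
    - transitivity (coord1 G1 * (cos v * cos v + sin v * sin v)
        + sin v * (coord1 G1 * - sin v + coord2 G1 * cos v)); [rewrite Hcs, D0; ring|].
      ring.
    - transitivity (coord2 G1 * (cos v * cos v + sin v * sin v)
        - cos v * (coord1 G1 * - sin v + coord2 G1 * cos v)); [rewrite Hcs, D0; ring|].
      ring. }
  exists m, (coord3 G1). split; [exact DM|]. split; [exact DN|]. split; [|split; [|split]].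
  - intros K. apply Z2. rewrite EG2, K. apply R3_ext; coords; triples; ring.
  - destruct (Req_dec m 0) as [E1|]; auto. destruct (Req_dec (coord3 G1) 0) as [E2|]; auto.
    exfalso. apply Z1. rewrite EG1, E1, E2. apply R3_ext; coords; triples; ring.
  - rewrite <- EG1. exact TG1.
  - rewrite <- EG2. exact TG2.
Qed.

Let p (w : C) : R := coord1 (nu (phi w)) * cos (snd w) + coord2 (nu (phi w)) * sin (snd w).
Let q (w : C) : R := coord3 (nu (phi w)).

(** The normal is orthogonal to the tangent M (- sin v, cos v, 0) of the parallel and M <> 0, so it
    lies in the meridian plane. *)
Lemma rotation_normal_form (w : C) : W w -> nu (phi w) = rotation_point (p w) (q w) (snd w).
Proof.
  intros Hw. destruct (rotation_tangents w Hw) as (m & n & _ & _ & HM & _ & _ & H).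
  assert (K : - coord1 (nu (phi w)) * sin (snd w) + coord2 (nu (phi w)) * cos (snd w) = 0).
  { apply (Rmult_eq_reg_l (M (fst w))); auto. rewrite Rmult_0_r, <- H.
    unfold dot; triples. ring. }
  pose proof (sin2_cos2 (snd w)) as Hcs. unfold Rsqr in Hcs.
  unfold p, q, rotation_point.
  set (x := nu (phi w)) in *. set (c := cos (snd w)) in *. set (s := sin (snd w)) in *.
  apply R3_ext; triples; [| |reflexivity].
  - transitivity (coord1 x * (s * s + c * c) + s * (- coord1 x * s + coord2 x * c)); [rewrite Hcs, K; ring|].
    ring.
  - transitivity (coord2 x * (s * s + c * c) - c * (- coord1 x * s + coord2 x * c)); [rewrite Hcs, K; ring|].
    ring.
Qed.

(** For fixed u, (p, q) is a unit vector orthogonal to the profile tangent (M', N'), which does not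
    depend on v; [planar_constant] then annihilates its v-derivative, so the normal cannot flip
    along a parallel. *)
Lemma rotation_normal_derivative (w : C) : W w ->
  is_derive (fun t => p (fst w, t)) (snd w) 0 /\ is_derive (fun t => q (fst w, t)) (snd w) 0.
Proof.
  intros Hw. pose proof Hphi as (HW & HP & HQ & HWU & _ & _).
  pose proof (smooth_dif W _ w HW HP Hw) as KP. pose proof (smooth_dif W _ w HW HQ Hw) as KQ.
  pose proof (vdif_comp_map nu phi w _ _ _ _ _ _ (vsmooth_vdif U nu _ HU Hnu (HWU w Hw)) KP KQ) as (K1 & K2
      & K3).
  assert (Hc : dif (fun w => cos (snd w)) w (- sin (snd w) * 0) (- sin (snd w) * 1))
    by (apply (dif_comp1 cos); [apply is_derive_cos|apply dif_snd]).
  assert (Hs : dif (fun w => sin (snd w)) w (cos (snd w) * 0) (cos (snd w) * 1))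
    by (apply (dif_comp1 sin); [apply is_derive_sin|apply dif_snd]).
  assert (Hp : exists a a', dif p w a a') by (unfold p; do 2 eexists; difs).
  destruct Hp as (ap & ap' & Hp).
  assert (Hq : exists b b', dif q w b b') by (unfold q; do 2 eexists; difs).
  destruct Hq as (bq & bq' & Hq).
  destruct (rotation_tangents w Hw) as (m & n & DM & DN & _ & Hmn & _ & _).
  (* Uniqueness of derivatives identifies the profile tangent found at (u, t) with the one found at
     [w]. *)
  assert (Hlin : forall t, W (fst w, t) -> p (fst w, t) * m + q (fst w, t) * n = 0).
  { intros t Ht. destruct (rotation_tangents _ Ht) as (m' & n' & DM' & DN' & _ & _ & H & _).
    cbn [fst snd] in *.
    rewrite <- (is_derive_unique _ _ _ DM), <- (is_derive_unique _ _ _ DN),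
      (is_derive_unique _ _ _ DM'), (is_derive_unique _ _ _ DN'), <- H.
    unfold p, q, dot. triples. cbn [fst snd]. ring. }
  assert (Hsq : forall x, W x -> p x * p x + q x * q x = 1).
  { intros x Hx. rewrite <- (Hunit _ (HWU x Hx)), (rotation_normal_form x Hx).
    unfold dot, rotation_point. triples.
    pose proof (sin2_cos2 (snd x)) as Hcs. unfold Rsqr in Hcs.
    transitivity (p x * p x * (sin (snd x) * sin (snd x) + cos (snd x) * cos (snd x)) + q x * q x);
      [rewrite Hcs; ring|ring]. }
  destruct (dif_const_on W HW (fun x => p x * p x + q x * q x) 1 w _ _ Hsq Hw
    (dif_plus _ _ _ _ _ _ _ (dif_mult _ _ _ _ _ _ _ Hp Hp) (dif_mult _ _ _ _ _ _ _ Hq Hq))) as [_ S2].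
  pose proof (dif_is_derive2 _ _ _ _ Hp) as Dp. pose proof (dif_is_derive2 _ _ _ _ Hq) as Dq.
  assert (S1 : ap' * m + bq' * n = 0).
  { rewrite <- (is_derive_unique _ _ _ (is_derive_lincomb _ _ _ _ _ m n Dp Dq)).
    apply is_derive_unique. apply is_derive_ext_loc with (fun _ => 0); [|auto_derive; auto].
    eapply filter_imp; [|exact (locally_slice2 W w (HW w Hw))].
    intros t Ht. symmetry. exact (Hlin t Ht). }
  pose proof (Hlin (snd w)) as S3. rewrite <- (surjective_pairing w) in S3. specialize (S3 Hw).
  destruct (planar_constant m n (p w) (q w) ap' bq' Hmn) as [Z1 Z2].
  - lra.
  - exact (Hsq w Hw).
  - lra.
  - lra.
  - subst ap' bq'. split; assumption.
Qed.

Lemma rotation_normal_profile (u0 v0 d : R) :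
  (forall u v, Rabs (u - u0) < d -> Rabs (v - v0) < d -> W (u, v)) ->
  exists p q : R -> R, forall u v, Rabs (u - u0) < d -> Rabs (v - v0) < d ->
    nu (phi (u, v)) = rotation_point (p u) (q u) v.
Proof.
  intros Hb. exists (fun u => p (u, v0)), (fun u => q (u, v0)).
  intros u v Hu Hv. rewrite (rotation_normal_form _ (Hb u v Hu Hv)). cbn [snd].
  f_equal.
  - apply (zero_derivative_const (fun t => p (u, t)) v0 d); auto.
    intros t Ht. exact (proj1 (rotation_normal_derivative (u, t) (Hb u t Hu Ht))).
  - apply (zero_derivative_const (fun t => q (u, t)) v0 d); auto.
    intros t Ht. exact (proj2 (rotation_normal_derivative (u, t) (Hb u t Hu Ht))).
Qed.
End Rotation.

Lemma dot_rotation (m n p q v : R) :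
  dot (rotation_point m n v) (rotation_point p q v) = m * p + n * q.
Proof.
  unfold dot, rotation_point. triples.
  pose proof (sin2_cos2 v) as H. unfold Rsqr in H.
  transitivity (m * p * (sin v * sin v + cos v * cos v) + n * q); [ring|rewrite H; ring].
Qed.

(** N is normal to X: the inner products reduce to <eta_i, Y> = 0, <Y, Y_i> = 0 and <eta, Y_i> =
    h_i. *)
Lemma support_surface_tangent (U : C -> Prop) (Y : C -> R3) (E h : C -> R) (c : R) (z : C) :
  open U -> vsmooth U Y -> (forall z, U z -> conformal_frame Y E z) -> smooth_on U h ->
  (forall z, U z -> h z <> 0) -> U z ->
  let n := support_surface Y E h in
  let X := reflected Y n (fun z => h z + c) in
  dot (D1 X z) (reflected Y n h z) = 0 /\ dot (D2 X z) (reflected Y n h z) = 0.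
Proof.
  intros HU HY HF Hh H0 Hz n X.
  pose proof (support_surface_norm U Y E h HU HY HF H0 z Hz) as HS. fold n in HS.
  destruct (support_surface_dot U Y E h HU HY HF z Hz) as (S0 & S1 & S2). fold n in S0, S1, S2.
  destruct (support_surface_D U Y E h HU HY HF Hh z Hz) as (T1 & T2 & _). fold n in T1, T2.
  destruct (frame_dot_Y_D U Y E HU HY HF z Hz) as [R1 R2].
  destruct (HF z Hz) as (YY & _).
  pose proof (vsmooth_vdif U Y z HU HY Hz) as Hy.
  pose proof (vsmooth_vdif U n z HU (support_surface_smooth U Y E h HU HY HF Hh) Hz) as Hn.
  assert (K := vdif_reflected Y n _ z _ _ _ _ _ _ (Rgt_not_eq _ _ HS) Hy Hn (dif_hc U h c HU Hh z Hz)).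
  fold X in K. rewrite (vdif_D1 _ _ _ _ K), (vdif_D2 _ _ _ _ K).
  unfold reflected_diff, reflected. dots.
  rewrite (dot_comm (D1 Y z) (Y z)), (dot_comm (D2 Y z) (Y z)), (dot_comm (D1 Y z) (n z)),
    (dot_comm (D2 Y z) (n z)), (dot_comm (D1 n z) (n z)), (dot_comm (D2 n z) (n z)),
    S0, S1, S2, T1, T2, R1, R2.
  split; field; lra.
Qed.

(* The centres X + R N = (1 + R) Y of the sphere congruence rotate with X and N, hence so does Y. *)
Lemma reflected_rotation (U : C -> Prop) (Y : C -> R3) (E h : C -> R) (c : R) (z : C) (m n p q v : R) :
  open U -> vsmooth U Y -> (forall z, U z -> conformal_frame Y E z) -> smooth_on U h ->
  (forall z, U z -> h z <> 0) -> c <> 0 -> U z ->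
  reflected Y (support_surface Y E h) (fun z => h z + c) z = rotation_point m n v ->
  reflected Y (support_surface Y E h) h z = rotation_point p q v ->
  let rho := (1 - (m * m + n * n)) / (2 * (m * p + n * q - 1)) in
  h z = - c / (1 + rho) /\
  Y z = rotation_point ((m + rho * p) / (1 + rho)) ((n + rho * q) / (1 + rho)) v.
Proof.
  intros HU HY HF Hh H0 Hc Hz EX EN rho.
  pose proof (support_surface_norm U Y E h HU HY HF H0 z Hz) as HS.
  assert (Hrho : rho = - (h z + c) / h z).
  { rewrite <- (radius_value U Y E h c HU HY HF Hc H0 z Hz). unfold radius, support.
    rewrite EX, EN, !dot_rotation. reflexivity. }
  specialize (H0 z Hz).
  assert (H1 : 1 + rho = - c / h z) by (rewrite Hrho; field; exact H0).
  assert (H2 : 1 + rho <> 0).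
  { rewrite H1. unfold Rdiv. apply Rmult_integral_contrapositive_currified; [lra|apply Rinv_neq_0_compat;
      exact H0]. }
  split.
  - rewrite H1. field. split; auto.
  - revert EX EN. unfold reflected. set (S := dot _ _) in *. set (x := support_surface Y E h z).
    intros EX EN.
    assert (K : forall a b y s k : R, y - 2 * (h z + c) / S * s = a * k -> y - 2 * h z / S * s = b * k ->
      y = (a + rho * b) / (1 + rho) * k).
    { intros a b y s k A B. apply (Rmult_eq_reg_l (1 + rho)); auto.
      transitivity (a * k + rho * (b * k)); [|field; exact H2].
      rewrite <- A, <- B, Hrho. field. split; auto. lra. }
    unfold rotation_point in *.
    apply R3_ext; triples.
    + apply (f_equal coord1) in EX. apply (f_equal coord1) in EN. revert EX EN. coords. triples. apply K.
    + apply (f_equal coord2) in EX. apply (f_equal coord2) in EN. revert EX EN. coords. triples. apply K.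
    + apply (f_equal coord3) in EX. apply (f_equal coord3) in EN. revert EX EN. coords. triples.
      intros EX EN. rewrite <- (Rmult_1_r (_ / _)). apply (K _ _ _ (coord3 x)); lra.
Qed.

(** * Charts in which g is the exponential function *)

(** The mean value theorem gives strict monotonicity, the intermediate value theorem the inverse,
    and f (k y) = y the value of its derivative. The radius d is halved to work on a closed
    interval. *)
Lemma local_inverse_increasing (f f' : R -> R) (u0 d : R) : 0 < d ->
  (forall u, Rabs (u - u0) < d -> is_derive f u (f' u) /\ 0 < f' u) ->
  exists (k : R -> R) (e : R), 0 < e /\ k (f u0) = u0 /\
    forall x, Rabs (x - f u0) < e ->
      Rabs (k x - u0) < d /\ f (k x) = x /\ is_derive k x (/ f' (k x)).
Proof.
  intros Hd Hf. set (a := u0 - d / 2). set (b := u0 + d / 2).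
  assert (Hab : a < b) by (unfold a, b; lra).
  assert (Hin : forall u, a <= u <= b -> Rabs (u - u0) < d)
    by (intros u Hu; unfold a, b in Hu; apply Rabs_lt_between; lra).
  assert (Hder : forall u, a <= u <= b -> derivable_pt f u).
  { intros u Hu. exists (f' u). apply is_derive_Reals. apply Hf, Hin, Hu. }
  assert (Hcont : forall u, a <= u <= b -> continuity_pt f u)
    by (intros u Hu; apply derivable_continuous_pt, Hder, Hu).
  assert (Hinc : forall x y, a <= x -> x < y -> y <= b -> f x < f y).
  { intros x y Hx Hxy Hy.
    destruct (MVT_gen f x y f') as (c & Hc & E).
    - intros t Ht. rewrite Rmin_left, Rmax_right in Ht by lra. apply Hf, Hin. lra.
    - intros t Ht. rewrite Rmin_left, Rmax_right in Ht by lra. apply Hcont. lra.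
    - rewrite Rmin_left, Rmax_right in Hc by lra.
      assert (K : 0 < f' c) by (apply Hf, Hin; lra). nra. }
  (* [u0] is a dummy value outside [f a, f b]; only values of k inside this interval are used. *)
  pose (k := fun y => match Rle_dec (f a) y, Rle_dec y (f b) with
    | left p, left q => proj1_sig (f_interv_is_interv f a b y Hab (conj p q) Hcont)
    | _, _ => u0 end).
  assert (Hk : forall y, f a <= y -> y <= f b -> a <= k y <= b /\ f (k y) = y).
  { intros y H1 H2. unfold k. destruct (Rle_dec (f a) y); [|tauto]. destruct (Rle_dec y (f b)); [|tauto].
    destruct (f_interv_is_interv f a b y Hab (conj r r0) Hcont) as [x Hx]. exact Hx. }
  assert (Hfa : f a < f u0) by (apply Hinc; unfold a, b; lra).
  assert (Hfb : f u0 < f b) by (apply Hinc; unfold a, b; lra).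
  exists k, (Rmin (f u0 - f a) (f b - f u0)). split; [apply Rmin_pos; lra|]. split.
  { destruct (Hk (f u0)) as [K1 K2]; try lra.
    destruct (Rtotal_order (k (f u0)) u0) as [L|[L|L]]; auto.
    - assert (f (k (f u0)) < f u0) by (apply Hinc; unfold a, b in *; lra). lra.
    - assert (f u0 < f (k (f u0))) by (apply Hinc; unfold a, b in *; lra). lra. }
  intros x Hx. apply Rabs_lt_between in Hx.
  pose proof (Rmin_l (f u0 - f a) (f b - f u0)). pose proof (Rmin_r (f u0 - f a) (f b - f u0)).
  assert (Hx' : f a < x < f b) by lra.
  destruct (Hk x) as [K1 K2]; try lra.
  split; [apply Hin, K1|]. split; [exact K2|].
  destruct (Hf (k x) (Hin _ K1)) as [D1 D2].
  assert (Dk : ex_derive k x).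
  { assert (T := derivable_pt_recip_interv f k a b x Hab Hx'
      (fun y H1 H2 => proj2 (Hk y H1 H2)) (fun y H1 H2 => proj1 (Hk y H1 H2)) Hinc Hder).
    apply ex_derive_Reals_1. apply T. rewrite Derive_Reals, (is_derive_unique _ _ _ D1). lra. }
  destruct Dk as [l Dk]. replace (/ f' (k x)) with l; [exact Dk|].
  apply (Rmult_eq_reg_r (f' (k x))); [|lra]. rewrite Rinv_l by lra.
  transitivity (Derive (fun y => f (k y)) x).
  - symmetry. apply is_derive_unique. exact (is_derive_comp f k x _ _ D1 Dk).
  - apply is_derive_unique. apply is_derive_ext_loc with (fun y => y);
      [|exact (is_derive_id (K := R_AbsRing) x)].
    assert (He : 0 < Rmin (x - f a) (f b - x)) by (apply Rmin_pos; lra).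
    exists (mkposreal _ He). intros y Hy.
    change (Rabs (y - x) < Rmin (x - f a) (f b - x)) in Hy.
    pose proof (Rmin_l (x - f a) (f b - x)). pose proof (Rmin_r (x - f a) (f b - x)).
    apply Rabs_lt_between in Hy. symmetry. apply Hk; lra.
Qed.

(** The sign s of the derivative is removed by inverting s f, so the inverse of f sends x to k (s
    x). *)
Lemma local_inverse (f f' : R -> R) (u0 d s : R) : 0 < d -> s * s = 1 ->
  (forall u, Rabs (u - u0) < d -> is_derive f u (f' u) /\ 0 < s * f' u) ->
  exists (k : R -> R) (e : R), 0 < e /\ k (f u0) = u0 /\
    forall x, Rabs (x - f u0) < e ->
      Rabs (k x - u0) < d /\ f (k x) = x /\ is_derive k x (/ f' (k x)).
Proof.
  intros Hd Hs Hf.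
  destruct (local_inverse_increasing (fun u => s * f u) (fun u => s * f' u) u0 d Hd) as (k & e & He & K0 & K).
  { intros u Hu. destruct (Hf u Hu) as [D P]. split; auto. exact (is_derive_scal f u s _ D). }
  exists (fun x => k (s * x)), e. split; [exact He|]. split; [exact K0|].
  assert (Hs0 : s <> 0) by (intros E; rewrite E in Hs; lra).
  assert (Habs : Rabs s = 1).
  { assert (Rabs s * Rabs s = 1) by (rewrite <- Rabs_mult, Hs; apply Rabs_R1).
    pose proof (Rabs_pos s). nra. }
  intros x Hx. destruct (K (s * x)) as (K1 & K2 & K3).
  { rewrite <- Rmult_minus_distr_l, Rabs_mult, Habs. lra. }
  split; [exact K1|]. split; [apply (Rmult_eq_reg_l s); auto|].
  evar_last; [apply (is_derive_comp k (fun x => s * x) x); [exact K3|]|].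
  - auto_derive; auto.
  - destruct (Hf _ K1) as [_ P].
    assert (f' (k (s * x)) <> 0) by (intros E; rewrite E in P; lra).
    unfold scal; cbn; unfold mult; cbn. field. auto.
Qed.

Lemma profile_ode (H H' : R -> R) (x0 e : R) :
  (forall x, Rabs (x - x0) < e -> is_derive H x (H' x)) ->
  (forall x, Rabs (x - x0) < e -> is_derive H' x (- 2 * (1 - tanh x ^ 2) * H x)) ->
  exists a1 a2, forall x, Rabs (x - x0) < e -> H x = h_profile a1 a2 x.
Proof.
  intros D1 D2.
  (* Wronskians of [H] with the solutions [1 - x tanh x] and [tanh x]. *)
  set (al := fun x => H x * (1 - tanh x ^ 2) - H' x * tanh x).
  set (be := fun x => (1 - x * tanh x) * H' x + (tanh x + x * (1 - tanh x ^ 2)) * H x).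
  assert (Dt : forall x, is_derive (fun x => tanh x) x (1 - tanh x ^ 2)) by exact is_derive_tanh.
  assert (Dtv : forall x, Derive (fun x => tanh x) x = 1 - tanh x ^ 2)
    by (intros x; apply is_derive_unique, Dt).
  assert (Dal : forall x, Rabs (x - x0) < e -> al x = al x0).
  { apply zero_derivative_const. intros x Hx.
    pose proof (D1 x Hx) as E1. pose proof (D2 x Hx) as E2. unfold al.
    auto_derive; [repeat split; eexists; eauto|].
    rewrite Dtv. replace (Derive (fun x => H x) x) with (H' x) by (symmetry; apply is_derive_unique, E1).
    replace (Derive (fun x => H' x) x) with (- 2 * (1 - tanh x ^ 2) * H x) by (symmetry;
        apply is_derive_unique, E2).
    ring. }
  assert (Dbe : forall x, Rabs (x - x0) < e -> be x = be x0).
  { apply zero_derivative_const. intros x Hx.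
    pose proof (D1 x Hx) as E1. pose proof (D2 x Hx) as E2. unfold be.
    auto_derive; [repeat split; eexists; eauto|].
    rewrite Dtv. replace (Derive (fun x => H x) x) with (H' x) by (symmetry; apply is_derive_unique, E1).
    replace (Derive (fun x => H' x) x) with (- 2 * (1 - tanh x ^ 2) * H x) by (symmetry;
        apply is_derive_unique, E2).
    ring. }
  (* The two solutions have Wronskian 1, so H = al (1 - x tanh x) + be tanh x, which is [h_profile]
     with constants al and al - be. *)
  exists (al x0), (al x0 - be x0). intros x Hx.
  rewrite <- (Dal x Hx), <- (Dbe x Hx). unfold h_profile, al, be. ring.
Qed.

(* Differentiating [g (psi z) = e^z] gives [psi' = e^z / g'(psi)]: this is the Cauchy-Riemann system for
   [psi], and it bootstraps smoothness from continuity. *)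
Lemma log_chart_holomorphic (U W : C -> Prop) (g psi : C -> C) :
  open U -> open W -> holomorphic_on U g -> (forall z, U z -> C_derive g z <> 0%C) ->
  (forall w, W w -> U (psi w)) -> (forall w, W w -> g (psi w) = Cexp w) ->
  (forall w, W w -> exists p1 p2 q1 q2,
     dif (fun x => Re (psi x)) w p1 p2 /\ dif (fun x => Im (psi x)) w q1 q2) ->
  holomorphic_on W psi /\ forall w, W w -> C_derive psi w <> 0%C.
Proof.
  intros HU HW Hg Hg' HWU Hexp Hd.
  set (A := pd1 (fun z => Re (g z))). set (B := pd1 (fun z => Im (g z))).
  set (G := fun z => A z * A z + B z * B z).
  assert (HG : forall z, U z -> G z <> 0).
  { intros z Hz. destruct (holomorphic_CR U g z Hg Hz) as (E1 & E2 & _).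
    pose proof (C_neq0_sqr _ (Hg' z Hz)). unfold G, A, B. rewrite E1, E2. lra. }
  (* p + i q is e^w times the conjugate of g'(psi), divided by |g'(psi)|^2: the expected derivative
     of [psi]. *)
  set (p := fun w => (A (psi w) * Cexp_re w + B (psi w) * Cexp_im w) * / G (psi w)).
  set (q := fun w => (A (psi w) * Cexp_im w - B (psi w) * Cexp_re w) * / G (psi w)).
  assert (Hpq : forall w, W w -> dif (fun x => Re (psi x)) w (p w) (- q w) /\
      dif (fun x => Im (psi x)) w (q w) (p w)).
  { intros w Hw. destruct (Hd w Hw) as (p1 & p2 & q1 & q2 & KP & KQ).
    destruct (C_derive_dif g _ _ (proj1 Hg _ (HWU w Hw))) as [K3 K4].
    destruct (holomorphic_CR U g _ Hg (HWU w Hw)) as (E1 & E2 & _).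
    rewrite <- E1, <- E2 in K3, K4. fold A B in K3, K4.
    pose proof (dif_comp_map _ psi w _ _ _ _ _ _ K3 KP KQ) as K5.
    pose proof (dif_comp_map _ psi w _ _ _ _ _ _ K4 KP KQ) as K6.
    destruct (dif_eq_on W HW _ Cexp_re w _ _ _ _ (fun x Hx => f_equal Re (Hexp x Hx)) Hw K5 (proj1
        (dif_Cexp w))) as [L1 L2].
    destruct (dif_eq_on W HW _ Cexp_im w _ _ _ _ (fun x Hx => f_equal Im (Hexp x Hx)) Hw K6 (proj2
        (dif_Cexp w))) as [L3 L4].
    pose proof (HG _ (HWU w Hw)) as HG0.
    split; (eapply dif_eq; [eassumption|..]); apply (Rmult_eq_reg_r (G (psi w))); auto; unfold p, q.
    - transitivity (A (psi w) * Cexp_re w + B (psi w) * Cexp_im w); [|field; auto].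
      rewrite <- L1, <- L3. unfold G. ring.
    - transitivity (- (A (psi w) * Cexp_im w - B (psi w) * Cexp_re w)); [|field; auto].
      replace (Cexp_im w) with (- - Cexp_im w) by ring. rewrite <- L2, <- L4. unfold G. ring.
    - transitivity (A (psi w) * Cexp_im w - B (psi w) * Cexp_re w); [|field; auto].
      rewrite <- L1, <- L3. unfold G. ring.
    - transitivity (A (psi w) * Cexp_re w + B (psi w) * Cexp_im w); [|field; auto].
      replace (Cexp_im w) with (- - Cexp_im w) by ring. rewrite <- L2, <- L4. unfold G. ring. }
  assert (Hsm : forall k, Ck_on k W (fun x => Re (psi x)) /\ Ck_on k W (fun x => Im (psi x))).
  { induction k as [|k [IP IQ]].
    - split; intros w Hw; [exact (dif_continuous _ _ _ _ (proj1 (Hpq w Hw)))|exact (dif_continuous _ _ _ _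
        (proj2 (Hpq w Hw)))].
    - destruct (Ck_Cexp k W HW) as [C1 C2].
      assert (Hcomp : forall f, smooth_on U f -> Ck_on k W (fun w => f (psi w))).
      { intros f Hf. apply Ck_on_ext with (fun w => f (Re (psi w), Im (psi w))); auto.
        - intros w _. f_equal. symmetry. apply surjective_pairing.
        - apply (Ck_on_comp k U W); auto. intros w Hw.
          change (U (fst (psi w), snd (psi w))). rewrite <- surjective_pairing. auto. }
      assert (HA : smooth_on U A) by apply smooth_pd1, Hg.
      assert (HB : smooth_on U B) by apply smooth_pd1, Hg.
      assert (HGi : Ck_on k W (fun w => / G (psi w))).
      { apply (Hcomp (fun z => / G z)). refine (smooth_inv U G HU HG _).
        exact (smooth_plus U _ _ HU (smooth_mult U A A HU HA HA) (smooth_mult U B B HU HB HB)). }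
      assert (Hp : Ck_on k W p).
      { unfold p. apply Ck_on_mult; auto. apply Ck_on_plus; auto; apply Ck_on_mult; auto. }
      assert (Hq : Ck_on k W q).
      { unfold q. apply Ck_on_mult; auto.
        apply Ck_on_ext with (fun w => A (psi w) * Cexp_im w + (-1) * (B (psi w) * Cexp_re w)); auto.
        - intros w _; ring.
        - exact (Ck_on_plus k W _ _ HW (Ck_on_mult k W _ _ HW (Hcomp A HA) C2)
            (Ck_on_mult k W _ _ HW (Ck_on_const k W (-1) HW) (Ck_on_mult k W _ _ HW (Hcomp B HB) C1))). }
      split.
      + apply (Ck_on_S_dif k W _ p (fun w => - q w)); auto.
        * intros w Hw. apply Hpq, Hw.
        * apply Ck_on_ext with (fun w => (-1) * q w); auto; [intros; ring|].
          apply Ck_on_mult; auto using Ck_on_const.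
      + apply (Ck_on_S_dif k W _ q p); auto. intros w Hw. apply Hpq, Hw. }
  assert (HD : forall w, W w -> is_derive psi w (p w, q w)).
  { intros w Hw. apply dif_C_derive; apply Hpq, Hw. }
  split; [split; [|split; intros k; apply Hsm]|].
  - intros w Hw. rewrite (is_C_derive_unique _ _ _ (HD w Hw)). apply HD, Hw.
  - intros w Hw. rewrite (is_C_derive_unique _ _ _ (HD w Hw)). intros K.
    injection K; intros Kq Kp. pose proof (HG _ (HWU w Hw)) as HG0.
    assert (E : (p w * p w + q w * q w) * G (psi w) = exp (fst w) * exp (fst w)).
    { transitivity ((Cexp_re w * Cexp_re w + Cexp_im w * Cexp_im w) * (G (psi w) * / G (psi w))).
      - unfold p, q. transitivity ((A (psi w) * A (psi w) + B (psi w) * B (psi w)) * (Cexp_re w * Cexp_re w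
          + Cexp_im w * Cexp_im w)
          * / G (psi w) * (/ G (psi w) * G (psi w))); [ring|]. fold (G (psi w)). rewrite Rinv_l by auto. ring.
      - rewrite Rinv_r by auto. unfold Cexp_re,
          Cexp_im. pose proof (sin2_cos2 (snd w)) as Hcs. unfold Rsqr in Hcs.
        transitivity (exp (fst w) * exp (fst w) * (sin (snd w) * sin (snd w) + cos (snd w) * cos (snd w)));
          [ring|rewrite Hcs; ring]. }
    rewrite Kp, Kq in E. pose proof (exp_pos (fst w)). nra.
Qed.

Lemma smooth_comp_map (U W : C -> Prop) (f : C -> R) (phi : C -> C) :
  open U -> open W -> (forall w, W w -> U (phi w)) -> smooth_on U f ->
  smooth_on W (fun w => Re (phi w)) -> smooth_on W (fun w => Im (phi w)) ->
  smooth_on W (fun w => f (phi w)).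
Proof.
  intros HU HW HWU Hf HP HQ n.
  apply Ck_on_ext with (fun w => f (Re (phi w), Im (phi w))); auto.
  - intros w _. f_equal. symmetry. apply surjective_pairing.
  - apply (Ck_on_comp n U W); auto. intros w Hw.
    change (U (fst (phi w), snd (phi w))). rewrite <- surjective_pairing. auto.
Qed.

(** Stereographic projection: g = (Y1 + i Y2) / (1 + Y3), where 1 + Y3 = 2 / T is nonzero. *)
Lemma Ymap_rotation (g : C -> C) (z : C) (p q v : R) :
  Ymap g z = rotation_point p q v ->
  Re (g z) = p / (1 + q) * cos v /\ Im (g z) = p / (1 + q) * sin v.
Proof.
  intros H. pose proof (Tfun_pos g z) as HT. unfold Ymap, rotation_point in H.
  injection H; intros H3 H2 H1.
  assert (Hq : 1 + q = 2 / Tfun g z) by (rewrite <- H3; field; lra).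
  rewrite Hq. split.
  - transitivity (p * cos v / (2 / Tfun g z)); [rewrite <- H1; field; lra|field; lra].
  - transitivity (p * sin v / (2 / Tfun g z)); [rewrite <- H2; field; lra|field; lra].
Qed.

Section Chart.
Context (U W : C -> Prop) (g phi : C -> C) (h : C -> R) (p q k : R -> R) (u0 v0 d : R)
  (HU : open U) (Hg : holomorphic_on U g) (Hg' : forall z, U z -> C_derive g z <> 0%C)
  (Hh : smooth_on U h) (HL : forall z, U z -> laplace_condition (conformal_factor g) h z)
  (Hphi : change_of_parameters W U phi) (Hd : 0 < d)
  (Hb : forall u v, Rabs (u - u0) < d -> Rabs (v - v0) < d -> W (u, v))
  (HY : forall u v, Rabs (u - u0) < d -> Rabs (v - v0) < d ->
     Ymap g (phi (u, v)) = rotation_point (p u) (q u) v)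
  (Hhk : forall u v, Rabs (u - u0) < d -> Rabs (v - v0) < d -> h (phi (u, v)) = k u).

Let r (u : R) : R := p u / (1 + q u).
Let a (w : C) : R := Re (g (phi w)).
Let b (w : C) : R := Im (g (phi w)).
(** The derivative of [r]. As [p] and [q] have no assumed regularity, it is read off from the smooth
    functions a and b on the slice v = v0, where r = a cos v0 + b sin v0. *)
Let rd (u : R) : R := pd1 a (u, v0) * cos v0 + pd1 b (u, v0) * sin v0.

Lemma chart_ab_smooth : smooth_on W a /\ smooth_on W b.
Proof.
  destruct Hphi as (HW & HP & HQ & HWU & _). destruct Hg as (_ & Ha & Hb').
  split.
  - exact (smooth_comp_map U W _ phi HU HW HWU Ha HP HQ).
  - exact (smooth_comp_map U W _ phi HU HW HWU Hb' HP HQ).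
Qed.

Lemma center_in_box : Rabs (v0 - v0) < d.
Proof. rewrite Rminus_diag, Rabs_R0. exact Hd. Qed.

Lemma chart_g (u v : R) : Rabs (u - u0) < d -> Rabs (v - v0) < d ->
  a (u, v) = r u * cos v /\ b (u, v) = r u * sin v.
Proof. intros Hu Hv. apply Ymap_rotation. apply HY; assumption. Qed.

Lemma interval_locally (x0 e x : R) : Rabs (x - x0) < e -> locally x (fun y => Rabs (y - x0) < e).
Proof.
  intros Hx. assert (He : 0 < e - Rabs (x - x0)) by lra.
  exists (mkposreal _ He). intros y Hy. change (Rabs (y - x) < e - Rabs (x - x0)) in Hy.
  replace (y - x0) with ((y - x) + (x - x0)) by ring.
  pose proof (Rabs_triang (y - x) (x - x0)). lra.
Qed.

Lemma chart_radius_derive (u : R) : Rabs (u - u0) < d -> is_derive r u (rd u).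
Proof.
  intros Hu. destruct Hphi as (HW & _). destruct chart_ab_smooth as [Sa Sb].
  pose proof (Hb u v0 Hu center_in_box) as Hw.
  pose proof (dif_is_derive1 _ _ _ _ (smooth_dif W a _ HW Sa Hw)) as Da.
  pose proof (dif_is_derive1 _ _ _ _ (smooth_dif W b _ HW Sb Hw)) as Db. cbn [fst snd] in Da, Db.
  apply is_derive_ext_loc with (fun t => a (t, v0) * cos v0 + b (t, v0) * sin v0).
  - eapply filter_imp; [|exact (interval_locally _ _ _ Hu)]. intros t Ht.
    destruct (chart_g t v0 Ht center_in_box) as [Ea Eb].
    assert (E : forall x y, x = r t * cos v0 -> y = r t * sin v0 -> x * cos v0 + y * sin v0 = r t).
    { intros x y -> ->. pose proof (sin2_cos2 v0) as K. unfold Rsqr in K.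
      transitivity (r t * (sin v0 * sin v0 + cos v0 * cos v0)); [ring|rewrite K; ring]. }
    exact (E _ _ Ea Eb).
  - exact (is_derive_lincomb _ _ u _ _ _ _ Da Db).
Qed.

(** The Jacobian of g o phi is |g'|^2 times that of [phi], which is nonzero; computed from g = r(u)
    e^(iv), it is r r'. *)
Lemma chart_radius_neq0 (u : R) : Rabs (u - u0) < d -> r u <> 0 /\ rd u <> 0.
Proof.
  intros Hu. pose proof Hphi as (HW & HP & HQ & HWU & _ & HJ). destruct chart_ab_smooth as [Sa Sb].
  pose proof (Hb u v0 Hu center_in_box) as Hw.
  pose proof (smooth_dif W a _ HW Sa Hw) as Ka. pose proof (smooth_dif W b _ HW Sb Hw) as Kb.
  pose proof (smooth_dif W _ _ HW HP Hw) as KP. pose proof (smooth_dif W _ _ HW HQ Hw) as KQ.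
  specialize (HJ _ Hw).
  destruct (C_derive_dif g _ _ (proj1 Hg _ (HWU _ Hw))) as [K3 K4].
  pose proof (C_neq0_sqr _ (Hg' _ (HWU _ Hw))) as HG.
  pose proof (dif_comp_map _ phi _ _ _ _ _ _ _ K3 KP KQ) as K5.
  pose proof (dif_comp_map _ phi _ _ _ _ _ _ _ K4 KP KQ) as K6.
  assert (Ea1 : pd1 a (u, v0) = rd u * cos v0).
  (* The zero term only gives the function the shape expected by [is_derive_lincomb]. *)
  { transitivity (Derive (fun t => r t * cos v0 + r t * 0) u).
    - apply Derive_ext_loc. eapply filter_imp; [|exact (interval_locally _ _ _ Hu)]. intros t Ht.
      destruct (chart_g t v0 Ht center_in_box) as [E _].
      rewrite Rmult_0_r, Rplus_0_r. exact E.
    - etransitivity; [apply is_derive_unique, (is_derive_lincomb _ _ u _ _ (cos v0) 0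
        (chart_radius_derive u Hu) (chart_radius_derive u Hu))|ring]. }
  assert (Eb1 : pd1 b (u, v0) = rd u * sin v0).
  { transitivity (Derive (fun t => r t * sin v0 + r t * 0) u).
    - apply Derive_ext_loc. eapply filter_imp; [|exact (interval_locally _ _ _ Hu)]. intros t Ht.
      destruct (chart_g t v0 Ht center_in_box) as [_ E].
      rewrite Rmult_0_r, Rplus_0_r. exact E.
    - etransitivity; [apply is_derive_unique, (is_derive_lincomb _ _ u _ _ (sin v0) 0
        (chart_radius_derive u Hu) (chart_radius_derive u Hu))|ring]. }
  assert (Ea2 : pd2 a (u, v0) = - r u * sin v0).
  { transitivity (Derive (fun t => r u * cos t) v0).
    - apply Derive_ext_loc. eapply filter_imp; [|exact (interval_locally v0 d v0 center_in_box)]. intros t Ht.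
      exact (proj1 (chart_g u t Hu Ht)).
    - apply is_derive_unique. auto_derive; auto. ring. }
  assert (Eb2 : pd2 b (u, v0) = r u * cos v0).
  { transitivity (Derive (fun t => r u * sin t) v0).
    - apply Derive_ext_loc. eapply filter_imp; [|exact (interval_locally v0 d v0 center_in_box)]. intros t Ht.
      exact (proj2 (chart_g u t Hu Ht)).
    - apply is_derive_unique. auto_derive; auto. ring. }
  rewrite (dif_pd1 a _ _ _ K5) in Ea1. rewrite (dif_pd2 a _ _ _ K5) in Ea2.
  rewrite (dif_pd1 b _ _ _ K6) in Eb1. rewrite (dif_pd2 b _ _ _ K6) in Eb2.
  revert Ea1 Ea2 Eb1 Eb2 HJ HG.
  set (P1 := pd1 (fun x => Re (phi x)) (u, v0)). set (P2 := pd2 (fun x => Re (phi x)) (u, v0)).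
  set (Q1 := pd1 (fun x => Im (phi x)) (u, v0)). set (Q2 := pd2 (fun x => Im (phi x)) (u, v0)).
  set (A := Re (C_derive g (phi (u, v0)))). set (B := Im (C_derive g (phi (u, v0)))).
  intros Ea1 Ea2 Eb1 Eb2 HJ HG.
  assert (E : (A * A + B * B) * (P1 * Q2 - P2 * Q1) = rd u * r u).
  { transitivity ((A * P1 + - B * Q1) * (B * P2 + A * Q2) - (A * P2 + - B * Q2) * (B * P1 + A * Q1)); [ring|].
    rewrite Ea1, Ea2, Eb1, Eb2. pose proof (sin2_cos2 v0) as K. unfold Rsqr in K.
    transitivity (rd u * r u * (sin v0 * sin v0 + cos v0 * cos v0)); [ring|rewrite K; ring]. }
  assert (K : rd u * r u <> 0).
  { rewrite <- E. apply Rmult_integral_contrapositive_currified; [lra|exact HJ]. }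
  split; intros Z; apply K; rewrite Z; ring.
Qed.

Lemma chart_rd_continuous : continuous rd u0.
Proof.
  destruct Hphi as (HW & _). destruct chart_ab_smooth as [Sa Sb].
  pose proof (Hb u0 v0 ltac:(rewrite Rminus_diag, Rabs_R0; exact Hd) center_in_box) as Hw.
  pose proof (dif_is_derive1 _ _ _ _ (smooth_dif W _ _ HW (smooth_pd1 _ _ Sa) Hw)) as Da.
  pose proof (dif_is_derive1 _ _ _ _ (smooth_dif W _ _ HW (smooth_pd1 _ _ Sb) Hw)) as Db.
  apply (ex_derive_continuous (K := R_AbsRing) (V := R_NormedModule)).
  eexists. exact (is_derive_lincomb _ _ u0 _ _ (cos v0) (sin v0) Da Db).
Qed.

Lemma sign_nearby (f : R -> R) : continuous f u0 -> f u0 <> 0 ->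
  exists s e, (s = 1 \/ s = -1) /\ 0 < e /\ forall u, Rabs (u - u0) < e -> 0 < s * f u.
Proof.
  intros Hf H0.
  assert (K : exists s, (s = 1 \/ s = -1) /\ 0 < s * f u0).
  { destruct (Rtotal_order (f u0) 0) as [L|[L|L]]; [exists (-1)|tauto|exists 1]; split; auto; lra. }
  destruct K as (s & Hs & Hp).
  assert (Hc : continuous (fun u => s * f u) u0)
    by exact (continuous_scal_r s f u0 Hf).
  destruct (Hc (fun y => 0 < y)) as [e He].
  { exact (open_gt 0 (s * f u0) Hp). }
  exists s, e. split; [exact Hs|]. split; [apply cond_pos|]. intros u Hu. apply He. exact Hu.
Qed.

Lemma rotation_normal_parameter :
  exists a1 a2 W' psi, normal_parameter a1 a2 W' U g h psi /\
    exists w0, W' w0 /\ psi w0 = phi (u0, v0).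
Proof.
  assert (Hu0 : Rabs (u0 - u0) < d) by (rewrite Rminus_diag, Rabs_R0; exact Hd).
  destruct (chart_radius_neq0 u0 Hu0) as [Hr0 Hrd0].
  assert (Hrc : continuous r u0).
  { apply (ex_derive_continuous (K := R_AbsRing) (V := R_NormedModule)). eexists. exact
      (chart_radius_derive u0 Hu0). }
  destruct (sign_nearby r Hrc Hr0) as (s & e1 & Hs & He1 & Hsr).
  destruct (sign_nearby rd chart_rd_continuous Hrd0) as (s' & e2 & Hs' & He2 & Hsrd).
  set (d' := Rmin d (Rmin e1 e2)).
  assert (Hd' : 0 < d') by (repeat apply Rmin_pos; assumption).
  assert (Hd'1 : forall u, Rabs (u - u0) < d' -> Rabs (u - u0) < d /\ 0 < s * r u /\ 0 < s' * rd u).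
  { intros u Hu. unfold d' in Hu. pose proof (Rmin_l d (Rmin e1 e2)). pose proof (Rmin_r d (Rmin e1 e2)).
    pose proof (Rmin_l e1 e2). pose proof (Rmin_r e1 e2).
    split; [lra|]. split; [apply Hsr|apply Hsrd]; lra. }
  assert (Hss : s * s = 1) by (destruct Hs as [-> | ->]; ring).
  assert (Hss' : s' * s' = 1) by (destruct Hs' as [-> | ->]; ring).
  (* s and s' are the signs of r and r' near u0, so s r = |r|, and its logarithmic derivative r' / r
     has sign s s'. *)
  destruct (local_inverse (fun u => ln (s * r u)) (fun u => rd u / r u) u0 d' (s * s') Hd')
    as (kap & e & He & Hk0 & Hk).
  { transitivity ((s * s) * (s' * s')); [ring|rewrite Hss, Hss'; ring]. }
  { intros u Hu. destruct (Hd'1 u Hu) as (Hu' & P1 & P2). destruct (chart_radius_neq0 u Hu') as [N1 N2].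
      split.
    - evar_last; [apply (is_derive_comp ln (fun u => s * r u) u);
        [apply is_derive_ln; exact P1|exact (is_derive_scal r u s _ (chart_radius_derive u Hu'))]|].
      unfold scal; cbn; unfold mult; cbn. field. split; auto. intros Z; rewrite Z in P1; lra.
    - replace (s * s' * (rd u / r u)) with ((s' * rd u) * / (s * r u) * (s * s)).
      + rewrite Hss, Rmult_1_r. apply Rmult_lt_0_compat; [exact P2|apply Rinv_0_lt_compat; exact P1].
      + field. split; auto. intros Z; rewrite Z in P1; lra. }
  set (x0 := ln (s * r u0)) in *.
  (* When r is negative, r e^(iv) = |r| e^(i (v + PI)): the sign of r is absorbed into a shift of
     the angle by th. *)
  assert (Hang : exists th, cos th = s /\ sin th = 0).
  { destruct Hs as [-> | ->]; [exists 0|exists PI]; split;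
     [apply cos_0|apply sin_0|apply cos_PI|apply sin_PI]. }
  destruct Hang as (th & Hcth & Hsth).
  set (W' := fun z : C => Rabs (fst z - x0) < e /\ Rabs (snd z - (v0 + th)) < d).
  set (psi := fun z : C => phi (kap (fst z), snd z - th)).
  assert (HW' : open W') by apply box_open.
  assert (Hbox : forall z, W' z -> Rabs (kap (fst z) - u0) < d /\ Rabs (snd z - th - v0) < d).
  { intros z [Hx Hy]. split; [apply Hd'1, Hk, Hx|].
    replace (snd z - th - v0) with (snd z - (v0 + th)) by ring. exact Hy. }
  pose proof Hphi as (HW & HP & HQ & HWU & Hinj & _).
  assert (HWpsi : forall z, W' z -> W (kap (fst z), snd z - th))
    by (intros z Hz; apply Hb; apply Hbox, Hz).
  assert (HUpsi : forall z, W' z -> U (psi z)) by (intros z Hz; apply HWU, HWpsi, Hz).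
  assert (Hexp : forall z, W' z -> g (psi z) = Cexp z).
  { intros z Hz. destruct (Hbox z Hz) as [Hu Hv]. destruct (chart_g _ _ Hu Hv) as [Ea Eb].
    destruct (Hk _ (proj1 Hz)) as (K1 & K2 & _). destruct (Hd'1 _ K1) as (_ & P1 & _).
    assert (Er : s * r (kap (fst z)) = exp (fst z)) by (etransitivity; [symmetry;
        exact (exp_ln _ P1)|exact (f_equal exp K2)]).
    rewrite cos_minus, Hcth, Hsth in Ea. rewrite sin_minus, Hcth, Hsth in Eb.
    rewrite (surjective_pairing (g (psi z))). unfold Cexp, Re, Im.
    f_equal.
    - transitivity (a (kap (fst z), snd z - th)); [reflexivity|]. rewrite Ea, <- Er. ring.
    - transitivity (b (kap (fst z), snd z - th)); [reflexivity|]. rewrite Eb, <- Er. ring. }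
  assert (Hdif : forall w, W' w -> exists p1 p2 q1 q2,
     dif (fun x => Re (psi x)) w p1 p2 /\ dif (fun x => Im (psi x)) w q1 q2).
  { intros w Hw. destruct (Hk _ (proj1 Hw)) as (_ & _ & Dk).
    pose proof (dif_comp1 kap (fun x => fst x) w _ _ _ Dk (dif_fst w)) as K1.
    pose proof (dif_minus _ _ w _ _ _ _ (dif_snd w) (dif_const th w)) as K2.
    pose proof (smooth_dif W _ _ HW HP (HWpsi w Hw)) as K3.
    pose proof (smooth_dif W _ _ HW HQ (HWpsi w Hw)) as K4.
    do 4 eexists. split.
    - exact (dif_comp _ _ _ w _ _ _ _ _ _ K3 K1 K2).
    - exact (dif_comp _ _ _ w _ _ _ _ _ _ K4 K1 K2). }
  destruct (log_chart_holomorphic U W' g psi HU HW' Hg Hg' HUpsi Hexp Hdif) as [Hhol Hpsi0].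
  assert (Hconf : conformal_parameter W' U psi).
  { split; [exact HW'|]. split; [exact Hhol|]. split; [exact HUpsi|]. split; [|exact Hpsi0].
    intros w w' Hw Hw' E. specialize (Hinj _ _ (HWpsi w Hw) (HWpsi w' Hw') E).
    injection Hinj; intros E2 E1.
    destruct (Hk _ (proj1 Hw)) as (_ & K1 & _). destruct (Hk _ (proj1 Hw')) as (_ & K2 & _).
    rewrite (surjective_pairing w), (surjective_pairing w'). f_equal.
    - rewrite <- K1, <- K2, E1. reflexivity.
    - lra. }
  set (hp := fun w => h (psi w)).
  assert (Shp : smooth_on W' hp)
    by exact (smooth_comp_map U W' h psi HU HW' HUpsi Hh (proj1 (proj2 Hhol)) (proj2 (proj2 Hhol))).
  assert (Ehp : forall w, W' w -> hp w = k (kap (fst w))) by (intros w Hw; apply Hhk; apply Hbox, Hw).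
  assert (Hv0 : forall x, Rabs (x - x0) < e -> W' (x, v0 + th)).
  { intros x Hx. split; [exact Hx|]. cbn [snd]. rewrite Rminus_diag, Rabs_R0. exact Hd. }
  assert (Hpd2 : forall w, W' w -> pd2 hp w = 0).
  { intros w Hw. transitivity (Derive (fun _ => k (kap (fst w))) (snd w)); [|apply Derive_const].
    apply Derive_ext_loc. eapply filter_imp; [|exact (locally_slice2 W' w (HW' w Hw))].
    intros t Ht. exact (Ehp _ Ht). }
  (* In the chart [hp] does not depend on the second coordinate, so on the line y = v0 + th the
     Laplace equation is an ordinary one. *)
  destruct (profile_ode (fun x => hp (x, v0 + th)) (fun x => pd1 hp (x, v0 + th)) x0 e) as (a1 & a2 & Hprof).
  { intros x Hx. exact (dif_is_derive1 _ _ _ _ (smooth_dif W' _ _ HW' Shp (Hv0 x Hx))). }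
  { intros x Hx.
    pose proof (proj1 (conformal_laplace U W' g psi h HU Hg Hg' Hh Hconf Hexp _ (Hv0 x Hx))
      (HL _ (HUpsi _ (Hv0 x Hx)))) as K. fold hp in K.
    rewrite (pd2_ext_loc (pd2 hp) (fun _ => 0)) in K
      by (apply (eq_locally W'); auto).
    rewrite (dif_pd2 _ _ _ _ (dif_const 0 (x, v0 + th))) in K.
    evar_last; [exact (dif_is_derive1 _ _ _ _ (smooth_dif W' _ _ HW' (smooth_pd1 _ _ Shp) (Hv0 x Hx)))|].
    change (Re (x, v0 + th)) with x in K. lra. }
  exists a1, a2, W', psi. split.
  - split; [exact Hconf|]. intros z Hz. split; [apply Hexp, Hz|].
    transitivity (k (kap (fst z))); [apply Ehp, Hz|].
    transitivity (hp (fst z, v0 + th)); [symmetry; exact (Ehp _ (Hv0 _ (proj1 Hz)))|].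
    exact (Hprof (fst z) (proj1 Hz)).
  - exists (x0, v0 + th). split.
    + apply Hv0. rewrite Rminus_diag, Rabs_R0. exact He.
    + unfold psi. cbn [fst snd]. rewrite Hk0. f_equal. f_equal. ring.
Qed.
End Chart.

(** * Global constants *)

(* On the normal form, [Y = (cos v / cosh u, sin v / cosh u, - tanh u)] and
   [eta = (a1 cosh u cos v, a1 cosh u sin v, a2 + a1 (u - 1))] with [u = ln |g|]; these two functions read off
   [a1] and [a2]. *)
Definition first_constant (g : C -> C) (h : C -> R) (z : C) : R :=
  coord1 (eta g h z) * coord1 (Ymap g z) + coord2 (eta g h z) * coord2 (Ymap g z).

Definition second_constant (g : C -> C) (h : C -> R) (z : C) : R :=
  coord3 (eta g h z) -
  first_constant g h z * (ln (Re (g z) * Re (g z) + Im (g z) * Im (g z)) * / 2 - 1).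

(** Constancy in the chart makes (a, b) composed with psi' vanish, and psi' is invertible with
    determinant p^2 + q^2. *)
Lemma dif_zero_of_chart (U W : C -> Prop) (psi : C -> C) (f : C -> R) (w : C) (k a b : R) :
  conformal_parameter W U psi -> W w -> (forall x, W x -> f (psi x) = k) ->
  dif f (psi w) a b -> a = 0 /\ b = 0.
Proof.
  intros (HW & (Hd & _) & _ & _ & H0) Hw Hf D.
  destruct (C_derive_dif psi w _ (Hd w Hw)) as [K1 K2].
  destruct (dif_const_on W HW _ k w _ _ Hf Hw (dif_comp_map f psi w _ _ _ _ _ _ D K1 K2)) as [L1 L2].
  pose proof (C_neq0_sqr _ (H0 w Hw)) as HD.
  set (p := Re (C_derive psi w)) in *. set (q := Im (C_derive psi w)) in *.
  split; apply (Rmult_eq_reg_r (p * p + q * q)); try lra; rewrite Rmult_0_l.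
  - transitivity ((a * p + b * q) * p - (a * - q + b * p) * q); [ring|rewrite L1, L2; ring].
  - transitivity ((a * p + b * q) * q + (a * - q + b * p) * p); [ring|rewrite L1, L2; ring].
Qed.

Section Main.
Context (U : C -> Prop) (g : C -> C) (h : C -> R)
  (HU : open U) (Hcon : dom_connected U) (Hg : holomorphic_on U g)
  (Hg' : forall z, U z -> C_derive g z <> 0%C)
  (Hh : smooth_on U h) (Hh0 : forall z, U z -> h z <> 0).

Let HYs : vsmooth U (Ymap g) := Ymap_smooth U g HU Hg.
Let HYf (z : C) (Hz : U z) : conformal_frame (Ymap g) (conformal_factor g) z :=
  Ymap_frame U g z HU Hg Hz (Hg' z Hz).

Lemma eta_smooth : vsmooth U (eta g h).
Proof. rewrite eta_support_surface. exact (support_surface_smooth U _ _ _ HU HYs HYf Hh). Qed.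

Lemma normal_modulus (a1 a2 : R) (W : C -> Prop) (psi : C -> C) (w : C) :
  normal_parameter a1 a2 W U g h psi -> W w ->
  Re (g (psi w)) * Re (g (psi w)) + Im (g (psi w)) * Im (g (psi w)) = exp (Re w + Re w).
Proof.
  intros (_ & Hgh) Hw. rewrite (proj1 (Hgh w Hw)), exp_plus. unfold Cexp.
  change (exp (Re w) * cos (Im w) * (exp (Re w) * cos (Im w)) +
    exp (Re w) * sin (Im w) * (exp (Re w) * sin (Im w)) = exp (Re w) * exp (Re w)).
  pose proof (sin2_cos2 (Im w)) as K. unfold Rsqr in K.
  transitivity (exp (Re w) * exp (Re w) * (sin (Im w) * sin (Im w) + cos (Im w) * cos (Im w)));
    [ring|rewrite K; ring].
Qed.

Lemma normal_constants (a1 a2 : R) (W : C -> Prop) (psi : C -> C) (w : C) :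
  normal_parameter a1 a2 W U g h psi -> W w ->
  first_constant g h (psi w) = a1 /\ second_constant g h (psi w) = a2.
Proof.
  intros Hn Hw.
  assert (E1 : first_constant g h (psi w) = a1).
  { unfold first_constant. rewrite (normal_eta U W g psi h a1 a2 HU Hg Hg' Hh Hn w Hw).
    unfold Ymap. rewrite Tfun_eq, (normal_modulus a1 a2 W psi w Hn Hw).
    rewrite (proj1 (proj2 Hn w Hw)). unfold rotation_point, M1_profile, Cexp. triples.
    replace (2 * Re w) with (Re w + Re w) by ring. rewrite exp_plus.
    unfold Re, Im; cbn [fst snd]. pose proof (exp_pos (fst w)).
    pose proof (sin2_cos2 (snd w)) as K. unfold Rsqr in K.
    transitivity (a1 * (sin (snd w) * sin (snd w) + cos (snd w) * cos (snd w))); [|rewrite K; ring].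
    field. split; nra. }
  split; [exact E1|].
  unfold second_constant. rewrite E1, (normal_modulus a1 a2 W psi w Hn Hw), ln_exp.
  rewrite (normal_eta U W g psi h a1 a2 HU Hg Hg' Hh Hn w Hw).
  unfold rotation_point, N1_profile. triples. field.
Qed.

Lemma normal_form_global :
  (forall z0, U z0 -> exists a1 a2 W psi, normal_parameter a1 a2 W U g h psi /\
     exists w0, W w0 /\ psi w0 = z0) ->
  exists a1 a2, normal_form_on a1 a2 U g h.
Proof.
  intros Hloc.
  destruct (classic (exists z, U z)) as [[z1 Hz1]|Hempty].
  (* [dom_connected] admits the empty set, where any constants do. *)
  2:{ exists 0, 0. intros z0 Hz0. exfalso. apply Hempty. exists z0. exact Hz0. }
  assert (Hd : forall z, U z -> dif (first_constant g h) z 0 0 /\ dif (second_constant g h) z 0 0).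
  { intros z Hz. destruct (Hloc z Hz) as (a1 & a2 & W & psi & Hn & w & Hw & <-).
    pose proof (proj1 Hn) as Hconf.
    destruct (vsmooth_vdif U _ _ HU eta_smooth Hz) as (E1 & E2 & E3).
    destruct (vsmooth_vdif U _ _ HU HYs Hz) as (Y1 & Y2 & Y3).
    pose proof Hg as (_ & Ga & Gb).
    pose proof (smooth_dif U _ _ HU Ga Hz) as Da. pose proof (smooth_dif U _ _ HU Gb Hz) as Db.
    assert (D1 : exists a b, dif (first_constant g h) (psi w) a b)
      by (unfold first_constant; do 2 eexists; difs).
    destruct D1 as (a & b & D1).
    assert (Dm : exists a b, dif (fun z => Re (g z) * Re (g z) + Im (g z) * Im (g z)) (psi w) a b)
      by (do 2 eexists; difs).
    destruct Dm as (ma & mb & Dm).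
    (* In a chart |g|^2 = e^(2u), so the logarithm in [second_constant] is differentiable. *)
    assert (Hm : 0 < Re (g (psi w)) * Re (g (psi w)) + Im (g (psi w)) * Im (g (psi w)))
      by (rewrite (normal_modulus a1 a2 W psi w Hn Hw); apply exp_pos).
    pose proof (dif_comp1 ln _ _ _ _ _ (is_derive_ln _ Hm) Dm) as Dl.
    assert (D2 : exists a b, dif (second_constant g h) (psi w) a b)
      by (unfold second_constant; do 2 eexists; difs).
    destruct D2 as (a' & b' & D2).
    destruct (dif_zero_of_chart U W psi (first_constant g h) w a1 a b Hconf Hw) as [-> ->]; auto.
    { intros x Hx. apply (normal_constants a1 a2 W psi x Hn Hx). }
    destruct (dif_zero_of_chart U W psi (second_constant g h) w a2 a' b' Hconf Hw) as [-> ->]; auto.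
    intros x Hx. apply (normal_constants a1 a2 W psi x Hn Hx). }
  exists (first_constant g h z1), (second_constant g h z1).
  intros z0 Hz0. destruct (Hloc z0 Hz0) as (a1 & a2 & W & psi & Hn & w & Hw & E).
  destruct (normal_constants a1 a2 W psi w Hn Hw) as [K1 K2]. rewrite E in K1, K2.
  rewrite (locally_const_connected U _ HU Hcon (fun z Hz => proj1 (Hd z Hz)) z1 z0 Hz1 Hz0), K1.
  rewrite (locally_const_connected U _ HU Hcon (fun z Hz => proj2 (Hd z Hz)) z1 z0 Hz1 Hz0), K2.
  exists W, psi. split; [exact Hn|]. exists w; auto.
Qed.

Lemma conformal_change_of_parameters (W : C -> Prop) (psi : C -> C) :
  conformal_parameter W U psi -> change_of_parameters W U psi.
Proof.
  intros (HW & Hp & HWU & Hinj & H0).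
  split; [exact HW|]. split; [apply Hp|]. split; [apply Hp|]. split; [exact HWU|]. split; [exact Hinj|].
  intros w Hw. destruct (holomorphic_CR W psi w Hp Hw) as (-> & -> & -> & ->).
  pose proof (C_neq0_sqr _ (H0 w Hw)). nra.
Qed.

Lemma normal_form_laplace (a1 a2 : R) : normal_form_on a1 a2 U g h ->
  forall z, U z -> laplace_condition (conformal_factor g) h z.
Proof.
  intros Hn z Hz. destruct (Hn z Hz) as (W & psi & Hp & w & Hw & <-).
  exact (normal_laplace U W g psi h a1 a2 HU Hg Hg' Hh Hp w Hw).
Qed.

Lemma normal_form_rotation (a1 a2 : R) (F : C -> R3) (M N : R -> R) :
  (forall W psi, normal_parameter a1 a2 W U g h psi -> forall z, W z ->
     F (psi z) = rotation_point (M (Re z)) (N (Re z)) (Im z)) ->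
  normal_form_on a1 a2 U g h -> surface_of_rotation_on U F.
Proof.
  intros HF Hn z Hz. destruct (Hn z Hz) as (W & psi & Hp & Hw).
  exists W, psi, M, N. split; [apply conformal_change_of_parameters, Hp|]. split; [exact Hw|].
  intros w Hw'. exact (HF W psi Hp w Hw').
Qed.

(** Serves both [eta] with normal [Y] and X with normal N. In the hypothesis on [Ymap] and [h], the
    values p', q', k depend on the profile data alone, neither on the point nor on the angle; this
    makes [Y] rotational and [h] a function of u. *)
Lemma rotation_normal_form_on (F nu : C -> R3) :
  vsmooth U F -> vsmooth U nu -> (forall z, U z -> dot (nu z) (nu z) = 1) ->
  (forall z, U z -> dot (D1 F z) (nu z) = 0 /\ dot (D2 F z) (nu z) = 0) ->
  immersion_on U F -> (forall z, U z -> laplace_condition (conformal_factor g) h z) ->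
  (forall m n p q, exists p' q' k, forall z v, U z ->
     F z = rotation_point m n v -> nu z = rotation_point p q v ->
     Ymap g z = rotation_point p' q' v /\ h z = k) ->
  surface_of_rotation_on U F -> exists a1 a2, normal_form_on a1 a2 U g h.
Proof.
  intros HF Hnu Hunit Htan Himm HL HYh Hrot. apply normal_form_global.
  intros z0 Hz0. destruct (Hrot z0 Hz0) as (W & phi & M & N & Hphi & (w0 & Hw0 & <-) & HFr).
  pose proof Hphi as (HW & _ & _ & HWU & _).
  destruct (open_box W w0 HW Hw0) as (d & Hd & Hb).
  destruct (rotation_normal_profile U W F nu phi M N HU HF Hnu Hunit Htan Himm Hphi HFr
    (fst w0) (snd w0) d Hb) as (p & q & Hpq).
  assert (Hex : exists p' q' k : R -> R, forall u v, Rabs (u - fst w0) < d -> Rabs (v - snd w0) < d ->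
    Ymap g (phi (u, v)) = rotation_point (p' u) (q' u) v /\ h (phi (u, v)) = k u).
  (* Radial and vertical components of [Y], and [h], on the slice v = v0: explicit functions of u,
     read off rather than chosen. *)
  { exists (fun u => coord1 (Ymap g (phi (u, snd w0))) * cos (snd w0) + coord2 (Ymap g (phi (u,
      snd w0))) * sin (snd w0)),
      (fun u => coord3 (Ymap g (phi (u, snd w0)))), (fun u => h (phi (u, snd w0))).
    intros u v Hu Hv.
    assert (Hv0 : Rabs (snd w0 - snd w0) < d) by (rewrite Rminus_diag, Rabs_R0; exact Hd).
    destruct (HYh (M u) (N u) (p u) (q u)) as (p' & q' & k & Hk).
    destruct (Hk _ _ (HWU _ (Hb u v Hu Hv)) (HFr _ (Hb u v Hu Hv)) (Hpq u v Hu Hv)) as [-> ->].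
    destruct (Hk _ _ (HWU _ (Hb u _ Hu Hv0)) (HFr _ (Hb u _ Hu Hv0)) (Hpq u _ Hu Hv0)) as [E1 E2].
    split; [|symmetry; exact E2]. change (Im (u, snd w0)) with (snd w0) in E1.
    rewrite E1. unfold rotation_point. triples.
    pose proof (sin2_cos2 (snd w0)) as K. unfold Rsqr in K.
    replace (p' * cos (snd w0) * cos (snd w0) + p' * sin (snd w0) * sin (snd w0)) with p'; [reflexivity|].
    transitivity (p' * (sin (snd w0) * sin (snd w0) + cos (snd w0) * cos (snd w0))); [rewrite K; ring|ring]. }
  destruct Hex as (p' & q' & k & Hk).
  destruct (rotation_normal_parameter U W g phi h p' q' k (fst w0) (snd w0) d HU Hg Hg' Hh HL Hphi Hd Hb
    (fun u v Hu Hv => proj1 (Hk u v Hu Hv)) (fun u v Hu Hv => proj2 (Hk u v Hu Hv)))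
    as (a1 & a2 & W' & psi & Hn & w1 & Hw1 & E).
  exists a1, a2, W', psi. split; [exact Hn|]. exists w1. split; [exact Hw1|].
  rewrite E, <- surjective_pairing. reflexivity.
Qed.

Lemma eta_normal_form : immersion_on U (eta g h) -> minimal_on U (eta g h) (Ymap g) ->
  surface_of_rotation_on U (eta g h) -> exists a1 a2, normal_form_on a1 a2 U g h.
Proof.
  intros Himm Hmin. apply (rotation_normal_form_on (eta g h) (Ymap g)); auto.
  - exact eta_smooth.
  - intros z Hz. apply (HYf z Hz).
  - intros z Hz. rewrite eta_support_surface.
    destruct (support_surface_D U _ _ _ HU HYs HYf Hh z Hz) as (K1 & K2 & _). auto.
  - rewrite eta_support_surface in Hmin.
    exact (minimal_laplace U _ _ _ HU HYs HYf Hh Hmin).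
  (* The normal is [Y] itself, and h = <eta, Y> is computed from the two profiles. *)
  - intros m n p q. exists p, q, (m * p + n * q). intros z v Hz E1 E2. split; [exact E2|].
    rewrite <- (dot_rotation m n p q v), <- E1, <- E2, eta_support_surface. symmetry.
    apply (support_surface_dot U _ _ _ HU HYs HYf z Hz).
Qed.

Lemma X_normal_form (c : R) : c <> 0 -> immersion_on U (Xmap g c h) ->
  H1_surface_on U (Xmap g c h) (Nmap g h) ->
  surface_of_rotation_on U (Xmap g c h) -> exists a1 a2, normal_form_on a1 a2 U g h.
Proof.
  intros Hc Himm HH.
  assert (EX : Xmap g c h = reflected (Ymap g) (support_surface (Ymap g) (conformal_factor g) h) (fun z =>
      h z + c))
    by (rewrite <- eta_support_surface; reflexivity).
  assert (EN : Nmap g h = reflected (Ymap g) (support_surface (Ymap g) (conformal_factor g) h) h)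
    by (rewrite <- eta_support_surface; reflexivity).
  rewrite EX, EN in *.
  apply (rotation_normal_form_on _ (reflected (Ymap g) (support_surface (Ymap g) (conformal_factor g) h)
      h)); auto.
  - apply (reflected_smooth U _ _ _ HU HYs HYf Hh Hh0). apply smooth_plus; auto using smooth_const.
  - apply (reflected_smooth U _ _ _ HU HYs HYf Hh Hh0); auto.
  - intros z Hz.
    (* The case k = 0, which is |N|^2 = 1. *)
    destruct (reflected_dot U _ _ _ HU HYs HYf Hh0 h 0 z Hz ltac:(ring)) as [-> _].
    pose proof (support_surface_norm U _ _ _ HU HYs HYf Hh0 z Hz). field. lra.
  - intros z Hz. exact (support_surface_tangent U _ _ _ c z HU HYs HYf Hh Hh0 Hz).
  - exact (H1_laplace U _ _ _ c HU HYs HYf Hh Hc Hh0 HH).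
  (* [reflected_rotation] supplies the witnesses: the profile of the centres divided by 1 + rho, and
     - c / (1 + rho) for [h]. *)
  - intros m n p q. do 3 eexists. intros z v Hz E1 E2.
    destruct (reflected_rotation U _ _ _ c z m n p q v HU HYs HYf Hh Hh0 Hc Hz E1 E2) as [K1 K2].
    split; [exact K2|exact K1].
Qed.
End Main.

(** Each equivalence carries its own immersion hypothesis, as one map can degenerate: on the normal
    form with a1 = 0, [eta] is the constant (0, 0, a2). *)
Theorem proposition4p1 :
  forall (U : C -> Prop) (g : C -> C) (c : R) (h : C -> R),
    open U -> dom_connected U ->
    holomorphic_on U g -> (forall z, U z -> C_derive g z <> 0%C) ->
    c <> 0 ->
    smooth_on U h -> (forall z, U z -> h z <> 0) ->
    (immersion_on U (Xmap g c h) ->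
       (H1_surface_on U (Xmap g c h) (Nmap g h) /\
        surface_of_rotation_on U (Xmap g c h)
        <-> exists a1 a2 : R, normal_form_on a1 a2 U g h)) /\
    (immersion_on U (eta g h) ->
       (minimal_on U (eta g h) (Ymap g) /\
        surface_of_rotation_on U (eta g h)
        <-> exists a1 a2 : R, normal_form_on a1 a2 U g h)) /\
    (forall (a1 a2 : R) (W : C -> Prop) (psi : C -> C),
       normal_parameter a1 a2 W U g h psi ->
       forall z, W z ->
         Xmap g c h (psi z) =
           rotation_point (M_profile c a1 a2 (Re z)) (N_profile c a1 a2 (Re z)) (Im z) /\
         eta g h (psi z) =
           rotation_point (M1_profile a1 (Re z)) (N1_profile a1 a2 (Re z)) (Im z)).
Proof.
  intros U g c h HU Hcon Hg Hg' Hc Hh Hh0.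
  assert (HYs := Ymap_smooth U g HU Hg).
  assert (HYf := fun z Hz => Ymap_frame U g z HU Hg Hz (Hg' z Hz)).
  split; [|split].
  - intros Himm. split.
    + intros [HH Hrot]. exact (X_normal_form U g h HU Hcon Hg Hg' Hh Hh0 c Hc Himm HH Hrot).
    + intros (a1 & a2 & Hn). split.
      * unfold Xmap, Nmap, Sfun in *. rewrite eta_support_surface in *.
        apply (laplace_H1 U _ _ _ c HU HYs HYf Hh Hc Hh0 Himm).
        exact (normal_form_laplace U g h HU Hg Hg' Hh a1 a2 Hn).
      * refine (normal_form_rotation U g h a1 a2 _ _ _ _ Hn).
        intros W psi Hp z Hz. exact (normal_X U W g psi h a1 a2 HU Hg Hg' Hh Hh0 Hp c z Hz).
  - intros Himm. split.
    + intros [HH Hrot]. exact (eta_normal_form U g h HU Hcon Hg Hg' Hh Himm HH Hrot).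
    + intros (a1 & a2 & Hn). split.
      * rewrite eta_support_surface in *.
        apply (laplace_minimal U _ _ _ HU HYs HYf Hh Himm).
        exact (normal_form_laplace U g h HU Hg Hg' Hh a1 a2 Hn).
      * refine (normal_form_rotation U g h a1 a2 _ _ _ _ Hn).
        intros W psi Hp z Hz. exact (normal_eta U W g psi h a1 a2 HU Hg Hg' Hh Hp z Hz).
  - intros a1 a2 W psi Hn z Hz. split.
    + exact (normal_X U W g psi h a1 a2 HU Hg Hg' Hh Hh0 Hn c z Hz).
    + exact (normal_eta U W g psi h a1 a2 HU Hg Hg' Hh Hn z Hz).
Qed.
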